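(* Let $G$ be a finite group and $H$ a normal subgroup of $G$. Let $\mathcal{C}=\mathcal{C}(G,1,H,1)$ be the group-theoretical category with trivial $3$-cocycle and trivial $2$-cochain, and let $U(\mathcal{C})$ be its universal grading group. Then there is a split exact sequence of groups $$1\to Z(H)\to U(\mathcal{C})\to G/H\to 1,$$ where $Z(H)$ is the center of $H$. Therefore, $U(\mathcal{C})$ is isomorphic to the semi-direct product $G/H\ltimes Z(H)$ (with respect to the action of $G/H$ on $Z(H)$ determined by the splitting).
   Context: $k$ is an algebraically closed field of characteristic $0$. Fusion categories are over $k$ (semisimple, rigid, $k$-linear tensor categories with finitely many isomorphism classes of simple objects, finite-dimensional Hom-spaces, and simple unit object). $\mathcal{C}(G,1,H,1)$ is the fusion category of $k[H]$-bimodules in the category $\mathrm{Vec}_G$ of finite-dimensional $G$-graded $k$-vector spaces (with trivial associativity), where the group algebra $k[H]$ is graded in the obvious way; the tensor product is $\otimes_{k[H]}$ and the unit object is $k[H]$. Universal grading group: for a fusion category $\mathcal{C}$, $\mathcal{C}_{ad}$ is the full fusion subcategory generated by all simple subobjects of $X\otimes X^*$, $X$ a simple object of $\mathcal{C}$. As a $\mathcal{C}_{ad}$-bimodule category, $\mathcal{C}$ decomposes into a direct sum of indecomposable $\mathcal{C}_{ad}$-bimodule categories $\mathcal{C}=\bigoplus_{a\in A}\mathcal{C}_a$. The index set $A$ carries a canonical group structure, characterized by $\mathcal{C}_a\otimes\mathcal{C}_b\subseteq\mathcal{C}_{ab}$; this group is the universal grading group $U(\mathcal{C})$. *)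

(* Defs.v *)
From HB Require Import structures.
From mathcomp Require Import all_boot all_algebra all_fingroup all_solvable all_field.
From mathcomp Require Import boolp.

Set Implicit Arguments.
Unset Strict Implicit.
Unset Printing Implicit Defensive.

Import GRing.Theory.
Local Open Scope ring_scope.

Record moncat (k : fieldType) := Moncat {
  cobj :> Type;
  chom : cobj -> cobj -> lmodType k;
  cid : forall X, chom X X;
  ccomp : forall X Y Z, chom Y Z -> chom X Y -> chom X Z;
  tens : cobj -> cobj -> cobj;
  tensm : forall X X' Y Y',
    chom X X' -> chom Y Y' -> chom (tens X Y) (tens X' Y');
  cunit : cobj;
  assoc : forall X Y Z, chom (tens (tens X Y) Z) (tens X (tens Y Z));
  assoc_inv : forall X Y Z, chom (tens X (tens Y Z)) (tens (tens X Y) Z);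
  lunitor : forall X, chom (tens cunit X) X;
  lunitor_inv : forall X, chom X (tens cunit X);
  runitor : forall X, chom (tens X cunit) X;
  runitor_inv : forall X, chom X (tens X cunit);
  ccompA : forall X Y Z W (f : chom Z W) (g : chom Y Z) (h : chom X Y),
    ccomp f (ccomp g h) = ccomp (ccomp f g) h;
  ccomp1m : forall X Y (f : chom X Y), ccomp (cid Y) f = f;
  ccompm1 : forall X Y (f : chom X Y), ccomp f (cid X) = f;
  ccomp_linl : forall X Y Z (g : chom X Y), linear (fun f : chom Y Z => ccomp f g);
  ccomp_linr : forall X Y Z (f : chom Y Z), linear (fun g : chom X Y => ccomp f g);
  tensm1 : forall X Y, tensm (cid X) (cid Y) = cid (tens X Y);
  tensm_comp : forall X Y Z X' Y' Z' (f : chom Y Z) (g : chom X Y)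
      (f' : chom Y' Z') (g' : chom X' Y'),
    tensm (ccomp f g) (ccomp f' g') = ccomp (tensm f f') (tensm g g');
  tensm_linl : forall X X' Y Y' (g : chom Y Y'),
    linear (fun f : chom X X' => tensm f g);
  tensm_linr : forall X X' Y Y' (f : chom X X'),
    linear (fun g : chom Y Y' => tensm f g);
  assocK : forall X Y Z, ccomp (assoc_inv X Y Z) (assoc X Y Z) = cid _;
  associK : forall X Y Z, ccomp (assoc X Y Z) (assoc_inv X Y Z) = cid _;
  lunK : forall X, ccomp (lunitor_inv X) (lunitor X) = cid _;
  luniK : forall X, ccomp (lunitor X) (lunitor_inv X) = cid _;
  runK : forall X, ccomp (runitor_inv X) (runitor X) = cid _;
  runiK : forall X, ccomp (runitor X) (runitor_inv X) = cid _;
  assoc_nat : forall X X' Y Y' Z Z'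
      (f : chom X X') (g : chom Y Y') (h : chom Z Z'),
    ccomp (assoc X' Y' Z') (tensm (tensm f g) h) =
    ccomp (tensm f (tensm g h)) (assoc X Y Z);
  lun_nat : forall X Y (f : chom X Y),
    ccomp (lunitor Y) (tensm (cid cunit) f) = ccomp f (lunitor X);
  run_nat : forall X Y (f : chom X Y),
    ccomp (runitor Y) (tensm f (cid cunit)) = ccomp f (runitor X);
  pentagon : forall X Y Z W,
    ccomp (assoc X Y (tens Z W)) (assoc (tens X Y) Z W) =
    ccomp (tensm (cid X) (assoc Y Z W))
         (ccomp (assoc X (tens Y Z) W) (tensm (assoc X Y Z) (cid W)));
  triangle : forall X Y,
    ccomp (tensm (cid X) (lunitor Y)) (assoc X cunit Y) = tensm (runitor X) (cid Y)
}.

Arguments cid {k m} X.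
Arguments ccomp {k m X Y Z} _ _.
Arguments tens {k m} _ _.
Arguments tensm {k m X X' Y Y'} _ _.
Arguments cunit {k m}.
Arguments assoc {k m} X Y Z.
Arguments assoc_inv {k m} X Y Z.
Arguments lunitor {k m} X.
Arguments lunitor_inv {k m} X.
Arguments runitor {k m} X.
Arguments runitor_inv {k m} X.

Section UniversalGrading.
Variables (k : fieldType) (C : moncat k).

(* A full subcategory of C is given by a predicate on the objects of C. *)
Implicit Types D M : C -> Prop.

Definition is_zero (X : C) : Prop := cid X = 0.

Definition is_mono (X Y : C) (f : chom X Y) : Prop :=
  forall W (g h : chom W X), ccomp f g = ccomp f h -> g = h.

Definition is_iso (X Y : C) (f : chom X Y) : Prop :=
  exists g : chom Y X, ccomp g f = cid X /\ ccomp f g = cid Y.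

Definition subobject (X Y : C) : Prop := exists f : chom X Y, is_mono f.

Definition simple_obj (X : C) : Prop :=
  ~ is_zero X /\
  forall Y (f : chom Y X), is_mono f -> is_zero Y \/ is_iso f.

Definition is_dsum (I : finType) (Y : I -> C) (X : C) : Prop :=
  exists (inj : forall i, chom (Y i) X) (prj : forall i, chom X (Y i)),
    [/\ forall i, ccomp (prj i) (inj i) = cid (Y i),
        forall i j, i != j -> ccomp (prj j) (inj i) = 0
      & \sum_i ccomp (inj i) (prj i) = cid X].

Definition is_dual (X D : C) : Prop :=
  exists (ev : chom (tens D X) cunit) (coev : chom cunit (tens X D)),
    ccomp (runitor X) (ccomp (tensm (cid X) ev)
      (ccomp (assoc X D X) (ccomp (tensm coev (cid X)) (lunitor_inv X)))) = cid X /\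
    ccomp (lunitor D) (ccomp (tensm ev (cid D))
      (ccomp (assoc_inv D X D) (ccomp (tensm (cid D) coev) (runitor_inv D)))) = cid D.

(* Closure under subobjects includes closure under isomorphism, and closure
   under direct sums includes the zero objects. *)
Definition fusion_subcat D : Prop :=
  D cunit /\
  (forall X Y, D X -> D Y -> D (tens X Y)) /\
  (forall X Y, D X -> is_dual X Y -> D Y) /\
  (forall (I : finType) (Y : I -> C) X,
     (forall i, D (Y i)) -> is_dsum Y X -> D X) /\
  (forall X Y, D Y -> subobject X Y -> D X).

(* C_ad, as the smallest full fusion subcategory containing the simple
   subobjects of Y (x) Y^* for Y simple *)
Definition adjoint_subcat (X : C) : Prop :=
  forall D, fusion_subcat D ->
    (forall Y Y' S, simple_obj Y -> is_dual Y Y' -> simple_obj S ->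
       subobject S (tens Y Y') -> D S) ->
    D X.

Definition sub_bimodule_cat D M : Prop :=
  [/\ forall (I : finType) (Y : I -> C) X,
        (forall i, M (Y i)) -> is_dsum Y X -> M X,
      forall X Y, M Y -> subobject X Y -> M X,
      forall X Y, D X -> M Y -> M (tens X Y)
    & forall X Y, M X -> D Y -> M (tens X Y)].

(* M is the direct sum of the D-bimodule categories N i. *)
Definition dsum_bimodule_cat D M (I : finType) (N : I -> C -> Prop) : Prop :=
  [/\ forall i, sub_bimodule_cat D (N i),
      forall i X, N i X -> M X,
      forall X, M X -> exists2 Y : I -> C, forall i, N i (Y i) & is_dsum Y X
    & forall i j X Y (f : chom X Y), i != j -> N i X -> N j Y -> f = 0].

Definition zero_cat M : Prop := forall X, M X -> is_zero X.

Definition indecomposable_bimodule_cat D M : Prop :=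
  ~ zero_cat M /\
  forall N : bool -> C -> Prop,
    dsum_bimodule_cat D M N -> exists b, zero_cat (N b).

(* The universal grading group is specified, up to isomorphism, by its
   characterization: its elements index the indecomposable C_ad-bimodule
   components Cg a of C, and Cg a (x) Cg b is contained in Cg (ab). *)
Definition universal_grading (U : finGroupType) (Cg : U -> C -> Prop) : Prop :=
  [/\ dsum_bimodule_cat adjoint_subcat (fun _ => True) Cg,
      forall a, indecomposable_bimodule_cat adjoint_subcat (Cg a)
    & forall a b X Y, Cg a X -> Cg b Y -> Cg (a * b)%g (tens X Y)].

End UniversalGrading.

Section LinearFacts.
Variable k : fieldType.

Lemma linfunE (U V : vectType k) (f : U -> V) : linear f -> linfun f =1 f.
Proof.
move=> lf.
pose g : {linear U -> V} := HB.pack f (GRing.isLinear.Build k U V *:%R f lf).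
exact: (lfunE g).
Qed.

Lemma linear_D (U V : lmodType k) (f : U -> V) :
  linear f -> forall x y, f (x + y) = f x + f y.
Proof. by move=> lf x y; have := lf 1 x y; rewrite !scale1r. Qed.

Lemma linear_0 (U V : lmodType k) (f : U -> V) : linear f -> f 0 = 0.
Proof.
move=> lf; have := linear_D lf 0 0; rewrite addr0 => /eqP.
by rewrite eq_sym -subr_eq0 addrK => /eqP.
Qed.

Lemma linear_Z (U V : lmodType k) (f : U -> V) :
  linear f -> forall c x, f (c *: x) = c *: f x.
Proof. by move=> lf c x; have := lf c x 0; rewrite addr0 (linear_0 lf) addr0. Qed.

Lemma linear_S (U V : lmodType k) (f : U -> V) I (r : seq I) P F :
  linear f -> f (\sum_(i <- r | P i) F i) = \sum_(i <- r | P i) f (F i).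
Proof.
move=> lf; apply: (big_morph f); first exact: linear_D.
exact: linear_0.
Qed.

Lemma linear_B (U V : lmodType k) (f : U -> V) :
  linear f -> forall x y, f (x - y) = f x - f y.
Proof.
by move=> lf x y; rewrite (linear_D lf) -scaleN1r (linear_Z lf) scaleN1r.
Qed.

Lemma linear_comp (U V W : lmodType k) (f : V -> W) (g : U -> V) :
  linear f -> linear g -> linear (fun x => f (g x)).
Proof. by move=> lf lg c x y; rewrite lg lf. Qed.

Lemma linear_sumf (U V : lmodType k) I (r : seq I) (P : pred I)
    (F : I -> U -> V) :
  (forall i, P i -> linear (F i)) -> linear (fun x => \sum_(i <- r | P i) F i x).
Proof.
move=> lF c x y; rewrite scaler_sumr -big_split; apply: eq_bigr => i Pi.
exact: lF.
Qed.

Lemma vbasis_ind (V : vectType k) (U : {vspace V}) (P : V -> Prop) :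
  P 0 -> (forall c x y, P x -> P y -> P (c *: x + y)) ->
  (forall v, v \in vbasis U -> P v) -> forall v, v \in U -> P v.
Proof.
move=> P0 PD Pb v /coord_vbasis->; apply: big_ind => //.
  by move=> x y Px Py; rewrite -[x]scale1r; apply: PD.
move=> i _; rewrite -[_ *: _]addr0; apply: PD => //.
by apply: Pb; apply: mem_nth; rewrite size_tuple.
Qed.

Lemma sumv_ind (V : vectType k) (I : finType) (Us : I -> {vspace V})
    (P : V -> Prop) :
  P 0 -> (forall x y, P x -> P y -> P (x + y)) ->
  (forall i v, v \in Us i -> P v) -> forall v, v \in (\sum_i Us i)%VS -> P v.
Proof.
move=> P0 PD Pb v /memv_sumP[vs vsP ->]; apply: big_ind => // i _.
by apply: Pb (vsP i isT).
Qed.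

Lemma directv_proj (V : vectType k) (I : finType) (Us : I -> {vspace V})
    (p : I -> V -> V) :
  (forall i, linear (p i)) -> (forall i v, v \in Us i -> p i v = v) ->
  (forall i j v, i != j -> v \in Us j -> p i v = 0) ->
  directv (\sum_i Us i)%VS.
Proof.
move=> lp pid p0; apply/directv_sum_independent => us Us_us sum0 i _.
have := linear_0 (lp i); rewrite -sum0 (linear_S _ _ _ (lp i)) (bigD1 i) //=.
rewrite big1 ?addr0 ?pid ?Us_us // => j ne_ji.
by apply: (p0 i j); rewrite ?Us_us // eq_sym.
Qed.

End LinearFacts.

Definition is_grading (k : fieldType) (G : finType) (V : vectType k)
    (gr : G -> {vspace V}) : Prop :=
  (\sum_g gr g)%VS = fullv /\ directv (\sum_g gr g)%VS.

Section GradingFacts.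
Variables (k : fieldType) (G : finType) (V : vectType k) (gr : G -> {vspace V}).
Hypothesis gr_gr : is_grading gr.

Lemma grading_ind (P : V -> Prop) :
  P 0 -> (forall x y, P x -> P y -> P (x + y)) ->
  (forall g v, v \in gr g -> P v) -> forall v, P v.
Proof.
by move=> P0 PD Pb v; apply: (sumv_ind P0 PD Pb); rewrite (proj1 gr_gr) memvf.
Qed.

End GradingFacts.

Definition grpi (k : fieldType) (G : finType) (V : vectType k)
  (gr : G -> {vspace V}) (g : G) : V -> V := sumv_pi (\sum_g gr g)%VS g.

Section GradingProj.
Variables (k : fieldType) (G : finType) (V : vectType k) (gr : G -> {vspace V}).

Lemma grpi_linear g : linear (grpi gr g).
Proof. by move=> c x y; rewrite /grpi linearP. Qed.

Lemma grpi_mem g v : grpi gr g v \in gr g.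
Proof. exact: memv_sum_pi. Qed.

Hypothesis gr_gr : is_grading gr.

Lemma grpi_sum v : \sum_g grpi gr g v = v.
Proof. by apply: sumv_pi_sum; rewrite (proj1 gr_gr) memvf. Qed.

Lemma grpi_delta g h v : v \in gr h -> grpi gr g v = if g == h then v else 0.
Proof.
move=> vh; have /directv_sum_independent dir := proj2 gr_gr.
pose u i := grpi gr i v - (if i == h then v else 0).
suff /eqP : u g = 0 by rewrite subr_eq0 => /eqP.
apply: dir => // [i _|].
  by apply: memvB; [exact: grpi_mem | case: eqP => [->|_] //; rewrite mem0v].
by rewrite sumrB grpi_sum -big_mkcond big_pred1_eq subrr.
Qed.

End GradingProj.

Section Bimodules.
Variables (k : fieldType) (G : finGroupType).

(* An algebra in Vec_G is a finite-dimensional G-graded algebra. *)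
Record galg := GAlg {
  galg_alg :> falgType k;
  galg_gr : G -> {vspace galg_alg};
  galg_grP : is_grading galg_gr;
  galg_gr1 : 1 \in galg_gr 1%g;
  galg_grM : forall g h a b,
    a \in galg_gr g -> b \in galg_gr h -> a * b \in galg_gr (g * h)%g
}.

Variable A : galg.

(* An A-bimodule in Vec_G: the structure maps A (x) M -> M and M (x) A -> M are
   bilinear and compatible with the gradings. *)
Record bimod := Bimod {
  bcar :> vectType k;
  bgr : G -> {vspace bcar};
  lact : A -> bcar -> bcar;
  ract : bcar -> A -> bcar;
  bgrP : is_grading bgr;
  lact_linl : forall m, linear (lact^~ m);
  lact_linr : forall a, linear (lact a);
  ract_linl : forall a, linear (ract^~ a);
  ract_linr : forall m, linear (ract m);
  lact1 : forall m, lact 1 m = m;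
  lactM : forall a b m, lact (a * b) m = lact a (lact b m);
  ract1 : forall m, ract m 1 = m;
  ractM : forall m a b, ract m (a * b) = ract (ract m a) b;
  lract : forall a m b, ract (lact a m) b = lact a (ract m b);
  lact_gr : forall g h a m,
    a \in galg_gr A g -> m \in bgr h -> lact a m \in bgr (g * h)%g;
  ract_gr : forall g h m a,
    m \in bgr g -> a \in galg_gr A h -> ract m a \in bgr (g * h)%g
}.

Definition is_bimod_hom (M N : bimod) (f : 'Hom(M, N)) : Prop :=
  [/\ forall a m, f (lact a m) = lact a (f m),
      forall m a, f (ract m a) = ract (f m) a
    & forall g m, m \in bgr M g -> f m \in bgr N g].

Definition bimod_homb (M N : bimod) : {pred 'Hom(M, N)} :=
  fun f => `[< is_bimod_hom f >].

Fact bimod_homb_submod (M N : bimod) : submod_closed (@bimod_homb M N).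
Proof.
split=> [|c f g]; rewrite !unfold_in.
  apply/asboolP; split=> *; rewrite !lfunE /= ?mem0v //.
    by rewrite (linear_0 (lact_linr _)).
  by rewrite (linear_0 (ract_linl _)).
move=> /asboolP[fl fr fg] /asboolP[gl gr gg].
apply/asboolP; split=> *; rewrite !lfunE /= !lfunE /=.
- by rewrite fl gl lact_linr.
- by rewrite fr gr ract_linl.
- by rewrite memvD ?memvZ ?fg ?gg.
Qed.

HB.instance Definition _ (M N : bimod) :=
  GRing.isSubmodClosed.Build k 'Hom(M, N) (@bimod_homb M N)
    (@bimod_homb_submod M N).

Record bimod_hom (M N : bimod) :=
  BimodHom { bhom_val :> 'Hom(M, N); _ : bhom_val \in @bimod_homb M N }.

HB.instance Definition _ M N := [isSub for @bhom_val M N].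
HB.instance Definition _ M N := [Choice of bimod_hom M N by <:].
HB.instance Definition _ M N := [SubChoice_isSubZmodule of bimod_hom M N by <:].
HB.instance Definition _ M N := [SubZmodule_isSubLmodule of bimod_hom M N by <:].

End Bimodules.

Section BimoduleHoms.
Variables (k : fieldType) (G : finGroupType) (A : galg k G).
Implicit Types M N P : bimod A.

Lemma bhomP M N (f : bimod_hom M N) : is_bimod_hom f.
Proof. exact/asboolP/(valP f). Qed.

Lemma bhom_lact M N (f : bimod_hom M N) a m : f (lact a m) = lact a (f m).
Proof. by case: (bhomP f). Qed.

Lemma bhom_ract M N (f : bimod_hom M N) m a : f (ract m a) = ract (f m) a.
Proof. by case: (bhomP f). Qed.

Lemma bhom_gr M N (f : bimod_hom M N) g m : m \in bgr M g -> f m \in bgr N g.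
Proof. by case: (bhomP f) => _ _; apply. Qed.

Lemma bhom_linear M N (f : bimod_hom M N) : linear f.
Proof. by move=> c x y; rewrite linearP. Qed.

Lemma bhom_eq M N (f g : bimod_hom M N) : f =1 g -> f = g.
Proof. by move=> fg; apply/val_inj/lfunP. Qed.

Lemma bhom_linE M N (c : k) (f g : bimod_hom M N) m :
  (c *: f + g) m = c *: f m + g m.
Proof. by rewrite lfunE /= lfunE. Qed.

Definition mkhom M N (f : M -> N) (lf : linear f)
    (fl : forall a m, f (lact a m) = lact a (f m))
    (fr : forall m a, f (ract m a) = ract (f m) a)
    (fg : forall g m, m \in bgr M g -> f m \in bgr N g) : bimod_hom M N.
Proof.
exists (linfun f); apply/asboolP.
by split=> *; rewrite !(linfunE lf) //; apply: fg.
Defined.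

Lemma mkhomE M N (f : M -> N) lf fl fr fg : @mkhom M N f lf fl fr fg =1 f.
Proof. exact: linfunE. Qed.

Definition bid M : bimod_hom M M.
Proof. exact: (@mkhom M M id). Defined.

Definition bcomp M N P (f : bimod_hom N P) (g : bimod_hom M N) : bimod_hom M P.
Proof.
apply: (@mkhom M P (fun m => f (g m))) => [|a m|m a|x m mx].
- by apply: linear_comp; apply: bhom_linear.
- by rewrite !bhom_lact.
- by rewrite !bhom_ract.
- by do 2!apply: bhom_gr.
Defined.

Lemma bidE M : bid M =1 id. Proof. exact: mkhomE. Qed.

Lemma bcompE M N P (f : bimod_hom N P) (g : bimod_hom M N) m :
  bcomp f g m = f (g m).
Proof. exact: mkhomE. Qed.

End BimoduleHoms.

(* The tensor product M (x)_A N: the quotient of M (x)_k N (matrices, with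
   m (x) n the rank one matrix of coordinates) by the span of the elements
   ma (x) n - m (x) an. The quotient by a subspace is modelled on a complement
   of it, with the projection along the subspace. *)

Section Tensor.
Variables (k : fieldType) (G : finGroupType) (A : galg k G).
Variables M N : bimod A.

Definition ktens (m : M) (n : N) : 'M[k]_(\dim {:M}, \dim {:N}) :=
  \matrix_(i, j) (coord (vbasis {:M}) i m * coord (vbasis {:N}) j n).

Definition tens_rel : {vspace 'M[k]_(\dim {:M}, \dim {:N})} :=
  (\sum_(a <- vbasis {:A}) \sum_(m <- vbasis {:M}) \sum_(n <- vbasis {:N})
     <[ktens (ract m a) n - ktens m (lact a n)]>)%VS.

Definition tcar : vectType k := subvs_of (tens_rel^C)%VS.

Definition tproj (w : 'M[k]_(\dim {:M}, \dim {:N})) : tcar :=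
  vsproj (tens_rel^C)%VS (daddv_pi (tens_rel^C) tens_rel w).

Definition tpure (m : M) (n : N) : tcar := tproj (ktens m n).

Lemma ktens_linl n : linear (ktens^~ n).
Proof.
by move=> c x y; apply/matrixP => i j; rewrite !mxE linearP /= mulrDl mulrA.
Qed.

Lemma ktens_linr m : linear (ktens m).
Proof.
by move=> c x y; apply/matrixP => i j; rewrite !mxE linearP /= mulrDr mulrCA.
Qed.

Lemma tproj_linear : linear tproj.
Proof. by move=> c x y; rewrite /tproj !linearP. Qed.

Lemma tprojK (t : tcar) : tproj (vsval t) = t.
Proof.
rewrite /tproj daddv_pi_id ?vsvalK //; last exact: subvsP.
by rewrite capvC capv_compl.
Qed.

Lemma tproj_sub w : w - vsval (tproj w) \in tens_rel.
Proof.
rewrite /tproj vsprojK ?memv_pi //.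
have cap0 : (tens_rel^C :&: tens_rel = 0)%VS by rewrite capvC capv_compl.
have {1}<- : daddv_pi (tens_rel^C) tens_rel w + daddv_pi tens_rel (tens_rel^C) w = w.
  by apply: daddv_pi_add; rewrite // addvC addv_complf memvf.
by rewrite addrAC subrr add0r memv_pi.
Qed.

Lemma tproj_rel w : w \in tens_rel -> tproj w = 0.
Proof.
move=> wr; apply: val_inj => /=; apply/eqP; rewrite -memv0.
have <- : (tens_rel^C :&: tens_rel)%VS = 0%VS by rewrite capvC capv_compl.
rewrite memv_cap subvsP /= -[vsval _](subKr w) memvB //.
exact: tproj_sub.
Qed.

Lemma tens_relP a m n : ktens (ract m a) n - ktens m (lact a n) \in tens_rel.
Proof.
have lin3 (V : lmodType k) (x y z t : V) c :
  c *: (x - y) + (z - t) = (c *: x + z) - (c *: y + t).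
  by rewrite scalerBr addrACA opprD.
have ha : a \in fullv by rewrite memvf.
have hm : m \in fullv by rewrite memvf.
have hn : n \in fullv by rewrite memvf.
have l0 (V W : lmodType k) (f : V -> W) : linear f -> f 0 = 0 by apply: linear_0.
elim/vbasis_ind: ha m n hm hn => [|c a1 a2 IH1 IH2|a' a'b] m n hm hn.
- rewrite (l0 _ _ _ (ract_linr m)) (l0 _ _ _ (ktens_linl n)).
  rewrite (l0 _ _ _ (lact_linl n)) (l0 _ _ _ (ktens_linr m)).
  by rewrite subr0 mem0v.
- rewrite ract_linr ktens_linl lact_linl ktens_linr -lin3.
  by rewrite memvD ?memvZ ?IH1 ?IH2.
elim/vbasis_ind: hm n hn => [|c m1 m2 IH1 IH2|m' m'b] n hn.
- rewrite (l0 _ _ _ (ract_linl a')) !(l0 _ _ _ (ktens_linl _)).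
  by rewrite subr0 mem0v.
- by rewrite ract_linl !ktens_linl -lin3 memvD ?memvZ ?IH1 ?IH2.
elim/vbasis_ind: hn => [|c n1 n2 IH1 IH2|n' n'b].
- rewrite (l0 _ _ _ (lact_linr a')) !(l0 _ _ _ (ktens_linr _)).
  by rewrite subr0 mem0v.
- by rewrite lact_linr !ktens_linr -lin3 memvD ?memvZ ?IH1 ?IH2.
apply: (subvP _ _ (memv_line _)).
rewrite /tens_rel (big_rem _ a'b) /=; apply: subv_trans (addvSl _ _).
rewrite (big_rem _ m'b) /=; apply: subv_trans (addvSl _ _).
by rewrite (big_rem _ n'b) /=; apply: addvSl.
Qed.

Lemma tpure_linl n : linear (tpure^~ n).
Proof. exact: linear_comp tproj_linear (ktens_linl n). Qed.

Lemma tpure_linr m : linear (tpure m).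
Proof. exact: linear_comp tproj_linear (ktens_linr m). Qed.

Lemma tpure_bal m a n : tpure (ract m a) n = tpure m (lact a n).
Proof.
apply/eqP; rewrite -subr_eq0 -(linear_B tproj_linear) tproj_rel //.
exact: tens_relP.
Qed.

Let bM i : M := (vbasis {:M})`_i.
Let bN j : N := (vbasis {:N})`_j.

Lemma bM_sum m : m = \sum_i coord (vbasis {:M}) i m *: bM i.
Proof. exact: coord_vbasis (memvf m). Qed.

Lemma bN_sum n : n = \sum_j coord (vbasis {:N}) j n *: bN j.
Proof. exact: coord_vbasis (memvf n). Qed.

Lemma ktens_sum (w : 'M[k]_(\dim {:M}, \dim {:N})) : w = \sum_i \sum_j w i j *: ktens (bM i) (bN j).
Proof.
rewrite {1}[w]matrix_sum_delta; do 2!(apply: eq_bigr => ? _).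
congr (_ *: _); apply/matrixP => i j; rewrite !mxE.
rewrite !coord_free ?(basis_free (vbasisP _)) //.
by rewrite -natrM mulnb eq_sym [_ == j]eq_sym.
Qed.

Lemma text (V : lmodType k) (f g : tcar -> V) : linear f -> linear g ->
  (forall m n, f (tpure m n) = g (tpure m n)) -> f =1 g.
Proof.
move=> lf lg fg t; rewrite -[t]tprojK [vsval t]ktens_sum.
rewrite !(linear_S _ _ _ tproj_linear) (linear_S _ _ _ lf) (linear_S _ _ _ lg).
apply: eq_bigr => i _; rewrite !(linear_S _ _ _ tproj_linear).
rewrite (linear_S _ _ _ lf) (linear_S _ _ _ lg); apply: eq_bigr => j _.
by rewrite (linear_Z tproj_linear) (linear_Z lf) (linear_Z lg) fg.
Qed.

Definition balanced (V : lmodType k) (b : M -> N -> V) : Prop :=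
  [/\ forall n, linear (b^~ n), forall m, linear (b m)
    & forall m a n, b (ract m a) n = b m (lact a n)].

Definition tlift0 (V : lmodType k) (b : M -> N -> V)
    (w : 'M[k]_(\dim {:M}, \dim {:N})) : V :=
  \sum_i \sum_j w i j *: b (bM i) (bN j).

Definition tlift (V : lmodType k) (b : M -> N -> V) (t : tcar) : V :=
  tlift0 b (vsval t).

Lemma tlift0_linear (V : lmodType k) (b : M -> N -> V) : linear (tlift0 b).
Proof.
move=> c x y; rewrite /tlift0 scaler_sumr -big_split; apply: eq_bigr => i _.
rewrite scaler_sumr -big_split; apply: eq_bigr => j _ /=.
by rewrite !mxE scalerDl scalerA.
Qed.

Lemma tlift_linear (V : lmodType k) (b : M -> N -> V) : linear (tlift b).
Proof. by move=> c x y; rewrite /tlift linearP tlift0_linear. Qed.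

Lemma tlift_lin (U V : lmodType k) (b : U -> M -> N -> V) :
  (forall m n, linear (fun u => b u m n)) -> forall t, linear (fun u => tlift (b u) t).
Proof.
move=> lb t c x y; rewrite /tlift /tlift0 scaler_sumr -big_split.
apply: eq_bigr => i _; rewrite scaler_sumr -big_split; apply: eq_bigr => j _ /=.
by rewrite lb scalerDr !scalerA mulrC.
Qed.

Lemma tlift0_ktens (V : lmodType k) (b : M -> N -> V) m n :
  balanced b -> tlift0 b (ktens m n) = b m n.
Proof.
case=> bl br _; rewrite [in RHS](bM_sum m) (linear_S _ _ _ (bl n)).
apply: eq_bigr => i _; rewrite (linear_Z (bl _)) [in RHS](bN_sum n).
rewrite (linear_S _ _ _ (br _)) scaler_sumr; apply: eq_bigr => j _.
by rewrite (linear_Z (br _)) scalerA mxE.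
Qed.

Lemma tlift0_rel (V : lmodType k) (b : M -> N -> V) w :
  balanced b -> w \in tens_rel -> tlift0 b w = 0.
Proof.
move=> bb; pose ok (U : {vspace 'M[k]_(\dim {:M}, \dim {:N})}) :=
  forall w, w \in U -> tlift0 b w = 0.
suff: ok tens_rel by apply.
have ok0 : ok 0%VS.
  by move=> v; rewrite memv0 => /eqP->; apply: linear_0 (tlift0_linear b).
have okD U1 U2 : ok U1 -> ok U2 -> ok (U1 + U2)%VS.
  move=> o1 o2 v /memv_addP[v1 h1 [v2 h2 ->]].
  by rewrite (linear_D (tlift0_linear b)) o1 ?o2 ?addr0.
rewrite /tens_rel; do 3!(apply: (big_ind ok) => // ? _).
move=> v /vlineP[c ->].
rewrite (linear_Z (tlift0_linear b)) (linear_B (tlift0_linear b)).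
by rewrite !tlift0_ktens //; case: bb => _ _ ->; rewrite subrr scaler0.
Qed.

Lemma tliftE (V : lmodType k) (b : M -> N -> V) m n :
  balanced b -> tlift b (tpure m n) = b m n.
Proof.
move=> bb; rewrite -(tlift0_ktens m n bb) /tlift /tpure.
apply/eqP; rewrite eq_sym -subr_eq0 -(linear_B (tlift0_linear b)).
by rewrite tlift0_rel ?tproj_sub.
Qed.

Definition tgr (g : G) : {vspace tcar} :=
  (\sum_h \sum_(m <- vbasis (bgr M h)) \sum_(n <- vbasis (bgr N (h^-1 * g)%g))
     <[tpure m n]>)%VS.

Lemma tpure_gr g h m n :
  m \in bgr M g -> n \in bgr N h -> tpure m n \in tgr (g * h)%g.
Proof.
move=> hm; rewrite -{1}[h](mulKg g) => hn.
have l0 (V W : lmodType k) (f : V -> W) : linear f -> f 0 = 0 by apply: linear_0.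
elim/vbasis_ind: hm n hn => [|c m1 m2 IH1 IH2|m' m'b] n hn.
- by rewrite (l0 _ _ _ (tpure_linl n)) mem0v.
- by rewrite tpure_linl memvD ?memvZ ?IH1 ?IH2.
elim/vbasis_ind: hn => [|c n1 n2 IH1 IH2|n' n'b].
- by rewrite (l0 _ _ _ (tpure_linr m')) mem0v.
- by rewrite tpure_linr memvD ?memvZ ?IH1 ?IH2.
apply: (subvP _ _ (memv_line _)); rewrite /tgr.
rewrite (bigD1 g) //=; apply: subv_trans (addvSl _ _).
rewrite (big_rem _ m'b) /=; apply: subv_trans (addvSl _ _).
by rewrite (big_rem _ n'b) /=; apply: addvSl.
Qed.

Lemma tgr_ind (P : tcar -> Prop) g :
  P 0 -> (forall c x y, P x -> P y -> P (c *: x + y)) ->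
  (forall h h' m n, m \in bgr M h -> n \in bgr N h' -> (h * h')%g = g ->
     P (tpure m n)) ->
  forall t, t \in tgr g -> P t.
Proof.
move=> P0 PD Pp.
pose ok (U : {vspace tcar}) := forall t, t \in U -> P t.
have ok0 : ok 0%VS by move=> v; rewrite memv0 => /eqP->.
have okD U1 U2 : ok U1 -> ok U2 -> ok (U1 + U2)%VS.
  move=> o1 o2 v /memv_addP[v1 h1 [v2 h2 ->]].
  by rewrite -[v1]scale1r; apply: PD; [apply: o1 | apply: o2].
rewrite -/(ok _) /tgr; apply: (big_ind ok) => // h _.
rewrite big_seq; apply: (big_ind ok) => // m mb.
rewrite big_seq; apply: (big_ind ok) => // n nb t /vlineP[c ->].
rewrite -[_ *: _]addr0; apply: PD => //.
apply: (Pp h (h^-1 * g)%g); [exact: vbasis_mem| exact: vbasis_mem | exact: mulKVg].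
Qed.

Lemma tpure_gr_ind (P : tcar -> Prop) :
  P 0 -> (forall c x y, P x -> P y -> P (c *: x + y)) ->
  (forall g h m n, m \in bgr M g -> n \in bgr N h -> P (tpure m n)) ->
  forall m n, P (tpure m n).
Proof.
move=> P0 PD Pp m n.
have PD' x y : P x -> P y -> P (x + y) by rewrite -{2}[x]scale1r; apply: PD.
elim/(grading_ind (bgrP M)): m => [|m1 m2 IH1 IH2|g m hm].
- by rewrite (linear_0 (tpure_linl n)).
- by rewrite (linear_D (tpure_linl n)); apply: PD'.
elim/(grading_ind (bgrP N)): n => [|n1 n2 IH1 IH2|h n hn].
- by rewrite (linear_0 (tpure_linr m)).
- by rewrite (linear_D (tpure_linr m)); apply: PD'.
exact: Pp hm hn.
Qed.

Lemma t_ind (P : tcar -> Prop) :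
  P 0 -> (forall c x y, P x -> P y -> P (c *: x + y)) ->
  (forall m n, P (tpure m n)) -> forall t, P t.
Proof.
move=> P0 PD Pp t; rewrite -[t]tprojK [vsval t]ktens_sum.
have PD' x y : P x -> P y -> P (x + y) by rewrite -{2}[x]scale1r; apply: PD.
rewrite (linear_S _ _ _ tproj_linear); apply: (big_ind P) => // i _.
rewrite (linear_S _ _ _ tproj_linear); apply: (big_ind P) => // j _.
rewrite (linear_Z tproj_linear) -[_ *: _]addr0; apply: PD => //.
exact: Pp.
Qed.

Let tpi g (m : M) (n : N) : tcar :=
  \sum_h tpure (grpi (bgr M) h m) (grpi (bgr N) (h^-1 * g)%g n).

Let tpi_gr g h h' m n : m \in bgr M h -> n \in bgr N h' ->
  tpi g m n = if g == (h * h')%g then tpure m n else 0.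
Proof.
move=> hm hn; rewrite /tpi (bigD1 h) //= big1 => [|i ne_ih].
  rewrite (grpi_delta (bgrP M) _ hm) eqxx (grpi_delta (bgrP N) _ hn) addr0.
  rewrite -(inj_eq (mulgI h)) mulKVg; case: eqP => // _.
  exact: linear_0 (tpure_linr m).
rewrite (grpi_delta (bgrP M) _ hm) (negPf ne_ih).
exact: linear_0 (tpure_linl _).
Qed.

Let tpi_linl g n : linear (tpi g ^~ n).
Proof.
apply: linear_sumf => h _ c x y /=.
by rewrite grpi_linear tpure_linl.
Qed.

Let tpi_linr g m : linear (tpi g m).
Proof.
apply: linear_sumf => h _ c x y /=.
by rewrite grpi_linear tpure_linr.
Qed.

Let tpi_bal g : balanced (tpi g).
Proof.
split=> [n|m|m a n]; [exact: tpi_linl | exact: tpi_linr |].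
elim/(grading_ind (bgrP M)): m => [|m1 m2 IH1 IH2|h m hm].
- by rewrite (linear_0 (ract_linl a)) !(linear_0 (tpi_linl g _)).
- by rewrite (linear_D (ract_linl a)) !(linear_D (tpi_linl g _)) IH1 IH2.
elim/(grading_ind (bgrP N)): n => [|n1 n2 IH1 IH2|h' n hn].
- by rewrite (linear_0 (lact_linr a)) !(linear_0 (tpi_linr g _)).
- by rewrite (linear_D (lact_linr a)) !(linear_D (tpi_linr g _)) IH1 IH2.
elim/(grading_ind (galg_grP A)): a => [|a1 a2 IH1 IH2|x a ha].
- rewrite (linear_0 (ract_linr m)) (linear_0 (lact_linl n)).
  by rewrite (linear_0 (tpi_linr g _)) (linear_0 (tpi_linl g _)).
- rewrite (linear_D (ract_linr m)) (linear_D (lact_linl n)).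
  by rewrite (linear_D (tpi_linr g _)) (linear_D (tpi_linl g _)) IH1 IH2.
rewrite (tpi_gr g (ract_gr hm ha) hn) (tpi_gr g hm (lact_gr ha hn)).
by rewrite mulgA tpure_bal.
Qed.

Lemma tgrP : is_grading tgr.
Proof.
have lp g := tlift_linear (tpi g).
have tgr_pi g h t : t \in tgr h -> tlift (tpi g) t = if g == h then t else 0.
  elim/tgr_ind => [|c x y IHx IHy|i j m n mi nj <-].
  - by rewrite (linear_0 (lp g)) if_same.
  - by rewrite lp IHx IHy; case: ifP; rewrite // scaler0 addr0.
  - by rewrite tliftE ?(tpi_gr g mi nj).
split; last first.
  apply: (directv_proj (p := fun g => tlift (tpi g))) => [//|i v|i j v ne_ij] vi.
    by rewrite (tgr_pi i i) ?eqxx.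
  by rewrite (tgr_pi i j) ?(negPf ne_ij).
apply/vspaceP => t; rewrite memvf.
elim/t_ind: t => [|c x y IHx IHy|m n]; rewrite ?mem0v ?memvD ?memvZ //.
apply: (tpure_gr_ind (P := fun t => t \in (\sum_g tgr g)%VS)).
- exact: mem0v.
- by move=> c x y IHx IHy; rewrite memvD ?memvZ.
move=> g h {}m {}n mg nh; apply: subvP (tpure_gr mg nh).
exact: (sumv_sup (g * h)%g).
Qed.

Definition tlact (a : A) : tcar -> tcar := tlift (fun m n => tpure (lact a m) n).
Definition tract (t : tcar) (a : A) : tcar :=
  tlift (fun m n => tpure m (ract n a)) t.

Fact tlact_bal a : balanced (fun m n => tpure (lact a m) n).
Proof.
split=> [n|m|m b n]; first exact: (linear_comp (tpure_linl n) (lact_linr a)).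
  exact: tpure_linr.
by rewrite -lract tpure_bal.
Qed.

Fact tract_bal a : balanced (fun m n => tpure m (ract n a)).
Proof.
split=> [n|m|m b n]; first exact: tpure_linl.
  exact: (linear_comp (tpure_linr m) (ract_linl a)).
by rewrite tpure_bal lract.
Qed.

Lemma tlactE a m n : tlact a (tpure m n) = tpure (lact a m) n.
Proof. exact: tliftE (tlact_bal a). Qed.

Lemma tractE a m n : tract (tpure m n) a = tpure m (ract n a).
Proof. exact: tliftE (tract_bal a). Qed.

Lemma tlact_linr a : linear (tlact a). Proof. exact: tlift_linear. Qed.
Lemma tract_linl a : linear (tract^~ a). Proof. exact: tlift_linear. Qed.

Lemma tlact_linl t : linear (tlact^~ t).
Proof.
apply: tlift_lin => m n.
exact: (linear_comp (tpure_linl n) (lact_linl m)).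
Qed.

Lemma tract_linr t : linear (tract t).
Proof.
apply: tlift_lin => m n.
exact: (linear_comp (tpure_linr m) (ract_linr n)).
Qed.

Definition btens : bimod A.
Proof.
apply: (@Bimod k G A tcar tgr tlact tract tgrP tlact_linl tlact_linr
  tract_linl tract_linr).
- apply: text => [||m n]; [exact: tlact_linr | by [] |].
  by rewrite tlactE lact1.
- move=> a b; apply: text => [||m n]; [exact: tlact_linr | |].
    exact: linear_comp (tlact_linr a) (tlact_linr b).
  by rewrite !tlactE lactM.
- apply: text => [||m n]; [exact: tract_linl | by [] |].
  by rewrite tractE ract1.
- move=> t a b; move: t; apply: text => [||m n]; [exact: tract_linl | |].
    exact: linear_comp (tract_linl b) (tract_linl a).
  by rewrite !tractE ractM.
- move=> a t b; move: t; apply: text => [||m n].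
  + exact: linear_comp (tract_linl b) (tlact_linr a).
  + exact: linear_comp (tlact_linr a) (tract_linl b).
  + by rewrite !(tlactE, tractE).
- move=> g h a t ha; elim/tgr_ind => [|c x y IHx IHy|i j m n mi nj <-].
  + by rewrite (linear_0 (tlact_linr a)) mem0v.
  + by rewrite tlact_linr memvD ?memvZ.
  + by rewrite tlactE mulgA tpure_gr ?lact_gr.
- move=> g h t a ht ha; elim/tgr_ind: ht => [|c x y IHx IHy|i j m n mi nj <-].
  + by rewrite (linear_0 (tract_linl a)) mem0v.
  + by rewrite tract_linl memvD ?memvZ.
  + by rewrite tractE -mulgA tpure_gr ?ract_gr.
Defined.

End Tensor.

Section BimoduleCategory.
Variables (k : fieldType) (G : finGroupType) (A : galg k G).
Implicit Types M N P Q : bimod A.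

Definition pt M N (m : M) (n : N) : btens M N := tpure m n.

Lemma pt_linl M N (n : N) : linear (fun m : M => pt m n).
Proof. exact: tpure_linl. Qed.

Lemma pt_linr M N (m : M) : linear (fun n : N => pt m n).
Proof. exact: tpure_linr. Qed.

Lemma pt_bal M N (m : M) a (n : N) : pt (ract m a) n = pt m (lact a n).
Proof. exact: tpure_bal. Qed.

Lemma pt_gr M N g h (m : M) (n : N) :
  m \in bgr M g -> n \in bgr N h -> pt m n \in bgr (btens M N) (g * h)%g.
Proof. exact: tpure_gr. Qed.

Lemma pt_gr_ind M N (P : btens M N -> Prop) g :
  P 0 -> (forall c x y, P x -> P y -> P (c *: x + y)) ->
  (forall h h' m n, m \in bgr M h -> n \in bgr N h' -> (h * h')%g = g ->
     P (pt m n)) ->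
  forall t, t \in bgr (btens M N) g -> P t.
Proof. exact: tgr_ind. Qed.

Lemma pt_lact M N a (m : M) (n : N) : lact a (pt m n) = pt (lact a m) n.
Proof. exact: tlactE. Qed.

Lemma pt_ract M N a (m : M) (n : N) : ract (pt m n) a = pt m (ract n a).
Proof. exact: tractE. Qed.

Lemma pt_ext M N (V : lmodType k) (f g : btens M N -> V) :
  linear f -> linear g ->
  (forall (m : M) (n : N), f (pt m n) = g (pt m n)) -> f =1 g.
Proof. exact: text. Qed.

Definition blift M N (V : lmodType k) (b : M -> N -> V) (t : btens M N) : V :=
  tlift b t.

Lemma blift_linear M N (V : lmodType k) (b : M -> N -> V) : linear (blift b).
Proof. exact: tlift_linear. Qed.

Lemma blift_lin M N (U V : lmodType k) (b : U -> M -> N -> V) :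
  (forall m n, linear (fun u => b u m n)) ->
  forall t, linear (fun u => blift (b u) t).
Proof. exact: tlift_lin. Qed.

Lemma bliftE M N (V : lmodType k) (b : M -> N -> V) m n :
  balanced b -> blift b (pt m n) = b m n.
Proof. exact: tliftE. Qed.

Lemma text3 M N P (V : lmodType k) (f g : btens (btens M N) P -> V) :
  linear f -> linear g ->
  (forall (m : M) (n : N) (p : P), f (pt (pt m n) p) =
                 g (pt (pt m n) p)) -> f =1 g.
Proof.
move=> lf lg fg; apply: pt_ext => // t p; move: t; apply: pt_ext => [||m n] //.
- exact: linear_comp lf (pt_linl p).
- exact: linear_comp lg (pt_linl p).
Qed.

Lemma text3' M N P (V : lmodType k) (f g : btens M (btens N P) -> V) :
  linear f -> linear g ->
  (forall (m : M) (n : N) (p : P), f (pt m (pt n p)) =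
                 g (pt m (pt n p))) -> f =1 g.
Proof.
move=> lf lg fg; apply: pt_ext => // m t; move: t; apply: pt_ext => [||n p] //.
- exact: linear_comp lf (pt_linr m).
- exact: linear_comp lg (pt_linr m).
Qed.

Lemma linear_f_lact M (V : lmodType k) (f : M -> V) a :
  linear f -> linear (fun x => f (lact a x)).
Proof. by move=> lf; apply: linear_comp lf (lact_linr a). Qed.

Lemma linear_lact_f M (V : lmodType k) (f : V -> M) a :
  linear f -> linear (fun x => lact a (f x)).
Proof. by move=> lf; apply: linear_comp (lact_linr a) lf. Qed.

Lemma linear_f_ract M (V : lmodType k) (f : M -> V) a :
  linear f -> linear (fun x => f (ract x a)).
Proof. by move=> lf; apply: linear_comp lf (ract_linl a). Qed.

Lemma linear_ract_f M (V : lmodType k) (f : V -> M) a :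
  linear f -> linear (fun x => ract (f x) a).
Proof. by move=> lf; apply: linear_comp (ract_linl a) lf. Qed.

Section TensHom.
Variables (M M' N N' : bimod A) (f : bimod_hom M M') (g : bimod_hom N N').

Fact btensm_bal : balanced (fun m n => pt (f m) (g n)).
Proof.
split=> [n|m|m a n].
- exact: linear_comp (pt_linl _) (bhom_linear f).
- exact: linear_comp (pt_linr _) (bhom_linear g).
- by rewrite bhom_ract pt_bal bhom_lact.
Qed.

Definition btensm : bimod_hom (btens M N) (btens M' N').
Proof.
apply: (@mkhom k G A (btens M N) (btens M' N')
          (blift (fun m n => pt (f m) (g n)))) => [|a|t a|x t].
- exact: blift_linear.
- apply: pt_ext => [||m n].
  + by apply: linear_f_lact; exact: blift_linear.
  + by apply: linear_lact_f; exact: blift_linear.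
  + by rewrite !(pt_lact, bliftE _ _ btensm_bal) bhom_lact.
- move: t; apply: pt_ext => [||m n].
  + by apply: linear_f_ract; exact: blift_linear.
  + by apply: linear_ract_f; exact: blift_linear.
  + by rewrite !(pt_ract, bliftE _ _ btensm_bal) bhom_ract.
- elim/pt_gr_ind => [|c t1 t2 IH1 IH2|i j m n mi nj <-].
  + by rewrite (linear_0 (blift_linear _)) mem0v.
  + by rewrite blift_linear memvD ?memvZ.
  + by rewrite (bliftE _ _ btensm_bal) pt_gr ?bhom_gr.
Defined.

Lemma btensmE m n : btensm (pt m n) = pt (f m) (g n).
Proof. by rewrite mkhomE (bliftE _ _ btensm_bal). Qed.

End TensHom.

Definition bunit : bimod A.
Proof.
apply: (@Bimod k G A A (galg_gr A) (fun a m => a * m) (fun m a => m * a)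
  (galg_grP A)) => //.
- by move=> m c x y; rewrite mulrDl scalerAl.
- by move=> a c x y; rewrite mulrDr scalerAr.
- by move=> a c x y; rewrite mulrDl scalerAl.
- by move=> m c x y; rewrite mulrDr scalerAr.
- exact: mul1r.
- by move=> a b m; rewrite mulrA.
- exact: mulr1.
- by move=> a b m; rewrite mulrA.
- by move=> a m b; rewrite mulrA.
- exact: galg_grM.
- exact: galg_grM.
Defined.

Section Associator.
Variables M N P : bimod A.

Let assoc1 (p : P) (t : btens M N) : btens M (btens N P) :=
  blift (fun (m : M) (n : N) => pt m (pt n p)) t.

Let assoc1_bal (p : P) :
  balanced (fun (m : M) (n : N) => pt m (pt n p)).
Proof.
split=> [n|m|m a n]; first exact: pt_linl.
  by apply: linear_comp (pt_linl p); exact: pt_linr.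
by rewrite pt_bal pt_lact.
Qed.

Let assoc1E (p : P) (m : M) (n : N) :
  assoc1 p (pt m n) = pt m (pt n p).
Proof. exact: bliftE (assoc1_bal p). Qed.

Let assoc2_bal : balanced (fun (t : btens M N) (p : P) => assoc1 p t).
Proof.
split=> [p|t|t a p]; first exact: blift_linear.
  apply: blift_lin => m n.
  exact: linear_comp (pt_linr m) (pt_linr n).
move: t; apply: pt_ext => [||m n].
- by apply: linear_f_ract; exact: blift_linear.
- exact: blift_linear.
by rewrite pt_ract !assoc1E pt_bal.
Qed.

Let assocf (t : btens (btens M N) P) : btens M (btens N P) :=
  blift (fun (t : btens M N) (p : P) => assoc1 p t) t.

Let assocfE (m : M) (n : N) (p : P) :
  assocf (pt (pt m n) p) = pt m (pt n p).
Proof. by rewrite /assocf (bliftE _ _ assoc2_bal) assoc1E. Qed.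

Let assocf_linear : linear assocf.
Proof. exact: blift_linear. Qed.

Definition bassoc : bimod_hom (btens (btens M N) P) (btens M (btens N P)).
Proof.
apply: (@mkhom k G A _ _ assocf assocf_linear) => [a|t a|x t].
- apply: text3 => [||m n p].
  + by apply: linear_f_lact; exact: assocf_linear.
  + by apply: linear_lact_f; exact: assocf_linear.
  + by rewrite !(pt_lact, assocfE).
- move: t; apply: text3 => [||m n p].
  + by apply: linear_f_ract; exact: assocf_linear.
  + by apply: linear_ract_f; exact: assocf_linear.
  + by rewrite !(pt_ract, assocfE).
- elim/pt_gr_ind => [|c t1 t2 IH1 IH2|i l t' p ti pl <-].
  + by rewrite (linear_0 assocf_linear) mem0v.
  + by rewrite assocf_linear memvD ?memvZ.
  elim/pt_gr_ind: ti => [|c t1 t2 IH1 IH2|{}i j m n mi nj <-].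
  + by rewrite (linear_0 (pt_linl p)) (linear_0 assocf_linear) mem0v.
  + by rewrite pt_linl assocf_linear memvD ?memvZ.
  + by rewrite assocfE -mulgA pt_gr // pt_gr.
Defined.

Lemma bassocE (m : M) (n : N) (p : P) :
  bassoc (pt (pt m n) p) = pt m (pt n p).
Proof. by rewrite mkhomE assocfE. Qed.

Let associ1 (m : M) (t : btens N P) : btens (btens M N) P :=
  blift (fun (n : N) (p : P) => pt (pt m n) p) t.

Let associ1_bal (m : M) :
  balanced (fun (n : N) (p : P) => pt (pt m n) p).
Proof.
split=> [p|n|n a p]; last by rewrite -pt_bal pt_ract.
  exact: linear_comp (pt_linl p) (pt_linr m).
exact: pt_linr.
Qed.

Let associ1E (m : M) (n : N) (p : P) :
  associ1 m (pt n p) = pt (pt m n) p.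
Proof. exact: bliftE (associ1_bal m). Qed.

Let associ2_bal : balanced (fun (m : M) (t : btens N P) => associ1 m t).
Proof.
split=> [t|m|m a t].
- apply: blift_lin => n p.
  exact: linear_comp (pt_linl p) (pt_linl n).
- exact: blift_linear.
move: t; apply: pt_ext => [||n p].
- exact: blift_linear.
- by apply: linear_f_lact; exact: blift_linear.
by rewrite pt_lact !associ1E pt_bal.
Qed.

Let associf (t : btens M (btens N P)) : btens (btens M N) P :=
  blift (fun (m : M) (t : btens N P) => associ1 m t) t.

Let associfE (m : M) (n : N) (p : P) :
  associf (pt m (pt n p)) = pt (pt m n) p.
Proof. by rewrite /associf (bliftE _ _ associ2_bal) associ1E. Qed.

Let associf_linear : linear associf.
Proof. exact: blift_linear. Qed.

Definition bassoci : bimod_hom (btens M (btens N P)) (btens (btens M N) P).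
Proof.
apply: (@mkhom k G A _ _ associf associf_linear) => [a|t a|x t].
- apply: text3' => [||m n p].
  + by apply: linear_f_lact; exact: associf_linear.
  + by apply: linear_lact_f; exact: associf_linear.
  + by rewrite !(pt_lact, associfE).
- move: t; apply: text3' => [||m n p].
  + by apply: linear_f_ract; exact: associf_linear.
  + by apply: linear_ract_f; exact: associf_linear.
  + by rewrite !(pt_ract, associfE).
- elim/pt_gr_ind => [|c t1 t2 IH1 IH2|i l m t' mi tl <-].
  + by rewrite (linear_0 associf_linear) mem0v.
  + by rewrite associf_linear memvD ?memvZ.
  elim/pt_gr_ind: tl => [|c t1 t2 IH1 IH2|j {}l n p nj pl <-].
  + by rewrite (linear_0 (pt_linr m)) (linear_0 associf_linear) mem0v.
  + by rewrite pt_linr associf_linear memvD ?memvZ.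
  + by rewrite associfE mulgA pt_gr // pt_gr.
Defined.

Lemma bassociE (m : M) (n : N) (p : P) :
  bassoci (pt m (pt n p)) = pt (pt m n) p.
Proof. by rewrite mkhomE associfE. Qed.

End Associator.

Section Unitors.
Variable M : bimod A.

Fact blun_bal : balanced (fun (a : bunit) (m : M) => lact (a : A) m).
Proof.
by split=> [m|a|a b m]; [exact: lact_linl | exact: lact_linr | exact: lactM].
Qed.

Fact brun_bal : balanced (fun (m : M) (a : bunit) => ract m (a : A)).
Proof.
split=> [a|m|m b a]; [exact: ract_linl | exact: ract_linr |].
by rewrite -ractM.
Qed.

Definition blun : bimod_hom (btens bunit M) M.
Proof.
apply: (@mkhom k G A _ _ (blift (fun (a : bunit) (m : M) => lact (a : A) m))
          (blift_linear _)) => [a|t a|x t].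
- apply: pt_ext => [||b m].
  + by apply: linear_f_lact; exact: blift_linear.
  + by apply: linear_lact_f; exact: blift_linear.
  + by rewrite pt_lact !(bliftE _ _ blun_bal) lactM.
- move: t; apply: pt_ext => [||b m].
  + by apply: linear_f_ract; exact: blift_linear.
  + by apply: linear_ract_f; exact: blift_linear.
  + by rewrite pt_ract !(bliftE _ _ blun_bal) lract.
- elim/pt_gr_ind => [|c t1 t2 IH1 IH2|i j b m bi mj <-].
  + by rewrite (linear_0 (blift_linear _)) mem0v.
  + by rewrite blift_linear memvD ?memvZ.
  + by rewrite (bliftE _ _ blun_bal) lact_gr.
Defined.

Lemma blunE (a : A) m : blun (pt (a : bunit) m) = lact a m.
Proof. by rewrite mkhomE (bliftE _ _ blun_bal). Qed.

Definition bluni : bimod_hom M (btens bunit M).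
Proof.
apply: (@mkhom k G A _ _ (fun m => pt (1 : bunit) m)) => [|a m|m a|x m mx].
- exact: pt_linr.
- by rewrite pt_lact -pt_bal /= mul1r mulr1.
- by rewrite pt_ract.
- by rewrite -[x]mul1g pt_gr //= galg_gr1.
Defined.

Lemma bluniE m : bluni m = pt (1 : bunit) m.
Proof. exact: mkhomE. Qed.

Definition brun : bimod_hom (btens M bunit) M.
Proof.
apply: (@mkhom k G A _ _ (blift (fun (m : M) (a : bunit) => ract m (a : A)))
          (blift_linear _)) => [a|t a|x t].
- apply: pt_ext => [||m b].
  + by apply: linear_f_lact; exact: blift_linear.
  + by apply: linear_lact_f; exact: blift_linear.
  + by rewrite pt_lact !(bliftE _ _ brun_bal) lract.
- move: t; apply: pt_ext => [||m b].
  + by apply: linear_f_ract; exact: blift_linear.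
  + by apply: linear_ract_f; exact: blift_linear.
  + by rewrite pt_ract !(bliftE _ _ brun_bal) ractM.
- elim/pt_gr_ind => [|c t1 t2 IH1 IH2|i j m b mi bj <-].
  + by rewrite (linear_0 (blift_linear _)) mem0v.
  + by rewrite blift_linear memvD ?memvZ.
  + by rewrite (bliftE _ _ brun_bal) ract_gr.
Defined.

Lemma brunE m (a : A) : brun (pt m (a : bunit)) = ract m a.
Proof. by rewrite mkhomE (bliftE _ _ brun_bal). Qed.

Definition bruni : bimod_hom M (btens M bunit).
Proof.
apply: (@mkhom k G A _ _ (fun m => pt m (1 : bunit))) => [|a m|m a|x m mx].
- exact: pt_linl.
- by rewrite pt_lact.
- by rewrite pt_ract pt_bal /= mul1r mulr1.
- by rewrite -[x]mulg1 pt_gr //= galg_gr1.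
Defined.

Lemma bruniE m : bruni m = pt m (1 : bunit).
Proof. exact: mkhomE. Qed.

End Unitors.

Definition bE := (bcompE, bidE, btensmE, bassocE, bassociE, blunE, bluniE,
  brunE, bruniE).

Lemma bext M N P (f g : bimod_hom (btens M N) P) :
  (forall (m : M) (n : N), f (pt m n) = g (pt m n)) -> f = g.
Proof. by move=> fg; apply/bhom_eq/pt_ext => //; apply: bhom_linear. Qed.

Lemma bext3 M N P Q (f g : bimod_hom (btens (btens M N) P) Q) :
  (forall (m : M) (n : N) (p : P), f (pt (pt m n) p) =
                 g (pt (pt m n) p)) -> f = g.
Proof. by move=> fg; apply/bhom_eq/text3 => //; apply: bhom_linear. Qed.

Lemma bext3' M N P Q (f g : bimod_hom (btens M (btens N P)) Q) :
  (forall (m : M) (n : N) (p : P), f (pt m (pt n p)) =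
                 g (pt m (pt n p))) -> f = g.
Proof. by move=> fg; apply/bhom_eq/text3' => //; apply: bhom_linear. Qed.

Lemma bext4 M N P Q V (f g : bimod_hom (btens (btens (btens M N) P) Q) V) :
  (forall (m : M) (n : N) (p : P) (q : Q),
     f (pt (pt (pt m n) p) q) =
     g (pt (pt (pt m n) p) q)) ->
  f = g.
Proof.
move=> fg; apply: bext => t q; move: t; apply: text3 => [||m n p] //.
- exact: linear_comp (bhom_linear f) (pt_linl q).
- exact: linear_comp (bhom_linear g) (pt_linl q).
Qed.

Definition Bimodules : moncat k.
Proof.
apply: (@Moncat k (bimod A) (fun M N => bimod_hom M N : lmodType k)
  (@bid k G A) (@bcomp k G A) (@btens k G A) btensm bunit bassoc bassoci
  blun bluni brun bruni).
- by move=> M N P Q f g h; apply: bhom_eq => m; rewrite !bE.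
- by move=> M N f; apply: bhom_eq => m; rewrite !bE.
- by move=> M N f; apply: bhom_eq => m; rewrite !bE.
- by move=> M N P g c f f'; apply: bhom_eq => m; rewrite !(bhom_linE, bE).
- move=> M N P f c g g'; apply: bhom_eq => m.
  by rewrite !(bhom_linE, bE) bhom_linear.
- by move=> M N; apply: bext => m n; rewrite !bE.
- by move=> *; apply: bext => m n; rewrite !bE.
- move=> M M' N N' g c f f'; apply: bext => m n.
  by rewrite !(bhom_linE, bE) pt_linl.
- move=> M M' N N' f c g g'; apply: bext => m n.
  by rewrite !(bhom_linE, bE) pt_linr.
- by move=> M N P; apply: bext3 => m n p; rewrite !bE.
- by move=> M N P; apply: bext3' => m n p; rewrite !bE.
- by move=> M; apply: bext => a m; rewrite !bE -pt_bal /= mul1r.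
- by move=> M; apply: bhom_eq => m; rewrite !bE lact1.
- by move=> M; apply: bext => m a; rewrite !bE pt_bal /= mulr1.
- by move=> M; apply: bhom_eq => m; rewrite !bE ract1.
- by move=> *; apply: bext3 => m n p; rewrite !bE.
- by move=> M N f; apply: bext => a m; rewrite !bE bhom_lact.
- by move=> M N f; apply: bext => m a; rewrite !bE bhom_ract.
- by move=> M N P Q; apply: bext4 => m n p q; rewrite !bE.
- by move=> M N; apply: bext3 => m a n; rewrite !bE pt_bal.
Defined.

End BimoduleCategory.

Section GroupAlgebra.
Variables (k : fieldType) (G : finGroupType) (H : {group G}).

Definition grpalg := {ffun subg_of H -> k^o}.
HB.instance Definition _ := Vector.on grpalg.

Implicit Types u v w : grpalg.

Definition ga_basis (x : subg_of H) : grpalg := [ffun y => (y == x)%:R].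

(* Convolution, i.e. the bilinear extension of the product of H *)
Definition ga_mul u v : grpalg :=
  [ffun x => \sum_(y : subg_of H) (u y : k) * v (y^-1 * x)%g].

Lemma ga_sum u : u = \sum_x u x *: ga_basis x.
Proof.
apply/ffunP => y; rewrite sum_ffunE (bigD1 y) //= !ffunE eqxx big1 ?addr0.
  by rewrite /GRing.scale /= mulr1.
by move=> x ne_xy; rewrite !ffunE eq_sym (negPf ne_xy) scaler0.
Qed.

Fact ga_mulA : associative ga_mul.
Proof.
move=> u v w; apply/ffunP => x; rewrite !ffunE.
under eq_bigr => y _ do rewrite ffunE mulr_sumr.
under [RHS]eq_bigr => y _ do rewrite ffunE mulr_suml.
rewrite [RHS]exchange_big /=; apply: eq_bigr => y _.
rewrite [RHS](reindex_inj (mulgI y)) /=; apply: eq_bigr => z _.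
by rewrite mulKg invMg mulgA mulrA.
Qed.

Fact ga_mul1 : left_id (ga_basis 1) ga_mul.
Proof.
move=> u; apply/ffunP => x; rewrite !ffunE (bigD1 1%g) //= ffunE eqxx mul1r.
rewrite invg1 mul1g big1 ?addr0 // => y ne_y1.
by rewrite ffunE (negPf ne_y1) mul0r.
Qed.

Fact ga_1mul : right_id (ga_basis 1) ga_mul.
Proof.
move=> u; apply/ffunP => x; rewrite !ffunE (bigD1 x) //= ffunE mulVg eqxx mulr1.
rewrite big1 ?addr0 // => y ne_yx.
by rewrite ffunE -eq_mulVg1 (negPf ne_yx) mulr0.
Qed.

Fact ga_mulDl : left_distributive ga_mul +%R.
Proof.
move=> u v w; apply/ffunP => x; rewrite !ffunE -big_split; apply: eq_bigr => y _.
by rewrite !ffunE mulrDl.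
Qed.

Fact ga_mulDr : right_distributive ga_mul +%R.
Proof.
move=> u v w; apply/ffunP => x; rewrite !ffunE -big_split; apply: eq_bigr => y _.
by rewrite !ffunE mulrDr.
Qed.

Fact ga_basis1_neq0 : ga_basis 1 != 0.
Proof.
apply/eqP => /ffunP/(_ 1%g)/eqP; rewrite !ffunE eqxx.
by rewrite (negPf (oner_neq0 _)).
Qed.

HB.instance Definition _ := GRing.Zmodule_isNzRing.Build grpalg
  ga_mulA ga_mul1 ga_1mul ga_mulDl ga_mulDr ga_basis1_neq0.

Fact ga_scaleAl (c : k) u v : c *: (u * v) = (c *: u) * v.
Proof.
apply/ffunP => x; rewrite !ffunE scaler_sumr; apply: eq_bigr => y _.
by rewrite !ffunE /GRing.scale /= mulrA.
Qed.

Fact ga_scaleAr (c : k) u v : c *: (u * v) = u * (c *: v).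
Proof.
apply/ffunP => x; rewrite !ffunE scaler_sumr; apply: eq_bigr => y _.
by rewrite !ffunE /GRing.scale /= mulrCA.
Qed.

HB.instance Definition _ :=
  GRing.Lmodule_isLalgebra.Build k grpalg ga_scaleAl.
HB.instance Definition _ :=
  GRing.Lalgebra_isAlgebra.Build k grpalg ga_scaleAr.
HB.instance Definition _ := Algebra_isFalgebra.Build k grpalg.

Definition ga_gr (g : G) : {vspace grpalg} :=
  (\sum_(h : subg_of H | sgval h == g) <[ga_basis h]>)%VS.

Lemma ga_basisM x y : ga_basis x * ga_basis y = ga_basis (x * y)%g.
Proof.
apply/ffunP => z; rewrite !ffunE (bigD1 x) //= !ffunE eqxx mul1r.
rewrite big1 ?addr0 => [|t ne_tx]; last by rewrite ffunE (negPf ne_tx) mul0r.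
by rewrite -(inj_eq (mulgI x)) mulKVg.
Qed.

Lemma ga_grE g u :
  u \in ga_gr g -> forall x : subg_of H, sgval x != g -> u x = 0.
Proof.
case/memv_sumP => us us_in -> x ne_xg; rewrite sum_ffunE big1 // => h hg.
have /vlineP[c ->] := us_in h hg; rewrite !ffunE.
case: (eqVneq x h) ne_xg => [->|_ _]; last by rewrite scaler0.
by rewrite (eqP hg) eqxx.
Qed.

Lemma ga_basis_gr (x : subg_of H) : ga_basis x \in ga_gr (sgval x).
Proof. by apply: subvP (memv_line _); apply: (sumv_sup x). Qed.

Fact ga_grP : is_grading ga_gr.
Proof.
split.
  apply/vspaceP => u; rewrite memvf [u]ga_sum memv_suml // => x _.
  rewrite memvZ //; apply: subvP (ga_basis_gr x).
  exact: (sumv_sup (sgval x)).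
pose p (g : G) (u : grpalg) : grpalg := [ffun x => if sgval x == g then u x else 0].
apply: (directv_proj (p := p)) => [g c u v|g u ug|g h u ne_gh uh].
- apply/ffunP => x; rewrite !ffunE; case: ifP; rewrite ?scaler0 ?addr0 //.
- apply/ffunP => x; rewrite !ffunE; case: ifPn => // /(ga_grE ug)->//.
- apply/ffunP => x; rewrite !ffunE; case: eqP => // xg.
  by rewrite (ga_grE uh) // xg.
Qed.

Fact ga_gr1 : (1 : grpalg) \in ga_gr 1%g.
Proof. exact: (ga_basis_gr 1%g). Qed.

Fact ga_grM g h (a b : grpalg) :
  a \in ga_gr g -> b \in ga_gr h -> a * b \in ga_gr (g * h)%g.
Proof.
case/memv_sumP => us us_in -> /memv_sumP[vs vs_in ->].
rewrite mulr_suml memv_suml // => x /[dup] /eqP xg /us_in/vlineP[c ->].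
rewrite mulr_sumr memv_suml // => y /[dup] /eqP yh /vs_in/vlineP[d ->].
rewrite -scalerAl -scalerAr ga_basisM !memvZ //.
by rewrite -xg -yh; apply: (ga_basis_gr (x * y)%g).
Qed.

Definition group_algebra : galg k G := GAlg ga_grP ga_gr1 ga_grM.

(* The category C(G,1,H,1) *)
Definition group_theoretical : moncat k := Bimodules group_algebra.

End GroupAlgebra.

Definition split_exact (zT uT qT : finGroupType) (Z : {set zT})
    (Q : {set qT}) (i : {morphism Z >-> uT})
    (p : {morphism [set: uT] >-> qT}) (s : {morphism Q >-> uT}) : Prop :=
  [/\ ('injm i)%g, (i @* Z = 'ker p)%g, (p @* [set: uT] = Q)%g
    & forall x, x \in Q -> p (s x) = x].

(* Main.v *)
From mathcomp Require Import all_boot all_algebra all_fingroup all_solvable all_field.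
From mathcomp Require Import boolp.
Require Import Defs.

Set Implicit Arguments.
Unset Strict Implicit.
Unset Printing Implicit Defensive.

Import GRing.Theory.

(** Write [A = k[H]] and let [Z] be the center of [H].  The action of [H] on
    either side of a bimodule does not change the coset in [G/H] of a degree.
    Moreover, an element [w] of [Z] acts on the part of degree [g] of a bimodule
    by [m |-> w^(g^-1) m w^-1].  This operator preserves the degree and commutes
    with both actions of [H] and with all homomorphisms, so its eigenspaces are
    natural summands.  Every bimodule is thus canonically the direct sum of
    parts of degree [(x, chi)], for [x] in [G/H] and [chi] a character of [Z],
    and tensor products follow the rule
    [(x, chi) (y, psi) = (x y, chi^y psi)] with [chi^y w = chi (w^(y^-1))]:
    this is a grading by the semidirect product of [G/H] and the character
    group of [Z], in which [x |-> (x, 1)] is a section.  Since [Z] is finite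
    abelian and [k] is algebraically closed of characteristic [0], a perfect
    pairing on [Z] ([abelian_perfect_pairing]) identifies [Z] with its
    character group, and carries the action of [G/H] over to [Z]
    ([dual_action]).

    This grading is universal.  The dual of an object of degree [a] has degree
    [a^-1] ([component_dual]), hence the adjoint subcategory lies in the
    trivial component, and it remains to see that each component is
    indecomposable as a bimodule category over it
    ([grading_component_indecomposable]).  A decomposition of a component
    yields an idempotent of the free bimodule [A (x) k_g (x) A] that is
    compatible with tensoring by objects [V] of the adjoint subcategory
    ([decomposition_idempotent]).  Taking for [V] the product of a simple
    bimodule [S] with its dual shows that an element [h] with a nonzero
    coefficient in this idempotent must act by a scalar on the degree one part
    of [S], under conjugation; by complete reducibility the same element then
    commutes with [H] ([adjoint_centralizer]).  So the idempotent comes from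
    [k[Z]], and [k[Z]] acts by the same scalars on all objects of the
    component: one of the two summands is zero.

    Finally, an indecomposable component of one universal grading lies inside a
    single component of any other ([grading_refine]).  As tensor products of
    nonzero bimodules are nonzero ([bimod_tens_nonzero]), the bijection between
    the components is an isomorphism of the grading groups
    ([universal_grading_unique]), and the split extension is transported along
    it. *)

(** * Kernels and idempotents in linear monoidal categories *)

Section LinearMonoidal.
Local Open Scope ring_scope.
Variables (k : fieldType) (C : moncat k).
Implicit Types X Y Z W : C.

Lemma comp0m X Y Z (g : chom X Y) : ccomp (0 : chom Y Z) g = 0.
Proof. exact: (linear_0 (ccomp_linl g)). Qed.

Lemma compm0 X Y Z (f : chom Y Z) : ccomp f (0 : chom X Y) = 0.
Proof. exact: (linear_0 (ccomp_linr f)). Qed.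

Lemma comp_suml X Y Z (g : chom X Y) (I : finType) (F : I -> chom Y Z) :
  ccomp (\sum_i F i) g = \sum_i ccomp (F i) g.
Proof. exact: (linear_S _ _ _ (ccomp_linl g)). Qed.

Lemma comp_sumr X Y Z (f : chom Y Z) (I : finType) (F : I -> chom X Y) :
  ccomp f (\sum_i F i) = \sum_i ccomp f (F i).
Proof. exact: (linear_S _ _ _ (ccomp_linr f)). Qed.

Lemma compBm X Y Z (g : chom X Y) (f1 f2 : chom Y Z) :
  ccomp (f1 - f2) g = ccomp f1 g - ccomp f2 g.
Proof. exact: (linear_B (ccomp_linl g)). Qed.

Lemma compmB X Y Z (f : chom Y Z) (g1 g2 : chom X Y) :
  ccomp f (g1 - g2) = ccomp f g1 - ccomp f g2.
Proof. exact: (linear_B (ccomp_linr f)). Qed.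

Lemma tens0m X X' Y Y' (g : chom Y Y') : tensm (0 : chom X X') g = 0.
Proof. exact: (linear_0 (tensm_linl g)). Qed.

Lemma tensm0 X X' Y Y' (f : chom X X') : tensm f (0 : chom Y Y') = 0.
Proof. exact: (linear_0 (tensm_linr f)). Qed.

Lemma tensm_sumr X X' Y Y' (f : chom X X') (I : finType) (F : I -> chom Y Y') :
  tensm f (\sum_i F i) = \sum_i tensm f (F i).
Proof. exact: (linear_S _ _ _ (tensm_linr f)). Qed.

Lemma tensm_suml X X' Y Y' (g : chom Y Y') (I : finType) (F : I -> chom X X') :
  tensm (\sum_i F i) g = \sum_i tensm (F i) g.
Proof. exact: (linear_S _ _ _ (tensm_linl g)). Qed.

Lemma hom_from_zero X Y (f : chom X Y) : is_zero X -> f = 0.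
Proof. by move=> X0; rewrite -[f]ccompm1 X0 compm0. Qed.

Lemma retract_mono X Y (f : chom X Y) (r : chom Y X) :
  ccomp r f = cid X -> is_mono f.
Proof.
by move=> rf W g h /(congr1 (ccomp r)); rewrite !ccompA rf !ccomp1m.
Qed.

Definition has_kernels : Prop := forall X Y (f : chom X Y),
  exists K (i : chom K X), [/\ is_mono i, ccomp f i = 0
    & forall W (g : chom W X), ccomp f g = 0 -> exists g', g = ccomp i g'].

Hypothesis kerC : has_kernels.

(** The image of an idempotent [e] is the kernel of [1 - e]. *)
Lemma split_idempotent X (e : chom X X) : ccomp e e = e ->
  exists Y (i : chom Y X) (p : chom X Y), ccomp p i = cid Y /\ ccomp i p = e.
Proof.
move=> ee; have [Y [i [mono_i ei0 univ]]] := kerC (cid X - e).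
have ei : ccomp e i = i.
  by apply/eqP; rewrite eq_sym -subr_eq0 -{1}[i]ccomp1m -compBm ei0.
have [|p eE] := univ _ e; first by rewrite compBm ccomp1m ee subrr.
exists Y, i, p; split => //; apply: mono_i.
by rewrite ccompA -eE ei ccompm1.
Qed.

Lemma dsum_of_idempotents (I : finType) X (e : I -> chom X X) :
    (forall i j, i != j -> ccomp (e j) (e i) = 0) -> \sum_i e i = cid X ->
  exists (Y : I -> C) (inj : forall i, chom (Y i) X)
      (prj : forall i, chom X (Y i)),
    [/\ forall i, ccomp (prj i) (inj i) = cid (Y i),
        forall i j, i != j -> ccomp (prj j) (inj i) = 0
      & forall i, ccomp (inj i) (prj i) = e i].
Proof.
move=> orth sum1.
have ee i : ccomp (e i) (e i) = e i.
  rewrite -{3}[e i]ccomp1m -sum1 comp_suml (bigD1 i) //= big1 ?addr0 // => j ne.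
  by apply: orth; rewrite eq_sym.
have H i : exists d : {Y : C & (chom Y X * chom X Y)%type},
    ccomp (tagged d).2 (tagged d).1 = cid _ /\ ccomp (tagged d).1 (tagged d).2 = e i.
  have [Y [a [b [ba ab]]]] := split_idempotent (ee i).
  by exists (Tagged (fun Y => (chom Y X * chom X Y)%type) (a, b)).
have /choice [d dP] := H.
exists (fun i => tag (d i)), (fun i => (tagged (d i)).1),
  (fun i => (tagged (d i)).2); split=> [i|i j ne|i]; try by case: (dP i).
have [di1 di2] := dP i; have [dj1 dj2] := dP j.
rewrite -[LHS]ccomp1m -dj1 -[X in ccomp _ X]ccompm1 -di1.
by rewrite -!ccompA (ccompA _ _ (tagged (d i)).1) di2 (ccompA _ (tagged (d j)).2) dj2
  (ccompA (e j)) orth // comp0m compm0.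
Qed.

Lemma dsum_of_idempotent X (q : chom X X) : ccomp q q = q ->
  exists (Y : bool -> C) (i : forall s, chom (Y s) X) (p : forall s, chom X (Y s)),
    [/\ forall s, ccomp (p s) (i s) = cid (Y s),
        forall s t, s != t -> ccomp (p t) (i s) = 0,
        forall s, ccomp (i s) (p s) = if s then q else cid X - q
      & \sum_s ccomp (i s) (p s) = cid X].
Proof.
move=> qq; have [|| Y [i [p [pi1 pi0 ip]]]] :=
    @dsum_of_idempotents bool X (fun s => if s then q else cid X - q).
- case=> [] [] // _; first by rewrite compBm ccomp1m qq subrr.
  by rewrite compmB ccompm1 qq subrr.
- by rewrite big_bool /= addrC subrK.
by exists Y, i, p; split=> //; rewrite big_bool !ip /= addrC subrK.
Qed.

End LinearMonoidal.

Arguments has_kernels {k} C.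

(** * Gradings defined by natural idempotents *)

Section NaturalIdempotents.
Local Open Scope ring_scope.
Variables (k : fieldType) (C : moncat k) (U : finGroupType).
Implicit Types X Y Z W : C.
Hypothesis kerC : has_kernels C.

Variable e : U -> forall X : C, chom X X.
Hypothesis e_nat : forall a X Y (f : chom X Y), ccomp (e a Y) f = ccomp f (e a X).
Hypothesis e_orth : forall a b X, a != b -> ccomp (e b X) (e a X) = 0.
Hypothesis e_sum : forall X, \sum_a e a X = cid X.
Hypothesis e_unit : e 1%g cunit = cid cunit.
Hypothesis e_tens : forall a b X Y, e a X = cid X -> e b Y = cid Y ->
  e (a * b)%g (tens X Y) = cid (tens X Y).

(** The objects of degree [a]: those on which [e a] is the identity. *)
Definition idem_component a X : Prop := e a X = cid X.
Local Notation Cg := idem_component.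

Lemma component_hom0 a b X Y (f : chom X Y) : a != b -> Cg a X -> Cg b Y -> f = 0.
Proof.
move=> ne aX bY; rewrite -[f]ccomp1m -bY -[f]ccompm1 -aX.
by rewrite ccompA e_nat -ccompA e_orth // compm0.
Qed.

Lemma component_dsum a (I : finType) (Y : I -> C) X :
  (forall i, Cg a (Y i)) -> is_dsum Y X -> Cg a X.
Proof.
move=> aY [inj [prj [_ _ sum1]]]; rewrite /Cg -[LHS]ccompm1 -sum1 comp_sumr.
by apply: eq_bigr => i _; rewrite ccompA e_nat aY ccompm1.
Qed.

Lemma component_sub a X Y : Cg a Y -> subobject X Y -> Cg a X.
Proof. by move=> aY [f mono_f]; apply: mono_f; rewrite -e_nat aY ccomp1m ccompm1. Qed.

Lemma component_decomposition X :
  exists2 Y : U -> C, (forall a, Cg a (Y a)) &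
  exists (inj : forall a, chom (Y a) X) (prj : forall a, chom X (Y a)),
    [/\ forall a, ccomp (prj a) (inj a) = cid (Y a),
        forall a b, a != b -> ccomp (prj b) (inj a) = 0
      & forall a, ccomp (inj a) (prj a) = e a X].
Proof.
have [Y [inj [prj [pi1 pi0 ip]]]] := dsum_of_idempotents kerC (fun a b => @e_orth a b X) (e_sum X).
exists Y; last by exists inj, prj.
move=> a; apply: (retract_mono (pi1 a)).
by rewrite -e_nat -ip -ccompA pi1.
Qed.

Lemma simple_component X : simple_obj X -> exists a, Cg a X.
Proof.
case=> nzX simX; have [Y CY [inj [prj [pi1 pi0 ip]]]] := component_decomposition X.
case: (pselect (forall a, is_zero (Y a))) => [Y0|].
  case: nzX; rewrite /is_zero -e_sum big1 // => a _.
  by rewrite -ip (hom_from_zero (inj a)) ?comp0m.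
move=> /existsNP[a nzY]; exists a.
have [//|[g [_ ig]]] := simX _ _ (retract_mono (pi1 a)).
by rewrite /Cg -[LHS]ccompm1 -ig ccompA e_nat CY ccompm1.
Qed.

(** The evaluation can only be nonzero on the component of degree [a^-1],
    and one triangle identity factors the identity of the dual through it. *)
Lemma component_dual a X D : Cg a X -> is_dual X D -> Cg a^-1%g D.
Proof.
move=> aX [ev [coev [_ tri]]].
have eD0 b : b != a^-1%g -> e b D = 0.
  move=> ne; have [Y CY [inj [prj [_ _ ip]]]] := component_decomposition D.
  have ev0 : ccomp ev (tensm (e b D) (cid X)) = 0.
    rewrite -ip -[cid X]ccompm1 tensm_comp ccompA.
    rewrite (@component_hom0 (b * a)%g 1%g _ _ (ccomp ev _)) ?comp0m //.
      by rewrite -eq_invg_mul eq_sym -(inj_eq invg_inj) invgK eq_sym.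
    exact: e_tens (CY b) aX.
  rewrite -[LHS]ccomp1m -tri -!ccompA.
  have -> : ccomp (runitor_inv D) (e b D) =
            ccomp (tensm (e b D) (cid cunit)) (runitor_inv D).
    rewrite -[LHS]ccompm1 -(runiK D) !ccompA -(ccompA _ _ (runitor D)).
    by rewrite -run_nat ccompA runK ccomp1m.
  rewrite (ccompA (tensm (cid D) coev)) -tensm_comp ccomp1m ccompm1.
  rewrite -[e b D]ccompm1 -[coev]ccomp1m tensm_comp -tensm1.
  have asi : ccomp (assoc_inv D X D) (tensm (e b D) (tensm (cid X) (cid D))) =
     ccomp (tensm (tensm (e b D) (cid X)) (cid D)) (assoc_inv D X D).
    rewrite -[LHS]ccompm1 -(associK D X D) !ccompA -(ccompA _ _ (assoc D X D)).
    by rewrite -assoc_nat ccompA assocK ccomp1m.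
  rewrite -(ccompA (tensm (e b D) _)) (ccompA (assoc_inv D X D)) asi -ccompA.
  rewrite (ccompA (tensm ev (cid D))) -tensm_comp ev0 tens0m comp0m.
  by rewrite compm0.
rewrite /Cg -e_sum (bigD1 a^-1%g) //= big1 ?addr0 // => b /eD0.
Qed.

(** A simple object and its dual have inverse degrees, so their product, and
    whatever it generates, has degree [1]. *)
Lemma adjoint_component X : adjoint_subcat X -> Cg 1%g X.
Proof.
apply; first split=> //; first split.
- by move=> Y Z CY CZ; rewrite -[1%g]mulg1; apply: e_tens.
- split=> [Y Z CY /(component_dual CY)|]; first by rewrite invg1.
  by split; [exact: component_dsum | exact: component_sub].
move=> Y Y' S /simple_component[a aY] /(component_dual aY) aY' _.
by apply: component_sub; rewrite -(mulgV a); apply: e_tens.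
Qed.

Lemma components_dsum_bimodule_cat :
  dsum_bimodule_cat (@adjoint_subcat k C) (fun _ => True) Cg.
Proof.
split=> // [a|X _|a b X Y f ne]; last exact: component_hom0.
  split=> [I Y X|X Y|X Y /adjoint_component CX CY|X Y CX /adjoint_component CY].
  - exact: component_dsum.
  - exact: component_sub.
  - by rewrite -[a]mul1g; apply: e_tens.
  - by rewrite -[a]mulg1; apply: e_tens.
have [Y CY [inj [prj [pi1 pi0 ip]]]] := component_decomposition X.
exists Y => //; exists inj, prj; split=> //.
by rewrite -[RHS]e_sum; apply: eq_bigr => a _.
Qed.

(** A decomposition of one component into two sub-bimodule categories induces
    a natural idempotent, here described only through its value at one object
    [P] and extended by zero to the other components. It commutes with
    tensoring by [D] because both summands are stable under [D]. *)
Lemma decomposition_idempotent (D : C -> Prop) a (N : bool -> C -> Prop) P :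
    (forall V, D V -> Cg 1%g V) -> dsum_bimodule_cat D (Cg a) N ->
  exists q : chom P P,
    [/\ forall X (f : chom P X), N true X -> ccomp f q = f,
        forall X (f : chom P X), N false X -> ccomp f q = 0
      & forall V (F : chom P (tens V P)), D V ->
          ccomp F q = ccomp (tensm (cid V) q) F].
Proof.
move=> D1 [Nsub NC decN hom0].
have [Y CY [inj [prj [pi1 pi0 ip]]]] := component_decomposition P.
have [Q NQ [i [p [pi1' pi0' ip1]]]] := decN _ (CY a).
(* the projection of [P] to the half of its component that lies in [N true] *)
pose q := ccomp (ccomp (inj a) (i true)) (ccomp (p true) (prj a)).
have ip1' : ccomp (i true) (p true) = cid (Y a) - ccomp (i false) (p false).
  by apply/eqP; rewrite eq_sym subr_eq -ip1 big_bool.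
have qE : q = e a P - ccomp (ccomp (inj a) (i false)) (ccomp (p false) (prj a)).
  rewrite /q -!ccompA (ccompA _ _ (prj a)) ip1' compBm ccomp1m compmB ip.
  by rewrite !ccompA.
have fe b X (f : chom P X) : Cg a X -> ccomp f (e b P) = if b == a then f else 0.
  move=> aX; case: eqP => [->|/eqP ne]; first by rewrite -e_nat aX ccomp1m.
  rewrite -ip ccompA (component_hom0 (ccomp f (inj b)) ne) ?comp0m //.
have qT X (f : chom P X) : N true X -> ccomp f q = f.
  move=> NX; rewrite qE compmB fe ?eqxx; last exact: NC NX.
  rewrite !ccompA (hom0 false true _ _ (ccomp (ccomp f (inj a)) (i false))) //.
  by rewrite !comp0m subr0.
have qF X (f : chom P X) : N false X -> ccomp f q = 0.
  move=> NX; rewrite /q !ccompA.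
  by rewrite (hom0 true false _ _ (ccomp (ccomp f (inj a)) (i true))) // !comp0m.
have qb b : b != a -> ccomp (prj b) q = 0.
  by move=> ne; rewrite /q !ccompA (pi0 a b) 1?eq_sym // !comp0m.
have bq b (ne : b != a) X (f : chom P X) : Cg b X -> ccomp f q = 0.
  move=> bX; rewrite /q !ccompA.
  by rewrite (component_hom0 (ccomp f (inj a)) _ (CY a) bX) 1?eq_sym // !comp0m.
clearbody q; exists q; split=> // V F DV.
have CV := D1 V DV.
have sub s : ccomp (tensm (cid V) (ccomp (p s) (prj a))) (ccomp F q) =
             ccomp (tensm (cid V) (ccomp (p s) (prj a))) (ccomp (tensm (cid V) q) F).
  have NV : N s (tens V (Q s)) by have [_ _ + _] := Nsub s; apply.
  rewrite !ccompA -tensm_comp ccompm1.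
  case: s NV => NV; first by rewrite !qT.
  by rewrite !qF ?tensm0 ?comp0m.
have part b : ccomp (tensm (cid V) (e b P)) (ccomp F q) =
              ccomp (tensm (cid V) (e b P)) (ccomp (tensm (cid V) q) F).
  have [->|ne] := eqVneq b a.
    have -> : e a P = \sum_s ccomp (ccomp (inj a) (i s)) (ccomp (p s) (prj a)).
      rewrite -ip -{1}[inj a]ccompm1 -ip1 comp_sumr comp_suml.
      by apply: eq_bigr => s _; rewrite !ccompA.
    rewrite tensm_sumr !comp_suml; apply: eq_bigr => s _.
    by rewrite -[cid V]ccomp1m tensm_comp -ccompA ccomp1m sub !ccompA.
  rewrite -ip -[cid V]ccomp1m tensm_comp ccomp1m -!ccompA; congr (ccomp _ _).
  rewrite !ccompA -tensm_comp qb // tensm0 comp0m.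
  by apply: (bq b ne); have := e_tens CV (CY b); rewrite mul1g.
rewrite -[LHS]ccomp1m -[RHS]ccomp1m -tensm1 -(e_sum P) tensm_sumr !comp_suml.
by apply: eq_bigr => b _; exact: part.
Qed.

End NaturalIdempotents.

(** * Uniqueness of the universal grading *)

Section Uniqueness.
Local Open Scope ring_scope.
Variables (k : fieldType) (C : moncat k).
Hypothesis kerC : has_kernels C.
Implicit Types X Y Z : C.

(** A component [C1 a] is the direct sum of its intersection with [C2 b] and of
    the objects that receive no nonzero map from [C2 b]. Both are stable under
    the adjoint subcategory, so one of them is zero; for a suitable [b] it is
    the second one. *)
Lemma grading_refine (U1 U2 : finGroupType) (C1 : U1 -> C -> Prop)
    (C2 : U2 -> C -> Prop) (a : U1) :
  universal_grading C1 -> universal_grading C2 ->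
  exists b, forall X, C1 a X -> C2 b X.
Proof.
case=> [[sub1 _ dec1 hom1] ind1 _] [[sub2 _ dec2 hom2] _ _].
have [/existsNP[X0 /not_implyP[aX0 nzX0]] indec] := ind1 a.
have [dsa suba lefta righta] := sub1 a.
have [Y0 CY0 [inj0 [prj0 [pi1 pi0 ip1]]]] := dec2 X0 I.
have [b nzY0] : exists b, ~ is_zero (Y0 b).
  apply: contrapT => /forallNP Y00; case: nzX0.
  rewrite /is_zero -ip1 big1 // => c _.
  by have /contrapT/(hom_from_zero (inj0 c))-> := Y00 c; rewrite comp0m.
have aY0 : C1 a (Y0 b).
  by apply: suba aX0 _; exists (inj0 b); apply: retract_mono (pi1 b).
have [dsb subb leftb rightb] := sub2 b.
pose N (s : bool) X := C1 a X /\
  if s then C2 b X else forall Y (f : chom Y X), C2 b Y -> f = 0.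
have Nsub s : sub_bimodule_cat (@adjoint_subcat k C) (N s).
  case: s; split=> [I Y X NY dX|X Y [aY bY] sXY|X Y DX [aY bY]|X Y [aX bX] DY]; split.
  - by apply: dsa dX => i; case: (NY i).
  - by apply: dsb dX => i; case: (NY i).
  - exact: suba aY sXY.
  - exact: subb bY sXY.
  - exact: lefta.
  - exact: leftb.
  - exact: righta.
  - exact: rightb.
  - by apply: dsa dX => i; case: (NY i).
  - move=> Z f bZ; have [inj [prj [_ _ sum1]]] := dX.
    rewrite -[f]ccomp1m -sum1 comp_suml big1 // => i _.
    by rewrite -ccompA (proj2 (NY i) _ (ccomp (prj i) f) bZ) compm0.
  - exact: suba aY sXY.
  - move=> Z f bZ; have [g mono_g] := sXY.
    by apply: mono_g; rewrite compm0 (bY _ (ccomp g f) bZ).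
  - exact: lefta.
  - move=> Z f bZ; have [Y' CY' [inj [prj [_ _ sum1]]]] := dec2 Y I.
    rewrite -[f]ccomp1m -tensm1 -sum1 tensm_sumr comp_suml big1 // => c _.
    rewrite -[cid X]ccomp1m tensm_comp.
    have [cb|ne] := eqVneq c b; first by rewrite (bY _ (inj c)) ?tensm0 ?comp0m // cb.
    rewrite -ccompA (hom2 b c _ _ (ccomp (tensm (cid X) (prj c)) f)) ?compm0 //.
      by rewrite eq_sym.
    by have [_ _ + _] := sub2 c; apply.
  - exact: righta.
  - move=> Z f bZ; have [Y' CY' [inj [prj [_ _ sum1]]]] := dec2 X I.
    rewrite -[f]ccomp1m -tensm1 -sum1 tensm_suml comp_suml big1 // => c _.
    rewrite -[cid Y]ccomp1m tensm_comp.
    have [cb|ne] := eqVneq c b; first by rewrite (bX _ (inj c)) ?tens0m ?comp0m // cb.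
    rewrite -ccompA (hom2 b c _ _ (ccomp (tensm (prj c) (cid Y)) f)) ?compm0 //.
      by rewrite eq_sym.
    by have [_ _ _ +] := sub2 c; apply.
have homN s t X Y (f : chom X Y) : s != t -> N s X -> N t Y -> f = 0.
  case: s t => [] [] // _ [aX bX] [aY bY]; first exact: bY.
  have [Y' CY' [inj [prj [_ _ sum1]]]] := dec2 X I.
  rewrite -[f]ccompm1 -sum1 comp_sumr big1 // => c _.
  have [cb|ne] := eqVneq c b; first by rewrite (bX _ (inj c)) ?comp0m ?compm0 // cb.
  by rewrite ccompA (hom2 c b _ _ (ccomp f (inj c))) ?comp0m.
have decN X : C1 a X -> exists Y : bool -> C, exists (inj : forall s, chom (Y s) X)
    (prj : forall s, chom X (Y s)),
  [/\ forall s, N s (Y s), forall i, ccomp (prj i) (inj i) = cid (Y i),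
        forall i j, i != j -> ccomp (prj j) (inj i) = 0
      & \sum_i ccomp (inj i) (prj i) = cid X].
  move=> aX; have [Y' CY' [inj [prj [pi1' pi0' sum1]]]] := dec2 X I.
  pose q := ccomp (inj b) (prj b).
  have qq : ccomp q q = q by rewrite /q !ccompA -(ccompA (inj b)) pi1' ccompm1.
  have [Y [i [p [pi2 pi3 ip ip1']]]] := dsum_of_idempotent kerC qq.
  have mono_i s : is_mono (i s) by apply: retract_mono (pi2 s).
  exists Y, i, p; split=> //; case; split; try by apply: suba aX _; eexists.
    apply: subb (CY' b) _; exists (ccomp (prj b) (i true)) => W g h.
    rewrite -!ccompA => /(congr1 (ccomp (inj b))); rewrite !(ccompA (inj b)).
    by rewrite -/q -[q](ip true) -!ccompA !(ccompA (p true)) pi2 !ccomp1m => /mono_i.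
  move=> Z f bZ; apply: mono_i; rewrite compm0 -[ccomp _ f]ccomp1m -sum1.
  rewrite comp_suml big1 // => c _; have [->|ne] := eqVneq c b.
    rewrite -/q ccompA -[i false]ccompm1 -pi2 (ccompA (i false)) ip /= ccompA.
    by rewrite compmB ccompm1 qq subrr !comp0m.
  by rewrite -ccompA (hom2 b c _ _ (ccomp (prj c) _)) ?compm0 // eq_sym.
have [|[] N0] := indec N.
- split=> [//|s X [] //|X aX|i j X Y f]; last exact: homN.
  by have [Y [inj [prj [NY H1 H2 H3]]]] := decN X aX; exists Y => //; exists inj, prj.
- by case: nzY0; apply: N0; split.
exists b => X aX; have [Y [inj [prj [NY H1 H2 H3]]]] := decN X aX.
apply: subb (proj2 (NY true)) _; exists (prj true).
apply: (@retract_mono _ _ _ _ _ (inj true)); rewrite -H3 big_bool /=.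
by rewrite (hom_from_zero (inj false)) ?comp0m ?addr0 //; apply: N0.
Qed.

Hypothesis tens_nonzero : forall X Y, ~ is_zero X -> ~ is_zero Y -> ~ is_zero (tens X Y).

Lemma universal_grading_nonzero (U : finGroupType) (Cg : U -> C -> Prop) a :
  universal_grading Cg -> exists2 X, Cg a X & ~ is_zero X.
Proof.
case=> _ ind _; have [/existsNP[X /not_implyP[aX nzX]] _] := ind a.
by exists X.
Qed.

Lemma universal_grading_inj (U : finGroupType) (Cg : U -> C -> Prop) a b X :
  universal_grading Cg -> ~ is_zero X -> Cg a X -> Cg b X -> a = b.
Proof.
case=> [[_ _ _ hom0] _ _] nzX aX bX; apply/eqP; apply: contrapT => /negP ne.
by apply: nzX; apply: hom0 ne aX bX.
Qed.

Lemma universal_grading_unique (U1 U2 : finGroupType) (C1 : U1 -> C -> Prop)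
    (C2 : U2 -> C -> Prop) :
  universal_grading C1 -> universal_grading C2 ->
  exists f : U1 -> U2, bijective f /\ forall a b, f (a * b)%g = (f a * f b)%g.
Proof.
move=> G1 G2.
have /choice[f fP] : forall a, exists b, forall X, C1 a X -> C2 b X.
  by move=> a; apply: grading_refine.
have /choice[g gP] : forall a, exists b, forall X, C2 a X -> C1 b X.
  by move=> a; apply: grading_refine.
exists f; split.
  exists g => a.
    have [X aX nzX] := universal_grading_nonzero a G1.
    by apply: (universal_grading_inj G1 nzX _ aX); apply/gP/fP.
  have [X aX nzX] := universal_grading_nonzero a G2.
  by apply: (universal_grading_inj G2 nzX _ aX); apply/fP/gP.
move=> a b.
have [X aX nzX] := universal_grading_nonzero a G1.
have [Y bY nzY] := universal_grading_nonzero b G1.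
apply: (universal_grading_inj G2 (tens_nonzero nzX nzY)).
  by apply: fP; case: G1 => _ _; apply.
by case: G2 => _ _; apply; apply: fP.
Qed.

End Uniqueness.

(** * Kernels of bimodule homomorphisms *)

Section GradedSpaces.
Local Open Scope ring_scope.
Variables (k : fieldType) (G : finGroupType).

(** Homogeneous parts given as the fixed spaces of projections: equality with
    the projection is then the membership test. *)
Definition proj_gr (V : vectType k) (p : G -> V -> V) (g : G) : {vspace V} :=
  fixedSpace (linfun (p g)).

Section ProjGrading.
Variables (V : vectType k) (p : G -> V -> V).
Hypothesis p_lin : forall g, linear (p g).

Lemma mem_proj_gr g v : reflect (p g v = v) (v \in proj_gr p g).
Proof. by rewrite -(linfunE (p_lin g)); apply: fixedSpaceP. Qed.

Lemma proj_gr_grading :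
  (forall g h v, p g (p h v) = if g == h then p h v else 0) ->
  (forall v, \sum_g p g v = v) -> is_grading (proj_gr p).
Proof.
move=> pp p_sum; split.
  apply/vspaceP => v; rewrite memvf -[v]p_sum memv_suml // => g _.
  apply: (subvP (sumv_sup g _ (subvv _))) => //.
  by apply/mem_proj_gr; rewrite pp eqxx.
apply: (directv_proj (p := p)) => // [g v /mem_proj_gr //|g h v ne /mem_proj_gr <-].
by rewrite pp (negPf ne).
Qed.

End ProjGrading.

Variable A : galg k G.
Implicit Types M N : bimod A.

Lemma grpi_id M g (m : M) : m \in bgr M g -> grpi (bgr M) g m = m.
Proof. by move=> mg; rewrite (grpi_delta (bgrP M) _ mg) eqxx. Qed.

Lemma grpi_grpi M g h (m : M) :
  grpi (bgr M) g (grpi (bgr M) h m) = if g == h then grpi (bgr M) h m else 0.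
Proof. by rewrite (grpi_delta (bgrP M) _ (grpi_mem _ _ _)). Qed.

Lemma homogeneous_ext M (V : lmodType k) (f f' : M -> V) :
    linear f -> linear f' ->
  (forall g m, m \in bgr M g -> f m = f' m) -> f =1 f'.
Proof.
move=> lf lf' ff'; apply: (grading_ind (bgrP M)) => //.
- by rewrite (linear_0 lf) (linear_0 lf').
- by move=> x y IHx IHy; rewrite (linear_D lf) (linear_D lf') IHx IHy.
Qed.

Lemma bhom_ext_homogeneous M N (f f' : bimod_hom M N) :
  (forall g m, m \in bgr M g -> f m = f' m) -> f = f'.
Proof. by move=> ff'; apply/bhom_eq/homogeneous_ext => //; apply: bhom_linear. Qed.

Lemma bhom_grpi M N (f : bimod_hom M N) g m :
  f (grpi (bgr M) g m) = grpi (bgr N) g (f m).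
Proof.
move: m; apply: homogeneous_ext => [||h m mh].
- exact: linear_comp (bhom_linear f) (grpi_linear _ g).
- exact: linear_comp (grpi_linear _ g) (bhom_linear f).
rewrite (grpi_delta (bgrP M) _ mh) (grpi_delta (bgrP N) _ (bhom_gr f mh)).
by case: eqP => // _; rewrite (linear_0 (bhom_linear f)).
Qed.

Lemma homogeneous_neq0 M (m : M) : m != 0 ->
  exists g, exists2 m', m' \in bgr M g & m' != 0.
Proof.
move=> nzm; apply: contrapT => H; case/eqP: nzm.
rewrite -[m](grpi_sum (bgrP M)) big1 // => g _; apply/eqP/negPn/negP => nz.
by case: H; exists g, (grpi (bgr M) g m) => //; apply: grpi_mem.
Qed.

Section Kernel.
Variables (M N : bimod A) (f : bimod_hom M N).
Let V : {vspace M} := lker (bhom_val f).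

Let memV v : (v \in V) = (f v == 0). Proof. exact: memv_ker. Qed.
Let fV (u : subvs_of V) : f (vsval u) = 0.
Proof. by apply/eqP; rewrite -memV subvsP. Qed.

Let kpi g (u : subvs_of V) : subvs_of V := vsproj V (grpi (bgr M) g (vsval u)).

Let kpiE g u : vsval (kpi g u) = grpi (bgr M) g (vsval u).
Proof.
by rewrite vsprojK // memV bhom_grpi fV (linear_0 (grpi_linear _ g)).
Qed.

Let kpi_lin g : linear (kpi g).
Proof. by move=> c x y; apply: val_inj; rewrite /= !kpiE linearP grpi_linear. Qed.

Let klact a (u : subvs_of V) : subvs_of V := vsproj V (lact a (vsval u)).
Let kract (u : subvs_of V) a : subvs_of V := vsproj V (ract (vsval u) a).

Let klactE a u : vsval (klact a u) = lact a (vsval u).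
Proof. by rewrite vsprojK // memV bhom_lact fV (linear_0 (lact_linr a)). Qed.
Let kractE u a : vsval (kract u a) = ract (vsval u) a.
Proof. by rewrite vsprojK // memV bhom_ract fV (linear_0 (ract_linl a)). Qed.

Let kgr g (u : subvs_of V) : (u \in proj_gr kpi g) = (vsval u \in bgr M g).
Proof.
apply/(mem_proj_gr kpi_lin)/idP => [<-|uM]; first by rewrite kpiE grpi_mem.
by apply: val_inj; rewrite /= kpiE grpi_id.
Qed.

Definition bker : bimod A.
Proof.
apply: (@Bimod k G A (subvs_of V) (proj_gr kpi) klact kract).
- apply: proj_gr_grading => [//|g h u|u].
    apply: val_inj; rewrite /= !kpiE grpi_grpi.
    by case: eqP; rewrite ?kpiE.
  apply: val_inj; rewrite /= linear_sum -[RHS](grpi_sum (bgrP M)).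
  by apply: eq_bigr => g _; exact: kpiE.
- by move=> u c a b; apply: val_inj; rewrite /= !(klactE, linearP) lact_linl.
- by move=> a c x y; apply: val_inj; rewrite /= !(klactE, linearP) lact_linr.
- by move=> a c x y; apply: val_inj; rewrite /= !(kractE, linearP) ract_linl.
- by move=> u c a b; apply: val_inj; rewrite /= !(kractE, linearP) ract_linr.
- by move=> u; apply: val_inj; rewrite /= klactE lact1.
- by move=> a b u; apply: val_inj; rewrite /= !klactE lactM.
- by move=> u; apply: val_inj; rewrite /= kractE ract1.
- by move=> u a b; apply: val_inj; rewrite /= !kractE ractM.
- by move=> a u b; apply: val_inj; rewrite /= !(kractE, klactE) lract.
- by move=> g h a u ag; rewrite !kgr klactE; apply: lact_gr.
- by move=> g h u a + ah; rewrite !kgr kractE => ug; apply: ract_gr.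
Defined.

Definition bker_inj : bimod_hom bker M.
Proof.
apply: (@mkhom k G A bker M (fun u => vsval (u : subvs_of V))).
- by move=> c x y; rewrite linearP.
- by move=> a u; rewrite klactE.
- by move=> u a; rewrite kractE.
- by move=> g u; rewrite kgr.
Defined.

Lemma bker_injE (u : bker) : bker_inj u = vsval (u : subvs_of V).
Proof. exact: mkhomE. Qed.

Lemma bker_lift W (g : bimod_hom W M) : (forall w, f (g w) = 0) ->
  exists g' : bimod_hom W bker, forall w, bker_inj (g' w) = g w.
Proof.
move=> fg; have gV w : vsval (vsproj V (g w)) = g w.
  by rewrite vsprojK // memV fg.
exists (@mkhom k G A W bker (fun w => vsproj V (g w))
  ltac:(by move=> c x y; rewrite !linearP)
  ltac:(by move=> a w; apply: val_inj; rewrite /= klactE !gV bhom_lact)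
  ltac:(by move=> w a; apply: val_inj; rewrite /= kractE !gV bhom_ract)
  ltac:(by move=> h w wh; rewrite kgr gV bhom_gr)) => w.
by rewrite bker_injE mkhomE gV.
Qed.

End Kernel.

Local Notation C := (Bimodules A).

Lemma bimod_compE (M N P : C) (f : chom N P) (g : chom M N) (m : (M : bimod A)) :
  (ccomp f g : bimod_hom _ _) m = (f : bimod_hom _ _) ((g : bimod_hom _ _) m).
Proof. exact: bcompE. Qed.

Lemma bimod_cidE (M : C) (m : (M : bimod A)) : (cid M : bimod_hom _ _) m = m.
Proof. exact: bidE. Qed.

Lemma bhom0E M N (m : M) : (0 : bimod_hom M N) m = 0.
Proof. by rewrite lfunE. Qed.

Lemma bhomDE M N (f g : bimod_hom M N) (m : M) : (f + g) m = f m + g m.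
Proof. by rewrite lfunE. Qed.

Lemma bhom_sumE M N (I : finType) (F : I -> bimod_hom M N) (m : M) :
  (\sum_i F i) m = \sum_i F i m.
Proof.
elim/big_rec2: _ => [|i y x _ <-]; first exact: bhom0E.
exact: bhomDE.
Qed.

Lemma bimod_zeroP (M : C) : is_zero M <-> forall m : (M : bimod A), m = 0.
Proof.
split=> [M0 m|M0]; first by rewrite -[m](@bimod_cidE M) M0 bhom0E.
by apply: bhom_eq => m; rewrite bhom0E; apply: M0.
Qed.

Lemma bimod_has_kernels : has_kernels C.
Proof.
move=> M N f; exists (bker f), (bker_inj f); split.
- move=> W g h gh; apply: bhom_eq => w; apply: val_inj => /=.
  by have /(congr1 (fun q : bimod_hom W M => q w)) := gh;
     rewrite !bcompE !bker_injE.
- apply: bhom_eq => u; rewrite bimod_compE bhom0E bker_injE.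
  by apply/eqP; rewrite -memv_ker subvsP.
move=> W g fg; have [|g' g'E] := @bker_lift M N f W g.
  move=> w; have /(congr1 (fun q : bimod_hom W N => q w)) := fg.
  by rewrite bcompE bhom0E.
by exists g'; apply: bhom_eq => w; rewrite bimod_compE g'E.
Qed.

Lemma bimod_mono_inj (M N : C) (f : chom M N) :
  is_mono f -> injective (f : bimod_hom M N).
Proof.
move=> mono_f; have i0 : (bker_inj f : chom (bker f : C) M) = 0.
  apply: mono_f; rewrite compm0; apply: bhom_eq => u.
  rewrite bimod_compE bhom0E bker_injE.
  by apply/eqP; rewrite -memv_ker subvsP.
have ker0 (m : (M : bimod A)) : (f : bimod_hom M N) m = 0 -> m = 0.
  move=> fm; have mV : m \in lker (bhom_val f) by rewrite memv_ker fm.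
  have := congr1 (fun h : bimod_hom _ _ => h (vsproj _ m : bker f)) i0.
  by rewrite bhom0E bker_injE vsprojK.
move=> x y fxy; apply/eqP; rewrite -subr_eq0; apply/eqP/ker0.
by rewrite (linear_B (bhom_linear f)) fxy subrr.
Qed.

End GradedSpaces.

(** * Complete reducibility of bimodules over a group algebra *)

Section GroupAlgebraBimodules.
Local Open Scope ring_scope.
Variables (k : fieldType) (G : finGroupType) (H : {group G}).
Local Notation A := (group_algebra k H).
Local Notation C := (group_theoretical k H).
Implicit Types (M N : bimod A) (h : subg_of H).

Definition la M h (m : M) : M := lact (ga_basis k h : A) m.
Definition ra M (m : M) h : M := ract m (ga_basis k h : A).

Lemma la_lin M h : linear (@la M h). Proof. exact: lact_linr. Qed.
Lemma ra_lin M h : linear (fun m : M => ra m h). Proof. exact: ract_linl. Qed.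
Lemma la1 M (m : M) : la 1%g m = m. Proof. exact: lact1. Qed.
Lemma ra1 M (m : M) : ra m 1%g = m. Proof. exact: ract1. Qed.
Lemma laM M h h' (m : M) : la (h * h')%g m = la h (la h' m).
Proof. by rewrite /la -lactM; congr (lact _ m); rewrite -ga_basisM. Qed.
Lemma raM M h h' (m : M) : ra m (h * h')%g = ra (ra m h) h'.
Proof. by rewrite /ra -ractM; congr (ract m _); rewrite -ga_basisM. Qed.
Lemma lara M h h' (m : M) : ra (la h m) h' = la h (ra m h').
Proof. exact: lract. Qed.
Lemma laK M h : cancel (@la M h) (la h^-1%g).
Proof. by move=> m; rewrite -laM mulVg la1. Qed.
Lemma raK M h : cancel (fun m : M => ra m h) (fun m => ra m h^-1%g).
Proof. by move=> m; rewrite -raM mulgV ra1. Qed.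
Lemma raVK M h : cancel (fun m : M => ra m h^-1%g) (fun m => ra m h).
Proof. by move=> m; rewrite -raM mulVg ra1. Qed.

Lemma la_gr M h g (m : M) : m \in bgr M g -> la h m \in bgr M (sgval h * g)%g.
Proof. by move=> mg; apply: lact_gr => //; apply: ga_basis_gr. Qed.
Lemma ra_gr M h g (m : M) : m \in bgr M g -> ra m h \in bgr M (g * sgval h)%g.
Proof. by move=> mg; apply: ract_gr => //; apply: ga_basis_gr. Qed.

Lemma lactE M (a : A) (m : M) : lact a m = \sum_h (a : grpalg k H) h *: la h m.
Proof.
rewrite [in LHS](ga_sum (a : grpalg k H)) (linear_S _ _ _ (lact_linl m)).
by apply: eq_bigr => h _; rewrite (linear_Z (lact_linl m)).
Qed.

Lemma ractE M (m : M) (a : A) : ract m a = \sum_h (a : grpalg k H) h *: ra m h.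
Proof.
rewrite [in LHS](ga_sum (a : grpalg k H)) (linear_S _ _ _ (ract_linr m)).
by apply: eq_bigr => h _; rewrite (linear_Z (ract_linr m)).
Qed.

Lemma bhom_la M N (f : bimod_hom M N) h m : f (la h m) = la h (f m).
Proof. exact: bhom_lact. Qed.
Lemma bhom_ra M N (f : bimod_hom M N) m h : f (ra m h) = ra (f m) h.
Proof. exact: bhom_ract. Qed.

Section MakeHom.
Variables (M N : bimod A).

Definition basis_hom (f : M -> N) (lf : linear f)
    (fl : forall h m, f (la h m) = la h (f m))
    (fr : forall m h, f (ra m h) = ra (f m) h)
    (fg : forall g m, m \in bgr M g -> f m \in bgr N g) : bimod_hom M N.
Proof.
apply: (@mkhom k G A M N f lf) => // [a m|m a].
  rewrite !lactE (linear_S _ _ _ lf); apply: eq_bigr => h _.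
  by rewrite (linear_Z lf) fl.
rewrite !ractE (linear_S _ _ _ lf); apply: eq_bigr => h _.
by rewrite (linear_Z lf) fr.
Defined.

Lemma basis_homE f lf fl fr fg : @basis_hom f lf fl fr fg =1 f.
Proof. exact: mkhomE. Qed.

Variable phi : G -> M -> N.
Hypothesis phi_lin : forall g, linear (phi g).
Hypothesis phi_gr : forall g m, m \in bgr M g -> phi g m \in bgr N g.
Hypothesis phi_la : forall g h m, m \in bgr M g ->
  phi (sgval h * g)%g (la h m) = la h (phi g m).
Hypothesis phi_ra : forall g h m, m \in bgr M g ->
  phi (g * sgval h)%g (ra m h) = ra (phi g m) h.

Let ghom_fun m := \sum_g phi g (grpi (bgr M) g m).

Let ghom_funE g m : m \in bgr M g -> ghom_fun m = phi g m.
Proof.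
move=> mg; rewrite /ghom_fun (bigD1 g) //= (grpi_id mg) big1 ?addr0 // => h ne.
by rewrite (grpi_delta (bgrP M) _ mg) (negPf ne) (linear_0 (phi_lin h)).
Qed.

Let ghom_lin : linear ghom_fun.
Proof.
by apply: linear_sumf => g _ c x y; rewrite grpi_linear phi_lin.
Qed.

Definition ghom : bimod_hom M N.
Proof.
apply: (@basis_hom ghom_fun ghom_lin) => [h|m h|g m mg].
- apply: homogeneous_ext => [||g m mg].
  + exact: linear_comp ghom_lin (la_lin h).
  + exact: linear_comp (la_lin h) ghom_lin.
  + by rewrite (ghom_funE mg) (ghom_funE (la_gr h mg)) phi_la.
- move: m; apply: homogeneous_ext => [||g m mg].
  + exact: linear_comp ghom_lin (ra_lin h).
  + exact: linear_comp (ra_lin h) ghom_lin.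
  + by rewrite (ghom_funE mg) (ghom_funE (ra_gr h mg)) phi_ra.
- by rewrite (ghom_funE mg) phi_gr.
Defined.

Lemma ghomE g m : m \in bgr M g -> ghom m = phi g m.
Proof. by move=> mg; rewrite basis_homE (ghom_funE mg). Qed.

End MakeHom.

Lemma card_subg_of : #|{: subg_of H}| = #|H|.
Proof. by rewrite -cardsT -(card_isog (isog_subg H)). Qed.

Section Maschke.
Hypothesis cardH : #|H|%:R != 0 :> k.

(** Average a linear retraction over [H] on both sides, after cutting it down
    to its homogeneous components. *)
Lemma bimod_maschke M N (f : bimod_hom M N) : injective f ->
  exists r : bimod_hom N M, forall m, r (f m) = m.
Proof.
move=> inj_f; pose r0 := (bhom_val f)^-1%VF.
have r0K m : r0 (f m) = m by apply: lker0_lfunK; apply/lker0P.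
have r0_lin : linear r0 by move=> c x y; rewrite linearP.
pose c := (#|H|%:R * #|H|%:R)^-1 : k.
pose psi g h h' (n : N) : M :=
  la h^-1%g (ra (grpi (bgr M) (sgval h * g * sgval h')%g (r0 (la h (ra n h')))) h'^-1%g).
pose phi g (n : N) : M := c *: \sum_h \sum_h' psi g h h' n.
have psi_lin g h h' : linear (psi g h h').
  by move=> d x y; rewrite /psi !(ra_lin, la_lin, r0_lin, grpi_linear).
have phi_lin g : linear (phi g).
  move=> d x y; rewrite /phi scalerA mulrC -scalerA -scalerDr; congr (_ *: _).
  rewrite scaler_sumr -big_split; apply: eq_bigr => h _ /=.
  by rewrite scaler_sumr -big_split; apply: eq_bigr => h' _ /=; apply: psi_lin.
have psi_f g m h h' : m \in bgr M g -> psi g h h' (f m) = m.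
  move=> mg; rewrite /psi -bhom_ra -bhom_la r0K.
  by rewrite grpi_id ?la_gr -?mulgA ?ra_gr ?la_gr // ?lara ?raK ?laK // ra_gr.
have phi_gr g n : n \in bgr N g -> phi g n \in bgr M g.
  move=> ng; rewrite memvZ // memv_suml // => h _; rewrite memv_suml // => h' _.
  have := la_gr h^-1%g (ra_gr h'^-1%g (grpi_mem (bgr M)
    (sgval h * g * sgval h')%g (r0 (la h (ra n h'))))).
  rewrite -[sgval h'^-1%g]/((sgval h')^-1)%g mulgK.
  by rewrite -[sgval h^-1%g]/((sgval h)^-1)%g mulKg.
have phi_la g h0 n : n \in bgr N g ->
    phi (sgval h0 * g)%g (la h0 n) = la h0 (phi g n).
  move=> _; rewrite /phi (linear_Z (la_lin h0)) (linear_S _ _ _ (la_lin h0)).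
  congr (_ *: _); rewrite [RHS](reindex_inj (mulIg h0)) /=.
  apply: eq_bigr => h _; rewrite (linear_S _ _ _ (la_lin h0)).
  apply: eq_bigr => h' _; rewrite /psi lara -!laM invMg mulKVg.
  by rewrite -[sgval (h * h0)%g]/(sgval h * sgval h0)%g !mulgA.
have phi_ra g h0 n : n \in bgr N g ->
    phi (g * sgval h0)%g (ra n h0) = ra (phi g n) h0.
  move=> _; rewrite /phi (linear_Z (ra_lin h0)) (linear_S _ _ _ (ra_lin h0)).
  congr (_ *: _); apply: eq_bigr => h _; rewrite (linear_S _ _ _ (ra_lin h0)).
  rewrite [RHS](reindex_inj (mulgI h0)) /=; apply: eq_bigr => h' _.
  rewrite /psi lara -!raM invMg -!mulgA mulVg mulg1.
  by rewrite -[sgval (h0 * h')%g]/(sgval h0 * sgval h')%g !mulgA.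
exists (ghom phi_lin phi_gr phi_la phi_ra); apply: homogeneous_ext => // [|g m mg].
  exact: linear_comp (bhom_linear _) (bhom_linear f).
rewrite (ghomE _ _ _ _ (bhom_gr f mg)) /phi.
under eq_bigr => h _ do under eq_bigr => h' _ do rewrite (psi_f _ _ _ _ mg).
rewrite !sumr_const card_subg_of -mulrnA -scaler_nat scalerA natrM mulVf ?scale1r //.
by rewrite mulf_neq0.
Qed.

Lemma bimod_inj_dim_iso (M N : C) (f : chom M N) :
  injective (f : bimod_hom M N) -> (\dim {:(N : bimod A)} <= \dim {:(M : bimod A)})%N ->
  is_iso f.
Proof.
move=> inj_f dim_le; have [r rf] := bimod_maschke inj_f.
exists r; split; apply: bhom_eq => m; rewrite bimod_compE bimod_cidE //.
have ker0 : lker (bhom_val (f : bimod_hom M N)) == 0%VS by apply/lker0P.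
have imf : limg (bhom_val (f : bimod_hom M N)) = fullv.
  apply/eqP; rewrite eqEdim subvf /= limg_dim_eq //.
  by rewrite (eqP ker0) capv0.
have : m \in limg (bhom_val (f : bimod_hom M N)) by rewrite imf memvf.
by case/memv_imgP => m' _ ->; rewrite rf.
Qed.

(** Complete reducibility, in the form of an induction principle: a bimodule
    that is neither zero nor simple has a proper summand by Maschke's theorem. *)
Lemma bimod_semisimple_ind (Q : C -> Prop) :
    (forall (I : finType) (Y : I -> C) X, (forall i, Q (Y i)) -> is_dsum Y X -> Q X) ->
    (forall S, simple_obj S -> Q S) ->
  forall M : C, Q M.
Proof.
move=> Qsum Qsim M.
have [n] := ubnP (\dim {:(M : bimod A)}); elim: n M => // n IH M leMn.
have [M0|nzM] := pselect (is_zero M).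
  apply: (Qsum void (fun v : void => match v with end)); first by case.
  exists (fun v : void => match v with end), (fun v : void => match v with end).
  by split; [case | case | rewrite big_pred0 //; case].
have [/Qsim //|nsM] := pselect (simple_obj M).
have [Y [f [mono_f nzY nisof]]] :
    exists (Y : C) (f : chom Y M), [/\ is_mono f, ~ is_zero Y & ~ is_iso f].
  apply: contrapT => /forallNP nY; apply: nsM; split=> // Y f mono_f.
  have /forallNP/(_ f) nf := nY Y.
  have [|nzY] := pselect (is_zero Y); first by left.
  by right; apply: contrapT => nisof; apply: nf.
have [r rf] := bimod_maschke (bimod_mono_inj mono_f).
have {}rf : ccomp (r : chom M Y) f = cid Y.
  by apply: bhom_eq => y; rewrite bimod_compE bimod_cidE rf.
pose q : chom M M := ccomp f (r : chom M Y).
have qq : ccomp q q = q by rewrite /q !ccompA -(ccompA f) rf ccompm1.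
have [N [i [p [pi1 pi0 ip ip1]]]] :=
  dsum_of_idempotent (@bimod_has_kernels k G A) qq.
apply: (Qsum _ N); last by exists i, p.
move=> s; apply: IH; rewrite -ltnS; apply: leq_trans leMn; rewrite ltnS ltnNge.
apply/negP => le_dim.
have [|g [_ ig]] := bimod_inj_dim_iso (f := i s) _ le_dim.
  exact: bimod_mono_inj (retract_mono (pi1 s)).
have es : (if s then q else cid M - q) = cid M.
  rewrite -ip -[LHS]ccompm1 -[X in ccomp _ X = _]ig.
  by rewrite ccompA -(ccompA (i s)) pi1 ccompm1 ig.
case: s es {le_dim g ig} => es; first by apply: nisof; exists r.
apply: nzY; apply: mono_f; rewrite ccompm1 compm0 -[f]ccomp1m -es compBm ccomp1m.
by rewrite /q -ccompA rf ccompm1 subrr.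
Qed.

End Maschke.

End GroupAlgebraBimodules.

(** * Dual bimodules *)

Section Duals.
Local Open Scope ring_scope.
Variables (k : fieldType) (G : finGroupType).

Section DualBimodule.
Variables (A : galg k G) (M : bimod A).
Let D : vectType k := 'Hom(M, k^o).

Let pull (phi : M -> M) (f : D) : D := linfun (fun m => f (phi m)).

Let pullE phi f m : linear phi -> pull phi f m = f (phi m).
Proof.
by move=> lp; rewrite linfunE // => c x y; rewrite lp linearP.
Qed.

Let pull_lin phi : linear phi -> linear (pull phi).
Proof.
move=> lp c f f'; apply/lfunP => m.
by rewrite pullE // !(add_lfunE, scale_lfunE) !pullE.
Qed.

Let dpi g : D -> D := pull (grpi (bgr M) g^-1%g).
Let dpiE g (f : D) m : dpi g f m = f (grpi (bgr M) g^-1%g m).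
Proof. exact: pullE (grpi_linear _ _). Qed.
Let dpi_lin g : linear (dpi g). Proof. exact: pull_lin (grpi_linear _ _). Qed.

Let dlact a : D -> D := pull (fun m => ract m a).
Let dract (f : D) a : D := pull (lact a) f.
Let dlactE a (f : D) m : dlact a f m = f (ract m a).
Proof. exact: pullE (ract_linl a). Qed.
Let dractE a (f : D) m : dract f a m = f (lact a m).
Proof. exact: pullE (lact_linr a). Qed.

Let dgrP g (f : D) : f \in proj_gr dpi g <->
  forall h m, m \in bgr M h -> h != g^-1%g -> f m = 0.
Proof.
split=> [/(mem_proj_gr dpi_lin) <- h m mh ne|f0].
  by rewrite dpiE (grpi_delta (bgrP M) _ mh) eq_sym (negPf ne) linear0.
apply/(mem_proj_gr dpi_lin)/lfunP; apply: homogeneous_ext => [||h m mh].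
- exact: linearP.
- exact: linearP.
rewrite dpiE (grpi_delta (bgrP M) _ mh) eq_sym.
by case: eqP => // /eqP ne; rewrite linear0 (f0 h).
Qed.

(** The linear dual, with [(a f) m = f (m a)], [(f a) m = f (a m)], and the
    forms of degree [g] vanishing off degree [g^-1]. *)
Definition bdual : bimod A.
Proof.
apply: (@Bimod k G A D (proj_gr dpi) dlact dract).
- apply: proj_gr_grading => [//|g h f|f]; apply/lfunP => m.
    rewrite !dpiE grpi_grpi (inj_eq invg_inj) eq_sym.
    by case: eqP => [->|_]; rewrite ?dpiE // linear0 lfunE.
  rewrite sum_lfunE -[in RHS](grpi_sum (bgrP M) m) linear_sum /=.
  rewrite [RHS](reindex_inj invg_inj) /=.
  by apply: eq_bigr => g _; rewrite dpiE.
- by move=> f c a b; apply/lfunP => m; 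
  rewrite dlactE !(add_lfunE, scale_lfunE) !dlactE ract_linr linearP.
- by move=> a; apply: pull_lin (ract_linl a).
- by move=> a; apply: pull_lin (lact_linr a).
- by move=> f c a b; apply/lfunP => m; 
  rewrite dractE !(add_lfunE, scale_lfunE) !dractE lact_linl linearP.
- by move=> f; apply/lfunP => m; rewrite dlactE ract1.
- by move=> a b f; apply/lfunP => m; rewrite !dlactE ractM.
- by move=> f; apply/lfunP => m; rewrite dractE lact1.
- by move=> f a b; apply/lfunP => m; rewrite !dractE lactM.
- by move=> a f b; apply/lfunP => m; rewrite !(dractE, dlactE) lract.
- move=> g h a f ag /dgrP f0; apply/dgrP => j m mj ne.
  rewrite dlactE (f0 _ _ (ract_gr mj ag)) //; apply: contra ne => /eqP E.
  by rewrite invMg -E mulgK.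
- move=> g h f a /dgrP f0 ah; apply/dgrP => j m mj ne.
  rewrite dractE (f0 _ _ (lact_gr ah mj)) //; apply: contra ne => /eqP E.
  by rewrite invMg -E mulKg.
Defined.

Definition form_of (f : bdual) : 'Hom(M, k^o) := f.

Lemma bdual_lactE a f m : form_of (lact a f) m = form_of f (ract m a).
Proof. exact: dlactE. Qed.
Lemma bdual_ractE a f m : form_of (ract f a) m = form_of f (lact a m).
Proof. exact: dractE. Qed.
Lemma bdual_grP g (f : bdual) : f \in bgr bdual g <->
  forall h m, m \in bgr M h -> h != g^-1%g -> form_of f m = 0.
Proof. exact: dgrP. Qed.

Definition dual_form (phi : M -> k^o) : bdual := linfun phi.
Lemma dual_formE phi m : linear phi -> form_of (dual_form phi) m = phi m.
Proof. by move=> lphi; rewrite /form_of linfunE. Qed.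

Definition casimir : btens M bdual :=
  \sum_(i < \dim {:M}) pt ((vbasis {:M})`_i : M) (dual_form (coord (vbasis {:M}) i)).

Let coordE i m : form_of (dual_form (coord (vbasis {:M}) i)) m = coord (vbasis {:M}) i m.
Proof. by apply: dual_formE => c x y; rewrite linearP. Qed.

Lemma form_of_coord (f : bdual) m :
  form_of f m = \sum_(i < \dim {:M}) coord (vbasis {:M}) i m * form_of f (vbasis {:M})`_i.
Proof.
rewrite [in LHS](coord_vbasis (memvf m)) linear_sum.
by apply: eq_bigr => i _; rewrite linearZ.
Qed.

Lemma dual_form_basis (f : bdual) :
  f = \sum_(i < \dim {:M}) form_of f (vbasis {:M})`_i *: dual_form (coord (vbasis {:M}) i).
Proof.
apply/lfunP => m; rewrite [LHS]form_of_coord sum_lfunE.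
by apply: eq_bigr => i _; rewrite scale_lfunE [X in _ = _ *: X]coordE mulrC.
Qed.

(** The sum of [m_i (x) f_i] over a basis and its dual basis allows operators to
    be moved across the tensor product by transposition. *)
Lemma casimir_slide (theta phi : M -> M) (psi : bdual -> bdual) :
    linear theta -> (forall f m, form_of (psi f) m = form_of f (phi m)) ->
  \sum_(i < \dim {:M}) pt (theta (phi (vbasis {:M})`_i)) (dual_form (coord (vbasis {:M}) i)) =
  \sum_(i < \dim {:M}) pt (theta (vbasis {:M})`_i) (psi (dual_form (coord (vbasis {:M}) i))).
Proof.
move=> lth adj.
transitivity (\sum_(i < \dim {:M}) \sum_(j < \dim {:M})
    coord (vbasis {:M}) j (phi (vbasis {:M})`_i) *:
    pt (theta (vbasis {:M})`_j) (dual_form (coord (vbasis {:M}) i))).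
  apply: eq_bigr => i _; rewrite [in LHS](coord_vbasis (memvf (phi _))).
  rewrite (linear_S _ _ _ lth) (linear_S _ _ _ (pt_linl _)).
  by apply: eq_bigr => j _; rewrite (linear_Z lth) (linear_Z (pt_linl _)).
rewrite exchange_big; apply: eq_bigr => j _ /=.
rewrite [in RHS](dual_form_basis (psi _)) (linear_S _ _ _ (pt_linr _)).
by apply: eq_bigr => i _; rewrite (linear_Z (pt_linr _)) adj coordE.
Qed.

Lemma casimir_act a : lact a casimir = ract casimir a.
Proof.
rewrite /casimir (linear_S _ _ _ (lact_linr a)) (linear_S _ _ _ (ract_linl a)).
under eq_bigr => i _ do rewrite pt_lact.
under [RHS]eq_bigr => i _ do rewrite pt_ract.
by apply: (casimir_slide (theta := id)) => // f m; apply: bdual_ractE.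
Qed.

(** Sliding the projections of the grading across the tensor product exhibits
    the Casimir element as a sum of terms of degree [g g^-1]. *)
Lemma casimir_gr : casimir \in bgr (btens M bdual) 1%g.
Proof.
pose dp g (f : bdual) : bdual := dual_form (fun m => form_of f (grpi (bgr M) g m)).
have dpE g f m : form_of (dp g f) m = form_of f (grpi (bgr M) g m).
  by rewrite dual_formE // => c x y; rewrite grpi_linear linearP.
have dp_lin g : linear (dp g).
  by move=> c f f'; apply/lfunP => m; rewrite [LHS]dpE !(add_lfunE, scale_lfunE) -!dpE.
have dp_gr g f : dp g f \in bgr bdual g^-1%g.
  apply/bdual_grP => h m mh; rewrite invgK dpE (grpi_delta (bgrP M) _ mh) eq_sym.
  by move=> /negPf->; rewrite linear0.
have -> : casimir = \sum_g \sum_(i < \dim {:M}) pt (grpi (bgr M) g (vbasis {:M})`_i)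
    (dp g (dual_form (coord (vbasis {:M}) i))).
  transitivity (\sum_(i < \dim {:M}) \sum_g pt (grpi (bgr M) g (vbasis {:M})`_i)
                                 (dual_form (coord (vbasis {:M}) i))).
    apply: eq_bigr => i _; rewrite -(linear_S _ _ _ (pt_linl _)).
    by rewrite (grpi_sum (bgrP M)).
  rewrite exchange_big /=; apply: eq_bigr => g _ /=.
  rewrite -(casimir_slide (grpi_linear _ g) (dpE g)).
  by apply: eq_bigr => i _; rewrite grpi_grpi eqxx.
rewrite memv_suml // => g _; rewrite memv_suml // => i _.
by rewrite -(mulgV g); apply: pt_gr (grpi_mem _ _ _) (dp_gr _ _).
Qed.

End DualBimodule.
End Duals.

Section GroupAlgebraDuals.
Local Open Scope ring_scope.
Variables (k : fieldType) (G : finGroupType) (H : {group G}).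
Local Notation A := (group_algebra k H).
Local Notation C := (group_theoretical k H).
Hypothesis cardH : #|H|%:R != 0 :> k.

Lemma ga_basis_mull (h x : subg_of H) (u : grpalg k H) :
  (ga_basis k h * u) x = u (h^-1 * x)%g.
Proof.
rewrite !ffunE (bigD1 h) //= ffunE eqxx mul1r big1 ?addr0 // => y ne.
by rewrite ffunE (negPf ne) mul0r.
Qed.

Lemma ga_basis_mulr (h x : subg_of H) (u : grpalg k H) :
  (u * ga_basis k h) x = u (x * h^-1)%g.
Proof.
rewrite !ffunE (bigD1 (x * h^-1)%g) //= ffunE invMg invgK mulgKV eqxx mulr1.
rewrite big1 ?addr0 // => y ne; rewrite ffunE; case: eqP => [E|_]; last by rewrite mulr0.
by case/eqP: ne; rewrite -E invMg invgK mulKVg.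
Qed.

Lemma ga_gr_mem g (u : grpalg k H) :
  (forall x : subg_of H, sgval x != g -> u x = 0) -> u \in ga_gr k H g.
Proof.
move=> u0; rewrite [u]ga_sum memv_suml // => x _.
have [<-|ne] := eqVneq (sgval x) g; first by rewrite memvZ ?ga_basis_gr.
by rewrite u0 // scale0r mem0v.
Qed.

Section Pairing.
Variable M : bimod A.

Let evf (f : bdual M) (m : M) : grpalg k H :=
  [ffun h => form_of f (ra m h^-1%g)].

Let evf_bal : balanced evf.
Proof.
split=> [m c x y|f c x y|f a m]; apply/ffunP => h; rewrite !ffunE.
- by rewrite /form_of add_lfunE scale_lfunE.
- by rewrite ra_lin linearP.
- by rewrite bdual_ractE /ra lract.
Qed.

(** The evaluation of the pairing, [f (x) m |-> sum_h f (m h^-1) h]: the bimodule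
    map whose coefficient at [1] is the pairing of [f] with [m]. *)
Definition bev : bimod_hom (btens (bdual M) M) (bunit A).
Proof.
apply: (@basis_hom k G H (btens (bdual M) M) (bunit A) (blift evf)
          (blift_linear _)) => [h|t h|x t].
- apply: pt_ext => [||f m].
  + by apply: linear_f_lact; exact: blift_linear.
  + exact: linear_comp (la_lin h) (blift_linear _).
  + rewrite /la pt_lact !(bliftE _ _ evf_bal); apply/ffunP => x.
    rewrite [in RHS]/lact /= ga_basis_mull !ffunE bdual_lactE invMg invgK.
    by rewrite raM.
- move: t; apply: pt_ext => [||f m].
  + by apply: linear_f_ract; exact: blift_linear.
  + exact: linear_comp (ra_lin h) (blift_linear _).
  + rewrite /ra pt_ract !(bliftE _ _ evf_bal); apply/ffunP => x.
    rewrite [in RHS]/ract /= ga_basis_mulr !ffunE invMg invgK.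
    by rewrite raM.
- elim/pt_gr_ind => [|c t1 t2 IH1 IH2|i j f m fi mj <-].
  + by rewrite (linear_0 (blift_linear _)) mem0v.
  + by rewrite blift_linear memvD ?memvZ.
  rewrite (bliftE _ _ evf_bal); apply: ga_gr_mem => h ne; rewrite ffunE.
  have /bdual_grP/(_ _ _ (ra_gr h^-1%g mj))-> // := fi.
  apply: contra ne => /eqP E; apply/eqP.
  by rewrite -[LHS]invgK -[(sgval h)^-1%g](mulKg j) E invMg !invgK.
Defined.

Lemma bevE (f : bdual M) (m : M) :
  bev (pt f m) = [ffun h => form_of f (ra m h^-1%g)] :> grpalg k H.
Proof. by rewrite basis_homE (bliftE _ _ evf_bal). Qed.

(** Dividing by the order of [H] compensates the sum over [H] in the
    evaluation, so that the triangle identities hold. *)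
Definition bcoev : bimod_hom (bunit A) (btens M (bdual M)).
Proof.
apply: (@mkhom k G A (bunit A) (btens M (bdual M))
          (fun a => (#|H|%:R^-1 : k) *: lact (a : A) (casimir M))).
- by move=> c x y; rewrite lact_linl scalerDr !scalerA mulrC.
- by move=> a m; rewrite lactM (linear_Z (lact_linr a)).
- move=> m a; rewrite (linear_Z (ract_linl a)) lract -casimir_act -lactM //.
- move=> g m mg; rewrite memvZ // -[g]mulg1.
  exact: lact_gr mg (casimir_gr M).
Defined.

Lemma bcoev1 : bcoev (1 : bunit A) = #|H|%:R^-1 *: casimir M.
Proof. by rewrite mkhomE lact1. Qed.

Lemma bdual_is_dual : is_dual (M : C) (bdual M).
Proof.
have avg (V : lmodType k) (v : V) : (#|H|%:R^-1 : k) *: (\sum_(h : subg_of H) v) = v.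
  by rewrite sumr_const card_subg_of -scaler_nat scalerA mulVf // scale1r.
have tri1 : bcomp (brun M) (bcomp (btensm (bid M) bev) (bcomp (bassoc M (bdual M) M)
    (bcomp (btensm bcoev (bid M)) (bluni M)))) = bid M.
  apply: bhom_eq => m; rewrite !bE bcoev1.
  rewrite (linear_Z (pt_linl m)) !(linear_Z (bhom_linear _)).
  rewrite (linear_S _ _ _ (pt_linl m)) !(linear_S _ _ _ (bhom_linear _)).
  rewrite -[RHS]avg; congr (_ *: _).
  transitivity (\sum_(i < \dim {:M}) \sum_(h : subg_of H)
     coord (vbasis {:M}) i (ra m h^-1%g) *: ra ((vbasis {:M})`_i : M) h).
    apply: eq_bigr => i _; rewrite !bE bevE ractE.
    by apply: eq_bigr => h _; rewrite ffunE dual_formE // => c x y; rewrite linearP.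
  rewrite exchange_big; apply: eq_bigr => h _ /=.
  rewrite -[RHS](raVK h) [in RHS](coord_vbasis (memvf (ra m h^-1%g))).
  rewrite (linear_S _ _ _ (ra_lin h)).
  by apply: eq_bigr => i _; rewrite (linear_Z (ra_lin h)).
have tri2 : bcomp (blun (bdual M)) (bcomp (btensm bev (bid (bdual M)))
    (bcomp (bassoci (bdual M) M (bdual M)) (bcomp (btensm (bid (bdual M)) bcoev)
      (bruni (bdual M))))) = bid (bdual M).
  apply: bhom_eq => m; rewrite !bE bcoev1.
  rewrite (linear_Z (pt_linr m)) !(linear_Z (bhom_linear _)).
  rewrite (linear_S _ _ _ (pt_linr m)) !(linear_S _ _ _ (bhom_linear _)).
  rewrite -[RHS]avg; congr (_ *: _).
  transitivity (\sum_(i < \dim {:M}) \sum_(h : subg_of H)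
     form_of m (ra ((vbasis {:M})`_i : M) h^-1%g) *:
        la h (dual_form (coord (vbasis {:M}) i))).
    apply: eq_bigr => i _; rewrite !bE bevE lactE.
    by apply: eq_bigr => h _; rewrite ffunE.
  rewrite exchange_big; apply: eq_bigr => h _ /=.
  apply/lfunP => v; rewrite sum_lfunE -[RHS]/(form_of m v) -[v in RHS](raK h).
  rewrite [in RHS](coord_vbasis (memvf (ra v h))) (linear_S _ _ _ (ra_lin _)) linear_sum.
  apply: eq_bigr => i _; rewrite scale_lfunE -[X in _ *: X]/(form_of _ v) bdual_lactE.
  rewrite dual_formE; last by move=> c x y; rewrite linearP.
  by rewrite (linear_Z (ra_lin _)) linearZ; apply: mulrC.
by exists bev, bcoev.
Qed.

End Pairing.

(** The product is a direct sum of simple subobjects, each one a generator of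
    the adjoint subcategory. *)
Lemma tens_bdual_adjoint (S : C) : simple_obj S -> adjoint_subcat (tens S (bdual S) : C).
Proof.
move=> simS D fD genD.
have [_ [_ [_ [Dsum _]]]] := fD.
suff Q (T : C) : subobject T (tens S (bdual S) : C) -> D T.
  by apply: Q; exists (cid _); apply: (@retract_mono _ _ _ _ _ (cid _)); rewrite ccomp1m.
move: T; apply: (bimod_semisimple_ind cardH) => [I Y X DY dX [f mono_f]|T simT sT].
  apply: (Dsum I Y X _ dX) => i; apply: DY.
  have [inj [prj [pi1 _ _]]] := dX; exists (ccomp f (inj i)) => W g h.
  by rewrite -!ccompA => /mono_f/(retract_mono (pi1 i)).
exact: genD simS (bdual_is_dual S) simT sT.
Qed.

End GroupAlgebraDuals.

(** * Free bimodules *)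

Section FreeBimodules.
Local Open Scope ring_scope.
Variables (k : fieldType) (G : finGroupType) (H : {group G}).
Local Notation A := (group_algebra k H).
Local Notation C := (group_theoretical k H).
Implicit Types M N W : bimod A.

Lemma nonzero_form (V : vectType k) (v : V) :
  v != 0 -> exists f : 'Hom(V, k^o), f v != 0.
Proof.
move=> nzv; apply: contrapT => /forallNP H0; case/eqP: nzv.
rewrite (coord_vbasis (memvf v)) big1 // => i _.
have /negP := H0 (linfun (coord (vbasis {:V}) i : V -> k^o)).
rewrite negbK linfunE => [/eqP->|c x y]; first by rewrite scale0r.
by rewrite linearP.
Qed.

Lemma balanced_basis M N (V : lmodType k) (b : M -> N -> V) :
    (forall n, linear (b^~ n)) -> (forall m, linear (b m)) ->
  (forall m h n, b (ra m h) n = b m (la h n)) -> balanced b.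
Proof.
move=> bl br bal; split=> // m a n.
rewrite ractE lactE (linear_S _ _ _ (bl n)) (linear_S _ _ _ (br m)).
by apply: eq_bigr => h _; rewrite (linear_Z (bl n)) (linear_Z (br m)) bal.
Qed.

(** A pure tensor of nonzero homogeneous elements is nonzero, because a
    bimodule is free over [k[H]]: the pairing below has only one nonzero
    term on such a tensor. *)
Lemma bimod_tens_nonzero (M N : C) :
  ~ is_zero M -> ~ is_zero N -> ~ is_zero (tens M N).
Proof.
move=> nzM nzN /bimod_zeroP T0.
have nz (X : C) : ~ is_zero X -> exists x : (X : bimod A), x != 0.
  move=> nzX; apply: contrapT => /forallNP X0; apply: nzX; apply/bimod_zeroP => x.
  by apply/eqP/negPn/negP; apply: X0.
have [_ /homogeneous_neq0[g [m mg nzm]]] := nz M nzM.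
have [n nzn] := nz N nzN.
have [f fm] := nonzero_form nzm.
pose b (m' : (M : bimod A)) (n' : (N : bimod A)) : (N : bimod A) :=
  \sum_(h : subg_of H) (f (grpi (bgr (M : bimod A)) g (ra m' h)) : k) *: la h^-1%g n'.
have bal_b : balanced b.
  apply: balanced_basis => [n' c x y|m' c x y|m' h0 n'].
  - rewrite /b scaler_sumr -big_split; apply: eq_bigr => h _ /=.
    by rewrite ra_lin grpi_linear linearP scalerDl scalerA.
  - rewrite /b scaler_sumr -big_split; apply: eq_bigr => h _ /=.
    by rewrite la_lin scalerDr !scalerA mulrC.
  rewrite /b [RHS](reindex_inj (mulgI h0)) /=; apply: eq_bigr => h _.
  by rewrite raM -laM invMg mulgKV.
have := bliftE m n bal_b; rewrite (T0 (pt m n)) (linear_0 (blift_linear _)).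
rewrite /b (bigD1 1%g) //= ra1 grpi_id // invg1 la1 big1 ?addr0 => [/esym/eqP|h ne].
  by rewrite scaler_eq0 (negPf fm) (negPf nzn).
rewrite (grpi_delta (bgrP (M : bimod A)) _ (ra_gr h mg)).
case: eqP => [E|_]; last by rewrite linear0 scale0r.
by case/eqP: ne; apply: val_inj; apply: (mulgI g); rewrite -E /= mulg1.
Qed.

Section BimoduleOfGroupActions.
Variables (V : vectType k) (gr : G -> {vspace V}) (L R : subg_of H -> V -> V).
Hypotheses (grP : is_grading gr) (L_lin : forall h, linear (L h))
  (R_lin : forall h, linear (R h)) (L1 : forall v, L 1%g v = v)
  (R1 : forall v, R 1%g v = v) (LM : forall h h' v, L (h * h')%g v = L h (L h' v))
  (RM : forall h h' v, R (h * h')%g v = R h' (R h v))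
  (RL : forall h h' v, R h (L h' v) = L h' (R h v))
  (L_gr : forall h g v, v \in gr g -> L h v \in gr (sgval h * g)%g)
  (R_gr : forall h g v, v \in gr g -> R h v \in gr (g * sgval h)%g).

Let ext (F : subg_of H -> V -> V) (a : grpalg k H) v := \sum_h (a h : k) *: F h v.

Let ext_linl F v : linear (fun a => ext F a v).
Proof.
move=> c a b; rewrite /ext scaler_sumr -big_split; apply: eq_bigr => h _ /=.
by rewrite !ffunE scalerDl scalerA.
Qed.

Let ext_linr F a : (forall h, linear (F h)) -> linear (ext F a).
Proof.
move=> F_lin c v w; rewrite /ext scaler_sumr -big_split; apply: eq_bigr => h _ /=.
by rewrite F_lin scalerDr !scalerA mulrC.
Qed.

Let ext_basis F h v : ext F (ga_basis k h) v = F h v.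
Proof.
rewrite /ext (bigD1 h) //= ffunE eqxx scale1r big1 ?addr0 // => h' ne.
by rewrite ffunE (negPf ne) scale0r.
Qed.

Let ga_lin_ext (W : lmodType k) (f f' : grpalg k H -> W) : linear f -> linear f' ->
  (forall h, f (ga_basis k h) = f' (ga_basis k h)) -> f =1 f'.
Proof.
move=> lf lf' E a; rewrite (ga_sum a) (linear_S _ _ _ lf) (linear_S _ _ _ lf').
by apply: eq_bigr => h _; rewrite (linear_Z lf) (linear_Z lf') E.
Qed.

Let mul_linl (b : grpalg k H) : linear (fun a => a * b).
Proof. by move=> c x y; rewrite mulrDl scalerAl. Qed.
Let mul_linr (a : grpalg k H) : linear (fun b => a * b).
Proof. by move=> c x y; rewrite mulrDr scalerAr. Qed.

Let ext_gr F (op : G -> G -> G) g h a v :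
    (forall x g v, v \in gr g -> F x v \in gr (op g (sgval x))) ->
  v \in gr g -> a \in ga_gr k H h -> ext F a v \in gr (op g h).
Proof.
move=> F_gr vg /ga_grE a0; rewrite memv_suml // => x _.
have [<-|ne] := eqVneq (sgval x) h; first by rewrite memvZ ?F_gr.
by rewrite a0 // scale0r mem0v.
Qed.

Definition group_bimod : bimod A.
Proof.
apply: (@Bimod k G A V gr (fun a => ext L (a : grpalg k H))
  (fun v a => ext R (a : grpalg k H) v)) => //.
- by move=> a; apply: ext_linr.
- by move=> a; apply: ext_linr.
- by move=> v; rewrite [LHS]ext_basis.
- move=> a b v; move: a; apply: ga_lin_ext => [||h].
  + exact: linear_comp (ext_linl L v) (mul_linl b).
  + exact: ext_linl.
  rewrite !ext_basis; move: b; apply: ga_lin_ext => [||h'].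
  + exact: linear_comp (ext_linl L v) (mul_linr _).
  + exact: linear_comp (L_lin h) (ext_linl L v).
  by rewrite ga_basisM !ext_basis.
- by move=> v; rewrite [LHS]ext_basis.
- move=> v a b; move: a; apply: ga_lin_ext => [||h].
  + exact: linear_comp (ext_linl R v) (mul_linl b).
  + exact: linear_comp (ext_linr _ R_lin) (ext_linl R v).
  rewrite !ext_basis; move: b; apply: ga_lin_ext => [||h'].
  + exact: linear_comp (ext_linl R v) (mul_linr _).
  + exact: ext_linl.
  by rewrite ga_basisM !ext_basis.
- move=> a v b; move: a; apply: ga_lin_ext => [||h].
  + exact: linear_comp (ext_linr _ R_lin) (ext_linl L v).
  + exact: ext_linl.
  rewrite !ext_basis; move: b; apply: ga_lin_ext => [||h'].
  + exact: ext_linl.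
  + exact: linear_comp (L_lin h) (ext_linl R v).
  by rewrite !ext_basis.
- move=> g h a v ag vh.
  by apply: (@ext_gr L (fun g h => h * g)%g) vh ag => x j w; apply: L_gr.
- move=> g h v a vg ah.
  by apply: (@ext_gr R (fun g h => g * h)%g) vg ah => x j w; apply: R_gr.
Defined.

Lemma group_bimod_la h (v : group_bimod) : la h v = L h v.
Proof. exact: ext_basis. Qed.
Lemma group_bimod_ra h (v : group_bimod) : ra v h = R h v.
Proof. exact: ext_basis. Qed.

End BimoduleOfGroupActions.

Section Free.
Variable g : G.
Local Notation X := (subg_of H * subg_of H)%type.
Let V : vectType k := {ffun X -> k^o}.
Let L h (u : V) : V := [ffun x => u (h^-1 * x.1, x.2)%g].
Let R h (u : V) : V := [ffun x => u (x.1, x.2 * h^-1)%g].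
Let deg (x : X) := (sgval x.1 * g * sgval x.2)%g.
Let p d (u : V) : V := [ffun x => if deg x == d then u x else 0].

Let p_lin d : linear (p d).
Proof.
by move=> c u v; apply/ffunP => x; rewrite !ffunE; case: eqP; rewrite ?scaler0 ?addr0.
Qed.

Let pE d (u : V) : u \in proj_gr p d <-> forall x, deg x != d -> u x = 0.
Proof.
split=> [/(mem_proj_gr p_lin) <- x /negPf ne|u0]; first by rewrite ffunE ne.
apply/(mem_proj_gr p_lin)/ffunP => x; rewrite ffunE.
by case: eqP => // /eqP/u0.
Qed.

(** The bimodule [k[H] (x) k_g (x) k[H]], free on one generator of degree [g]. *)
Definition free_bimod : bimod A.
Proof.
apply: (@group_bimod V (proj_gr p) L R).
- apply: proj_gr_grading => [//|d d' u|u]; apply/ffunP => x.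
    rewrite !ffunE; case: (eqVneq d d') => [->|ne]; first by rewrite ffunE; case: eqP.
    by rewrite !ffunE; case: eqP => // ->; rewrite (negPf ne).
  rewrite sum_ffunE (bigD1 (deg x)) //= ffunE eqxx big1 ?addr0 // => d ne.
  by rewrite ffunE eq_sym (negPf ne).
- by move=> h c u v; apply/ffunP => x; rewrite !ffunE.
- by move=> h c u v; apply/ffunP => x; rewrite !ffunE.
- by move=> u; apply/ffunP => -[x y]; rewrite !ffunE /= invg1 mul1g.
- by move=> u; apply/ffunP => -[x y]; rewrite !ffunE /= invg1 mulg1.
- by move=> h h' u; apply/ffunP => x; rewrite !ffunE /= invMg mulgA.
- by move=> h h' u; apply/ffunP => x; rewrite !ffunE /= invMg mulgA.
- by move=> h h' u; apply/ffunP => x; rewrite !ffunE.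
- move=> h d u /pE u0; apply/pE => x ne; rewrite ffunE u0 //.
  apply: contra ne => /eqP <-; rewrite /deg.
  have -> : sgval (h^-1 * x.1)%g = ((sgval h)^-1 * sgval x.1)%g by [].
  by rewrite !mulgA mulgV mul1g.
- move=> h d u /pE u0; apply/pE => x ne; rewrite ffunE u0 //.
  apply: contra ne => /eqP <-; rewrite /deg.
  have -> : sgval (x.2 * h^-1)%g = (sgval x.2 * (sgval h)^-1)%g by [].
  by rewrite !mulgA mulgKV.
Defined.

Definition free_coef (u : free_bimod) : {ffun X -> k^o} := u.
Definition free_gen : free_bimod := [ffun x : X => (x == (1%g, 1%g))%:R] : {ffun X -> k^o}.

Lemma free_coef_la h u x : free_coef (la h u) x = free_coef u (h^-1 * x.1, x.2)%g.
Proof. by rewrite /free_coef group_bimod_la ffunE. Qed.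
Lemma free_coef_ra h u x : free_coef (ra u h) x = free_coef u (x.1, x.2 * h^-1)%g.
Proof. by rewrite /free_coef group_bimod_ra ffunE. Qed.

Lemma free_gen_gr : free_gen \in bgr free_bimod g.
Proof.
apply/pE => x ne; rewrite ffunE; case: eqP => // E; case/eqP: ne.
by rewrite E /deg mul1g mulg1.
Qed.

Lemma free_coef_gr d (u : free_bimod) (x : X) : u \in bgr free_bimod d ->
  (sgval x.1 * g * sgval x.2)%g != d -> free_coef u x = 0.
Proof. by move=> /pE; apply. Qed.

Lemma free_coef_linear x : linear (fun u : free_bimod => (free_coef u x : k^o)).
Proof. by move=> c u v; rewrite /free_coef !ffunE. Qed.

Lemma free_gen_trans x y :
  free_coef (la x.1 (ra free_gen x.2)) y = (y == x)%:R.
Proof.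
case: x y => [a b] [c d]; rewrite free_coef_la free_coef_ra ffunE /= !xpair_eqE.
by rewrite -eq_mulVg1 -eq_mulgV1 [a == c]eq_sym.
Qed.

Lemma free_sum (u : free_bimod) :
  u = \sum_(x : X) (free_coef u x : k) *: la x.1 (ra free_gen x.2).
Proof.
apply/ffunP => y; rewrite sum_ffunE (bigD1 y) //= ffunE.
rewrite -[X in _ *: X]/(free_coef _ y) free_gen_trans eqxx big1 ?addr0 => [|x ne].
  by rewrite /GRing.scale /= mulr1.
by rewrite ffunE -[X in _ *: X]/(free_coef _ y) free_gen_trans eq_sym (negPf ne) scaler0.
Qed.

Lemma free_bhomE M (f : bimod_hom free_bimod M) u :
  f u = \sum_(x : X) (free_coef u x : k) *: la x.1 (ra (f free_gen) x.2).
Proof.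
rewrite [in LHS](free_sum u) (linear_S _ _ _ (bhom_linear f)).
by apply: eq_bigr => x _; rewrite (linear_Z (bhom_linear f)) bhom_la bhom_ra.
Qed.

Lemma free_hom M (m : M) : m \in bgr M g ->
  exists f : bimod_hom free_bimod M, f free_gen = m.
Proof.
move=> mg; pose F (u : free_bimod) : M :=
  \sum_(x : X) (free_coef u x : k) *: la x.1 (ra m x.2).
have F_lin : linear F.
  move=> c u v; rewrite /F scaler_sumr -big_split; apply: eq_bigr => x _ /=.
  by rewrite /free_coef !ffunE scalerDl scalerA.
have F_la h u : F (la h u) = la h (F u).
  rewrite /F (linear_S _ _ _ (la_lin h)).
  rewrite (reindex_inj (h := fun x : X => (h * x.1, x.2)%g)) /=.
    apply: eq_bigr => x _; rewrite (linear_Z (la_lin h)) free_coef_la /= mulKg.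
    by rewrite laM -surjective_pairing.
  move=> [a b] [c d] E; have /= /mulgI-> := congr1 fst E.
  by have /= -> := congr1 snd E.
have F_ra u h : F (ra u h) = ra (F u) h.
  rewrite /F (linear_S _ _ _ (ra_lin h)).
  rewrite (reindex_inj (h := fun x : X => (x.1, x.2 * h)%g)) /=.
    apply: eq_bigr => x _; rewrite (linear_Z (ra_lin h)) free_coef_ra /= mulgK.
    by rewrite raM lara -surjective_pairing.
  move=> [a b] [c d] E; have /= -> := congr1 fst E.
  by have /= /mulIg-> := congr1 snd E.
have F_gr d u : u \in bgr free_bimod d -> F u \in bgr M d.
  move=> /pE u0; rewrite memv_suml // => x _.
  have [<-|ne] := eqVneq (deg x) d; last by rewrite /free_coef u0 // scale0r mem0v.
  by rewrite memvZ // /deg -mulgA; apply/la_gr/ra_gr.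
exists (basis_hom F_lin F_la F_ra F_gr); rewrite basis_homE /F.
rewrite (bigD1 (1%g, 1%g)) //= ra1 la1 ffunE eqxx scale1r big1 ?addr0 // => x ne.
by rewrite ffunE (negPf ne) scale0r.
Qed.

(** The tensor product [W (x) free_bimod] is the direct sum of copies of [W],
    one for each element [h2] of [H]; this is the projection to the copy of
    [h2]. *)
Definition free_tens_coef W (h2 : subg_of H) : btens W free_bimod -> W :=
  blift (fun (v : W) (u : free_bimod) =>
    \sum_(h1 : subg_of H) (free_coef u (h1, h2) : k) *: ra v h1).

Lemma free_tens_coef_linear W h2 : linear (@free_tens_coef W h2).
Proof. exact: blift_linear. Qed.

Lemma free_tens_coefE W h2 (v : W) (u : free_bimod) :
  free_tens_coef h2 (pt v u) =
  \sum_(h1 : subg_of H) (free_coef u (h1, h2) : k) *: ra v h1.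
Proof.
apply: bliftE; apply: balanced_basis => [u' c x y|v' c x y|v' h u'].
- rewrite scaler_sumr -big_split; apply: eq_bigr => h _ /=.
  by rewrite ra_lin scalerDr !scalerA mulrC.
- rewrite scaler_sumr -big_split; apply: eq_bigr => h _ /=.
  by rewrite /free_coef !ffunE scalerDl scalerA.
rewrite [RHS](reindex_inj (mulgI h)) /=; apply: eq_bigr => h1 _.
by rewrite free_coef_la /= mulKg raM.
Qed.

End Free.
End FreeBimodules.

(** * The centralizer of the adjoint subcategory *)

Section CentralSupport.
Local Open Scope ring_scope.
Variables (k : fieldType) (G : finGroupType) (H : {group G}).
Local Notation A := (group_algebra k H).
Local Notation C := (group_theoretical k H).
Implicit Types M N V : bimod A.
Hypothesis cardH : #|H|%:R != 0 :> k.

Definition conj_act M (h : subg_of H) (m : M) : M := la h (ra m h^-1%g).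

Lemma conj_act_lin M h : linear (@conj_act M h).
Proof. exact: linear_comp (la_lin h) (ra_lin _). Qed.

Lemma conj_act_gr M h (m : M) :
  m \in bgr M 1%g -> conj_act h m \in bgr M 1%g.
Proof.
move=> m1; have := la_gr h (ra_gr h^-1%g m1).
by rewrite mul1g -[sgval h^-1%g]/((sgval h)^-1)%g mulgV.
Qed.

Lemma conj_act_hom M N (f : bimod_hom M N) h m :
  f (conj_act h m) = conj_act h (f m).
Proof. by rewrite bhom_la bhom_ra. Qed.

(** The map [1 (x) ev] evaluated at [- (x) s]. *)
Lemma dual_pure_balanced M (s : M) :
  balanced (fun (m : M) (f : bdual M) =>
    \sum_(h : subg_of H) (form_of f (ra s h^-1%g) : k) *: ra m h).
Proof.
apply: balanced_basis => [f c x y|m c x y|m h0 f].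
- rewrite scaler_sumr -big_split; apply: eq_bigr => h _ /=.
  by rewrite ra_lin scalerDr !scalerA mulrC.
- rewrite scaler_sumr -big_split; apply: eq_bigr => h _ /=.
  by rewrite /form_of add_lfunE scale_lfunE scalerDl scalerA.
rewrite [RHS](reindex_inj (mulgI h0)) /=; apply: eq_bigr => h _.
by rewrite /la bdual_lactE -/(ra _ h0) -!raM invMg mulgKV.
Qed.

(** Contracting both sides of [h (m (x) f) = (m (x) f) h] with [s] leaves, for
    degree reasons, a single term on each side. *)
Lemma conj_act_scalar M h :
    (forall v : btens M (bdual M), v \in bgr _ 1%g -> la h v = ra v h) ->
  forall (s m : M) (f : bdual M), s \in bgr M 1%g -> m \in bgr M 1%g ->
    f \in bgr (bdual M) 1%g ->
  (form_of f s : k) *: conj_act h m = (form_of f (conj_act h s) : k) *: m.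
Proof.
move=> central s m f s1 m1 f1.
have := central (pt m f); rewrite -[1%g]mulg1 pt_gr // => /(_ isT).
rewrite /la pt_lact -/(la h m) /ra pt_ract -/(ra f h).
move=> /(congr1 (blift (fun (m : M) (f : bdual M) =>
  \sum_(h : subg_of H) (form_of f (ra s h^-1%g) : k) *: ra m h))).
rewrite !(bliftE _ _ (dual_pure_balanced s)) => E.
have f0 j x : x \in bgr M j -> j != 1%g -> form_of f x = 0.
  by move=> xj ne; have /bdual_grP f10 := f1; apply: f10 xj _; rewrite invg1.
rewrite (bigD1 1%g) //= big1 ?addr0 in E; last first.
  move=> h' ne; rewrite (f0 _ _ (ra_gr h'^-1%g s1)) ?scale0r //.
  by rewrite mul1g -[sgval h'^-1%g]/((sgval h')^-1)%g invg_eq1.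
rewrite (bigD1 h) //= big1 ?addr0 in E; last first.
  move=> h' ne; rewrite bdual_ractE -/(la h _).
  rewrite (f0 _ _ (la_gr h (ra_gr h'^-1%g s1))) ?scale0r //.
  rewrite mul1g -[sgval h'^-1%g]/((sgval h')^-1)%g -eq_mulgV1 eq_sym.
  by apply: contra ne => /eqP/val_inj->.
rewrite invg1 !ra1 bdual_ractE -/(la h _) in E.
have := congr1 (fun x : M => ra x h^-1%g) E.
rewrite !(linear_Z (ra_lin _)) raK => <-.
by rewrite lara.
Qed.

(** By the previous lemma, [h] acts by a scalar on the degree one part of every
    simple bimodule, under conjugation. There it commutes with the conjugation
    by any [w]; this property passes to direct sums, hence to the free bimodule
    on a generator of degree one, on which conjugation is a faithful action. *)
Lemma adjoint_centralizer (h : subg_of H) :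
    (forall V : C, adjoint_subcat V ->
       forall v : (V : bimod A), v \in bgr (V : bimod A) 1%g -> la h v = ra v h) ->
  forall w : subg_of H, (h * w = w * h)%g.
Proof.
move=> central.
pose Q (M : C) := forall w (m : (M : bimod A)), m \in bgr (M : bimod A) 1%g ->
  conj_act h (conj_act w m) = conj_act w (conj_act h m).
have QM : forall M, Q M.
  apply: (bimod_semisimple_ind cardH) => [I Y X QY [inj [prj [_ _ sum1]]] w m m1|S simS w m m1].
    rewrite -[m]bidE -[bid _]/(cid X) -sum1 bhom_sumE.
    rewrite !(linear_S _ _ _ (conj_act_lin _)); apply: eq_bigr => i _.
    by rewrite bimod_compE -!(conj_act_hom (inj i : bimod_hom _ _)) QY // bhom_gr.
  have [->|nzm] := eqVneq m 0; first by rewrite !(linear_0 (conj_act_lin _)).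
  have [f0 f0m] := nonzero_form nzm.
  pose f : bdual (S : bimod A) := dual_form (fun x => f0 (grpi (bgr (S : bimod A)) 1%g x)).
  have fE x : form_of f x = f0 (grpi (bgr (S : bimod A)) 1%g x).
    by apply: dual_formE => c y z; rewrite grpi_linear linearP.
  have f1 : f \in bgr (bdual (S : bimod A)) 1%g.
    apply/bdual_grP => j x xj; rewrite invg1 eq_sym fE => /negPf ne.
    by rewrite (grpi_delta (bgrP (S : bimod A)) _ xj) ne linear0.
  have fm : form_of f m != 0 by rewrite fE grpi_id.
  have sc x : x \in bgr (S : bimod A) 1%g -> (form_of f m : k) *: conj_act h x =
      (form_of f (conj_act h m) : k) *: x.
    move=> x1; apply: conj_act_scalar => // v v1.
    exact: (central _ (tens_bdual_adjoint cardH simS)).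
  apply: (scalerI fm); rewrite sc ?conj_act_gr //.
  by rewrite -!(linear_Z (conj_act_lin w)) sc.
move=> w; have := QM (free_bimod k H 1%g) w _ (free_gen_gr k H 1%g).
rewrite /conj_act -!lara -!raM -!laM => /(congr1 (@free_coef k G H 1%g)).
move=> /ffunP/(_ (h * w, w^-1 * h^-1)%g).
have E a b x : free_coef (ra (la a (free_gen k H 1%g)) b) x = (x == (a, b))%:R.
  by rewrite lara; exact: (@free_gen_trans k G H 1%g (a, b) x).
rewrite !E eqxx; case: eqP => [E1 _|_ /eqP]; first by have /= -> := congr1 fst E1.
by rewrite oner_eq0.
Qed.

(** For [v] of degree one in [V], apply [F q = (1 (x) q) F] to the homomorphism
    [F] that sends the generator to [v (x) 1]: the coefficients at [(h1, h2)]
    give [h1 v = v h1] whenever the coefficient of [q] there is nonzero. *)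
Lemma free_end_central g (q : bimod_hom (free_bimod k H g) (free_bimod k H g)) :
    (forall (V : bimod A) (F : bimod_hom (free_bimod k H g) (btens V (free_bimod k H g))),
       adjoint_subcat (V : C) -> bcomp F q = bcomp (btensm (bid V) q) F) ->
  forall x, free_coef (q (free_gen k H g)) x != 0 ->
  forall w, (x.1 * w = w * x.1)%g.
Proof.
move=> qF [h1 h2] /= nzu; apply: adjoint_centralizer => V adV v v1.
set u := q _ in nzu.
have [|F Fg] := @free_hom k G H g (btens V (free_bimod k H g)) (pt v (free_gen k H g)).
  by have := pt_gr v1 (free_gen_gr k H g); rewrite mul1g.
have := congr1 (fun f : bimod_hom _ _ => free_tens_coef h2 (f (free_gen k H g))) (qF V F adV).
rewrite !bcompE Fg -/u btensmE bidE -/u free_tens_coefE free_bhomE Fg.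
have flin := @free_tens_coef_linear k G H g V h2.
have coefE (x : subg_of H * subg_of H) :
    free_tens_coef h2 (la x.1 (ra (pt v (free_gen k H g)) x.2)) =
    if x.2 == h2 then la x.1 v else 0.
  rewrite /ra pt_ract -/(ra _ x.2) /la pt_lact -/(la x.1 v) free_tens_coefE.
  have E h : free_coef (ra (free_gen k H g) x.2) (h, h2) = ((h, h2) == (1%g, x.2))%:R.
    by rewrite -[ra _ _]la1; exact: (@free_gen_trans k G H g (1%g, x.2)).
  rewrite (bigD1 1%g) //= E big1 ?addr0 => [|h ne].
    by rewrite xpair_eqE eqxx eq_sym ra1; case: eqP; rewrite ?scale1r ?scale0r.
  by rewrite E xpair_eqE (negPf ne) scale0r.
rewrite (linear_S _ _ _ flin).
rewrite (eq_bigr (fun x : subg_of H * subg_of H =>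
  if x.2 == h2 then (free_coef u (x.1, h2) : k) *: la x.1 v else 0)); last first.
  move=> [a b] _; rewrite (linear_Z flin) coefE /=.
  by case: eqP => [->|_] //; rewrite scaler0.
rewrite -(pair_bigA _ (fun a b => if b == h2 then (free_coef u (a, h2) : k) *: la a v else 0)) /=.
rewrite (eq_bigr (fun a => (free_coef u (a, h2) : k) *: la a v)); last first.
  by move=> a _; rewrite -big_mkcond big_pred1_eq.
(* the terms indexed by [h] have degree [h], which isolates the one at [h1] *)
move=> /(congr1 (grpi (bgr V) (sgval h1))).
rewrite !(linear_S _ _ _ (grpi_linear _ _)).
have one (T : subg_of H -> V) : (forall h, T h \in bgr V (sgval h)) ->
    \sum_h grpi (bgr V) (sgval h1) ((free_coef u (h, h2) : k) *: T h) =
    (free_coef u (h1, h2) : k) *: T h1.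
  move=> T_gr; rewrite (bigD1 h1) //= big1 ?addr0 => [|h ne].
    by rewrite (linear_Z (grpi_linear _ _)) grpi_id.
  rewrite (linear_Z (grpi_linear _ _)) (grpi_delta (bgrP V) _ (T_gr h)).
  by rewrite (inj_eq val_inj) eq_sym (negPf ne) scaler0.
rewrite !one; first exact: scalerI.
  by move=> h; have := ra_gr h v1; rewrite mul1g.
by move=> h; have := la_gr h v1; rewrite mulg1.
Qed.

End CentralSupport.

(** * Perfect pairings on finite abelian groups *)

Section PerfectPairings.
Local Open Scope ring_scope.
Variables (k : closedFieldType) (gT : finGroupType).
Hypothesis char_k : [pchar k] =i pred0.

Lemma natf_neq0_char0 n : (0 < n)%N -> n%:R != 0 :> k.
Proof. by move=> n_gt0; rewrite (proj1 (pcharf0P k) char_k) -lt0n. Qed.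

Lemma closed_primitive_root n : (0 < n)%N -> exists z : k, n.-primitive_root z.
Proof.
move=> n_gt0; have [rs def_p] := closed_field_poly_normal ('X^n - 1 : {poly k}).
have lead1 : lead_coef ('X^n - 1 : {poly k}) = 1.
  by apply/eqP; rewrite -[_ == _]/(_ \is monic) monicXnsubC.
rewrite lead1 scale1r in def_p.
have uniq_rs : uniq rs.
  rewrite -separable_prod_XsubC -def_p separable_Xn_sub_1 //.
  exact: natf_neq0_char0.
have unity_rs : all n.-unity_root rs.
  by apply/allP => z zrs; rewrite /root_of_unity def_p root_prod_XsubC.
have size_rs : (n <= size rs)%N.
  by rewrite -ltnS -(size_prod_XsubC rs id) -def_p size_XnsubC.
by have /hasP[z _ zP] := has_prim_root n_gt0 unity_rs uniq_rs size_rs; exists z.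
Qed.

(** A nondegenerate symmetric bicharacter of [Z]. It identifies [Z] with its
    group of characters, although not canonically. *)
Definition perfect_pairing (Z : {set gT}) (b : gT -> gT -> k) : Prop :=
  [/\ {in Z &, forall x y, b x y = b y x},
      {in Z & &, forall x y z, b x (y * z)%g = b x y * b x z},
      {in Z, forall x, b x 1%g = 1}
    & {in Z, forall z, {in Z, forall x, b x z = 1} -> z = 1%g}].

(** Send [(x^i, x^j)] to [z^(i j)], for [z] a primitive root of unity of order
    [#[x]]. *)
Lemma cycle_perfect_pairing (x : gT) : exists b, perfect_pairing <[x]>%g b.
Proof.
have [z prim_z] := closed_primitive_root (order_gt0 x).
have /choice[d dP] : forall y, exists m, y \in <[x]>%g -> y = (x ^+ m)%g.
  move=> y; have [/cycleP[m ->]|_] := boolP (y \in <[x]>%g); first by exists m.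
  by exists 0%N.
have zE i j : (z ^+ i == z ^+ j) = (x ^+ i == x ^+ j)%g.
  by rewrite (eq_prim_root_expr prim_z) eq_expg_mod_order.
have dM y t : y \in <[x]>%g -> t \in <[x]>%g -> z ^+ d (y * t)%g = z ^+ d y * z ^+ d t.
  move=> yx tx; rewrite -exprD; apply/eqP.
  by rewrite zE expgD -!dP ?groupM.
exists (fun y t => z ^+ (d y * d t)); split.
- by move=> y t _ _; rewrite mulnC.
- by move=> y t u _ tx ux; rewrite ![(d y * _)%N]mulnC !exprM dM // exprMn.
- move=> y _; rewrite mulnC exprM; have -> : z ^+ d 1%g = 1; last exact: expr1n.
  by apply/eqP; rewrite -(expr0 z) zE -dP ?group1.
move=> t tx /(_ x (cycle_id x)) E; rewrite (dP t tx); apply/eqP.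
rewrite -[1%g](expg0 x) -zE expr0 -{}E exprM; apply/eqP; congr (_ ^+ _).
by apply/eqP; rewrite -{1}[z]expr1 zE -dP ?cycle_id ?expg1.
Qed.

Lemma dprod_perfect_pairing (K L M : {group gT}) bK bL :
    (K \x L)%g = M -> perfect_pairing K bK -> perfect_pairing L bL ->
  exists b, perfect_pairing M b.
Proof.
move=> KLM [symK mulK oneK ndK] [symL mulL oneL ndL].
have /choice[c cP] : forall t, exists c : gT * gT, t \in M ->
    [/\ c.1 \in K, c.2 \in L, t = (c.1 * c.2)%g
      & {in K & L, forall a b, t = (a * b)%g -> c = (a, b)}].
  move=> t; have [tM|_] := boolP (t \in M); last by exists (1%g, 1%g).
  have [a [b [aK bL' tE uniq]]] := mem_dprod KLM tM.
  by exists (a, b) => _; split=> // a' b' a'K b'L /(uniq _ _ a'K b'L)[-> ->].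
have [_ KL cKL _] := dprodP KLM.
have KM : {subset K <= M} by apply/subsetP; case/dprodW: KLM => <-; apply: mulG_subl.
have LM : {subset L <= M} by apply/subsetP; case/dprodW: KLM => <-; apply: mulG_subr.
have cM t u : t \in M -> u \in M -> c (t * u)%g = ((c t).1 * (c u).1, (c t).2 * (c u).2)%g.
  move=> tM uM; have [t1 t2 tE _] := cP t tM; have [u1 u2 uE _] := cP u uM.
  have [_ _ _ uniq] := cP _ (groupM tM uM); apply: uniq; rewrite ?groupM //.
  have comm : commute (c t).2 (c u).1 by exact: (centP (subsetP cKL _ t2)).
  by rewrite [in LHS]tE [in LHS]uE -!mulgA (mulgA (c t).2) comm !mulgA.
have cK t : t \in K -> c t = (t, 1%g).
  by move=> tK; have [_ _ _ uniq] := cP t (KM t tK); apply: uniq; rewrite ?mulg1.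
have cL t : t \in L -> c t = (1%g, t).
  by move=> tL; have [_ _ _ uniq] := cP t (LM t tL); apply: uniq; rewrite ?mul1g.
exists (fun t u => bK (c t).1 (c u).1 * bL (c t).2 (c u).2); split.
- move=> t u /cP[t1 t2 _ _] /cP[u1 u2 _ _]; rewrite symK // symL //.
- move=> t u v tM uM vM; have [t1 t2 _ _] := cP t tM; have [u1 u2 _ _] := cP u uM.
  have [v1 v2 _ _] := cP v vM.
  by rewrite cM //= mulK // mulL // mulrACA.
- by move=> t /cP[t1 t2 _ _]; rewrite (cK 1%g) ?group1 //= oneK // oneL // mulr1.
move=> t tM tnd; have [t1 t2 tE _] := cP t tM.
have c1 : (c t).1 = 1%g.
  apply: ndK => // u uK; have := tnd u (KM u uK).
  by rewrite (cK u uK) /= (symL _ _ (group1 L) t2) oneL // mulr1.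
have c2 : (c t).2 = 1%g.
  apply: ndL => // u uL; have := tnd u (LM u uL).
  by rewrite (cL u uL) /= (symK _ _ (group1 K) t1) oneK // mul1r.
by rewrite tE c1 c2 mulg1.
Qed.

Lemma abelian_perfect_pairing (Z : {group gT}) : abelian Z ->
  exists b, perfect_pairing Z b.
Proof.
move=> /abelian_structure[s defZ _]; elim: s Z defZ => [|x s IH] Z.
  rewrite big_nil => defZ; exists (fun _ _ => 1); split=> // [*|z].
    by rewrite mulr1.
  by rewrite -defZ => /set1P.
rewrite big_cons => defZ; have [[K L defK defL] _ _ _] := dprodP defZ.
have [bL pL] := IH L defL; have [bK pK] := cycle_perfect_pairing x.
rewrite defL in defZ.
exact: (@dprod_perfect_pairing <[x]>%G L Z bK bL).
Qed.

Section Characters.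
Variables (Z : {group gT}) (b : gT -> gT -> k).
Hypothesis bP : perfect_pairing Z b.

Lemma pairing_sym : {in Z &, forall x y, b x y = b y x}. Proof. by case: bP. Qed.
Lemma pairingMr : {in Z & &, forall x y z, b x (y * z)%g = b x y * b x z}.
Proof. by case: bP. Qed.
Lemma pairing1r : {in Z, forall x, b x 1%g = 1}. Proof. by case: bP. Qed.
Lemma pairingMl : {in Z & &, forall x y z, b (x * y)%g z = b x z * b y z}.
Proof.
move=> x y z xZ yZ zZ; rewrite pairing_sym ?groupM // pairingMr //.
by rewrite !(pairing_sym zZ).
Qed.
Lemma pairing1l : {in Z, forall x, b 1%g x = 1}.
Proof. by move=> x xZ; rewrite pairing_sym // pairing1r. Qed.

Lemma pairing_neq0 : {in Z &, forall x y, b x y != 0}.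
Proof.
move=> x y xZ yZ; apply/eqP => b0; have /eqP := pairing1r xZ.
by rewrite -(mulgV y) pairingMr ?groupV // b0 mul0r eq_sym oner_eq0.
Qed.

Lemma pairingVr : {in Z &, forall x y, b x y^-1%g = (b x y)^-1}.
Proof.
move=> x y xZ yZ; apply: (mulfI (pairing_neq0 xZ yZ)).
by rewrite -pairingMr ?groupV // mulgV pairing1r // divff // pairing_neq0.
Qed.

Lemma pairingVl : {in Z &, forall x y, b x^-1%g y = (b x y)^-1}.
Proof. by move=> x y xZ yZ; rewrite pairing_sym ?groupV // pairingVr // pairing_sym. Qed.

Lemma pairing_sum : {in Z, forall z,
  \sum_(x in Z) b x z = if z == 1%g then #|Z|%:R else 0}.
Proof.
move=> z zZ; case: eqP => [->|/eqP nz1].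
  by under eq_bigr => x xZ do rewrite pairing1r //; rewrite sumr_const.
have [x0 x0Z nb1] : exists2 x0, x0 \in Z & b x0 z != 1.
  apply: contrapT => /forall2NP H; case/eqP: nz1; have [_ _ _ nd] := bP.
  by apply: nd => // x xZ; have [//|/negP/negPn/eqP] := H x.
have E : \sum_(x in Z) b x z = b x0 z * \sum_(x in Z) b x z.
  rewrite mulr_sumr (reindex_inj (mulgI x0)) /=.
  by apply: eq_big => [x|x]; rewrite groupMl // => xZ; rewrite pairingMl.
apply/eqP; have /eqP := E; rewrite -subr_eq0 -{1}[X in X - _]mul1r -mulrBl mulf_eq0.
by rewrite subr_eq0 eq_sym (negPf nb1).
Qed.

Lemma pairing_inj : {in Z &, forall x y, {in Z, forall z, b x z = b y z} -> x = y}.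
Proof.
move=> x y xZ yZ E; have [_ _ _ nd] := bP; apply/eqP; rewrite eq_mulgV1; apply/eqP.
apply: nd => [|z zZ]; first by rewrite groupM ?groupV.
rewrite pairing_sym ?groupM ?groupV // pairingMl ?groupV // pairingVl // E //.
by rewrite divff // pairing_neq0.
Qed.

(** Every character of [Z] is represented by an element: otherwise it would
    be orthogonal to all the characters [b x], whose sum is [#|Z|] times the
    indicator of the identity. *)
Lemma pairing_surj (chi : gT -> k) : chi 1%g = 1 ->
    {in Z &, forall x y, chi (x * y)%g = chi x * chi y} ->
  exists2 t, t \in Z & {in Z, forall z, b t z = chi z}.
Proof.
move=> chi1 chiM; apply: contrapT => /forall2NP nt.
have chi_neq0 z : z \in Z -> chi z != 0.
  move=> zZ; apply/eqP => chi0; have /eqP := chi1.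
  by rewrite -(mulgV z) chiM ?groupV // chi0 mul0r eq_sym oner_eq0.
have orth t : t \in Z -> \sum_(z in Z) b t z^-1%g * chi z = 0.
  move=> tZ; have [z0 z0Z ne] : exists2 z0, z0 \in Z & b t z0^-1%g * chi z0 != 1.
    apply: contrapT => /forall2NP H; have [//|[]] := nt t => z zZ.
    have [//|/negP/negPn/eqP] := H z; rewrite pairingVr // => E.
    by apply: (mulfI (invr_neq0 (pairing_neq0 tZ zZ))); rewrite E mulVf // pairing_neq0.
  have E : \sum_(z in Z) b t z^-1%g * chi z =
      (b t z0^-1%g * chi z0) * \sum_(z in Z) b t z^-1%g * chi z.
    rewrite [LHS](reindex_inj (mulIg z0)) /= mulr_sumr.
    apply: eq_big => [z|z]; rewrite groupMr // => zZ.
    by rewrite invMg pairingMr ?groupV // chiM // [chi z * _]mulrC mulrACA.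
  apply/eqP; have /eqP := E; rewrite -subr_eq0 -{1}[X in X - _]mul1r -mulrBl mulf_eq0.
  by rewrite subr_eq0 eq_sym (negPf ne).
have : \sum_(t in Z) \sum_(z in Z) b t z^-1%g * chi z = #|Z|%:R.
  rewrite exchange_big (bigD1 1%g) //= chi1 invg1.
  under eq_bigr => t _ do rewrite mulr1.
  rewrite pairing_sum // eqxx big1 ?addr0 // => z /andP[zZ nz1].
  by rewrite -mulr_suml pairing_sum ?groupV // invg_eq1 (negPf nz1) mul0r.
rewrite big1 // => /esym/eqP; apply/negP; apply: natf_neq0_char0.
exact: cardG_gt0.
Qed.

End Characters.
End PerfectPairings.

(** * The action on the characters of the center *)

Section DualAction.
Local Open Scope ring_scope.
Variables (k : closedFieldType) (char_k : [pchar k] =i pred0).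
Variables (G : finGroupType) (H : {group G}).
Hypothesis nHG : (H <| [set: G])%g.
Local Notation Z := ('Z(H))%g.

Lemma center_conj g z : z \in Z -> (z ^ g)%g \in Z.
Proof.
have nZG : (Z <| [set: G])%g by apply: char_normal_trans nHG; apply: center_char.
by move=> zZ; rewrite memJ_norm //; apply: (subsetP (normal_norm nZG)); rewrite inE.
Qed.

Lemma center_conj_id h z : h \in H -> z \in Z -> (z ^ h)%g = z.
Proof. by move=> hH zZ; rewrite conjgE -(centerC hH zZ) mulKg. Qed.

Variable b : G -> G -> k.
Hypothesis bP : perfect_pairing Z b.

Lemma adjoint_conj_exists : exists tw : G -> G -> G, forall t g, t \in Z ->
  tw t g \in Z /\ {in Z, forall w, b (tw t g) w = b t (w ^ g^-1)%g}.
Proof.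
have H0 (p : G * G) : exists t', p.1 \in Z ->
    t' \in Z /\ {in Z, forall w, b t' w = b p.1 (w ^ p.2^-1)%g}.
  have [tZ|_] := boolP (p.1 \in Z); last by exists 1%g.
  have [||t' t'Z E] := pairing_surj char_k bP (chi := fun w => b p.1 (w ^ p.2^-1)%g).
  - by rewrite conj1g (pairing1r bP).
  - by move=> x y xZ yZ; rewrite conjMg (pairingMr bP) ?center_conj.
  by exists t'.
have [tw twP] := choice H0.
by exists (fun t g => tw (t, g)) => t g; apply: (twP (t, g)).
Qed.

(** The quotient [G/H] acts on the characters of ['Z(H)] by conjugation; the
    pairing transports this action to ['Z(H)] itself. *)
Lemma dual_action : exists to : groupAction ([set: G] / H)%g Z%G,
  forall t g w, t \in Z -> w \in Z ->
    b (to t (coset H g)) w = b t (w ^ g^-1)%g.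
Proof.
have [tw twP] := adjoint_conj_exists.
have twZ t g : t \in Z -> tw t g \in Z by case/(twP t g).
have twE t g w : t \in Z -> w \in Z -> b (tw t g) w = b t (w ^ g^-1)%g.
  by case/(twP t g) => _; apply.
pose f (t : G) (x : coset_of H) := if t \in Z then tw t (repr x) else t.
have nH g : g \in 'N(H)%g by apply: (subsetP (normal_norm nHG)); rewrite inE.
have fE t g w : t \in Z -> w \in Z -> b (f t (coset H g)) w = b t (w ^ g^-1)%g.
  move=> tZ wZ; rewrite /f tZ twE // val_coset //; case: repr_rcosetP => h hH.
  have h'H : (h^-1)%g \in H by rewrite groupV.
  by rewrite invMg conjgM (center_conj_id h'H (center_conj _ wZ)).
have fZ t x : t \in Z -> f t x \in Z by move=> tZ; rewrite /f tZ twZ.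
have ext := pairing_inj bP.
have fM t : act_morph f t.
  move=> x y; have [tZ|ntZ] := boolP (t \in Z); last by rewrite /f !(negPf ntZ).
  have [g _ ->] := cosetP x; have [h _ ->] := cosetP y.
  rewrite -coset_morphM //; apply: ext => [||w wZ]; rewrite ?fZ //.
  by rewrite !fE ?fZ ?center_conj // invMg conjgM.
have f1 t : f t 1%g = t.
  have [tZ|ntZ] := boolP (t \in Z); last by rewrite /f !(negPf ntZ).
  rewrite -(coset_id (group1 H)); apply: ext => [||w wZ]; rewrite ?fZ //.
  by rewrite fE // invg1 conjg1.
have f_act : is_action ([set: G] / H)%g f.
  split=> [x|t x y _ _]; last exact: fM.
  by apply: (can_inj (g := f^~ x^-1%g)) => t; rewrite -fM mulgV f1.
pose to := Action f_act.
have to_gact : is_groupAction Z to.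
  move=> x Dx; rewrite inE; apply/andP; split.
    by apply/subsetP => t; rewrite inE actpermE /= /f; case: ifP => // _; rewrite eqxx.
  apply/morphicP => s t sZ tZ; rewrite !actpermE /=; have [g _ ->] := cosetP x.
  apply: ext => [||w wZ]; rewrite ?groupM ?fZ ?groupM //.
  by rewrite fE ?groupM // !(pairingMl bP) ?fZ ?center_conj // !fE.
by exists (GroupAction to_gact).
Qed.

End DualAction.

(** * The grading by cosets and central characters *)

Section GradingIdempotents.
Local Open Scope ring_scope.
Variables (k : closedFieldType) (char_k : [pchar k] =i pred0).
Variables (G : finGroupType) (H : {group G}).
Hypothesis nHG : (H <| [set: G])%g.
Local Notation Z := ('Z(H))%g.
Local Notation A := (group_algebra k H).
Local Notation C := (group_theoretical k H).
Variable b : G -> G -> k.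
Hypothesis bP : perfect_pairing Z b.
Variable to : groupAction ([set: G] / H)%g Z%G.
Hypothesis toE : forall t g w, t \in Z -> w \in Z ->
  b (to t (coset H g)) w = b t (w ^ g^-1)%g.
Local Notation U := (sdprod_by to).
Implicit Types (M N : bimod A) (a : U).

Let cardZ : #|Z|%:R != 0 :> k.
Proof. exact: (natf_neq0_char0 char_k (cardG_gt0 _)). Qed.

Lemma normal_norm_mem g : g \in 'N(H)%g.
Proof. by apply: (subsetP (normal_norm nHG)); rewrite inE. Qed.

Lemma subg_centerC w (h : subg_of H) : w \in Z -> (subg H w * h = h * subg H w)%g.
Proof.
move=> wZ; apply: val_inj => /=; rewrite subgK ?(subsetP (center_sub H)) //.
exact: esym (centerC (subgP h) wZ).
Qed.

Lemma center_conjM_l (h : subg_of H) g w : w \in Z -> (w ^ (sgval h * g)^-1 = w ^ g^-1)%g.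
Proof.
move=> wZ; have h'H : (sgval h)^-1%g \in H by rewrite groupV subgP.
by rewrite invMg conjgM (center_conj_id h'H (center_conj nHG _ wZ)).
Qed.

Lemma center_conjM_r (h : subg_of H) g w : w \in Z -> (w ^ (g * sgval h)^-1 = w ^ g^-1)%g.
Proof.
move=> wZ; have h'H : (sgval h)^-1%g \in H by rewrite groupV subgP.
by rewrite invMg conjgM (center_conj_id h'H wZ).
Qed.

(** The element [w] of ['Z(H)] acts on both sides of the part of degree [g], in
    such a way that the degree is preserved. These operators commute with the
    actions of [H] since [w^(g^-1)] is central in [H] and depends only on the
    coset of [g]. *)
Definition central_twist M g w (m : M) : M :=
  la (subg H (w ^ g^-1)%g) (ra m (subg H w^-1%g)).
Local Notation tw := central_twist.

Lemma twist_lin M g w : linear (@tw M g w).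
Proof. exact: linear_comp (la_lin _) (ra_lin _). Qed.

Lemma twist_gr M g w (m : M) : w \in Z -> m \in bgr M g -> tw g w m \in bgr M g.
Proof.
move=> wZ mg; have := la_gr (subg H (w ^ g^-1)%g) (ra_gr (subg H w^-1%g) mg).
have ZH := subsetP (center_sub H).
rewrite !subgK ?ZH ?groupV ?center_conj //.
suff -> : (w ^ g^-1 * (g * w^-1) = g)%g by [].
by rewrite conjgE invgK !mulgA mulgKV mulgK.
Qed.

Lemma twist_la M g w (h : subg_of H) (m : M) : w \in Z ->
  tw (sgval h * g)%g w (la h m) = la h (tw g w m).
Proof.
move=> wZ; rewrite /tw center_conjM_l // lara -!laM.
by rewrite subg_centerC ?center_conj.
Qed.

Lemma twist_ra M g w (h : subg_of H) (m : M) : w \in Z ->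
  tw (g * sgval h)%g w (ra m h) = ra (tw g w m) h.
Proof.
move=> wZ; rewrite /tw center_conjM_r // lara -!raM.
by rewrite subg_centerC ?groupV.
Qed.

Lemma twistM M g (w w' : G) (m : M) : w \in Z -> w' \in Z ->
  tw g (w * w')%g m = tw g w (tw g w' m).
Proof.
move=> wZ w'Z; have ZH := subsetP (center_sub H).
rewrite /tw lara -raM -laM -!subgM ?ZH ?groupV ?center_conj //.
by rewrite conjMg invMg.
Qed.

Lemma twist1 M g (m : M) : tw g 1%g m = m.
Proof. by rewrite /tw conj1g invg1 morph1 ra1 la1. Qed.

Lemma twist_hom M N (f : bimod_hom M N) g w m : f (tw g w m) = tw g w (f m).
Proof. by rewrite bhom_la bhom_ra. Qed.

Lemma coset_mull (h : subg_of H) g : coset H (sgval h * g)%g = coset H g.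
Proof. exact: coset_kerl (subgP h). Qed.

Lemma coset_mulr (h : subg_of H) g : coset H (g * sgval h)%g = coset H g.
Proof. exact: coset_kerr (subgP h). Qed.

Section Idempotent.
Variables (a : U) (M : bimod A).

Let phi g (m : M) : M :=
  if coset H g == a.1 then #|Z|%:R^-1 *: \sum_(w in Z) (b a.2 w)^-1 *: tw g w m else 0.

Let phi_lin g : linear (phi g).
Proof.
move=> c x y; rewrite /phi; case: ifP => _; last by rewrite scaler0 addr0.
rewrite scalerA mulrC -scalerA -scalerDr; congr (_ *: _).
rewrite scaler_sumr -big_split; apply: eq_bigr => w _ /=.
by rewrite twist_lin scalerDr !scalerA mulrC.
Qed.

Let phi_gr g m : m \in bgr M g -> phi g m \in bgr M g.
Proof.
move=> mg; rewrite /phi; case: ifP => _; last by rewrite mem0v.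
by rewrite memvZ // memv_suml // => w wZ; rewrite memvZ // twist_gr.
Qed.

Let phi_la g h m : m \in bgr M g -> phi (sgval h * g)%g (la h m) = la h (phi g m).
Proof.
move=> _; rewrite /phi coset_mull; case: ifP => _; last by rewrite (linear_0 (la_lin h)).
rewrite (linear_Z (la_lin h)) (linear_S _ _ _ (la_lin h)); congr (_ *: _).
by apply: eq_bigr => w wZ; rewrite (linear_Z (la_lin h)) twist_la.
Qed.

Let phi_ra g h m : m \in bgr M g -> phi (g * sgval h)%g (ra m h) = ra (phi g m) h.
Proof.
move=> _; rewrite /phi coset_mulr; case: ifP => _; last by rewrite (linear_0 (ra_lin h)).
rewrite (linear_Z (ra_lin h)) (linear_S _ _ _ (ra_lin h)); congr (_ *: _).
by apply: eq_bigr => w wZ; rewrite (linear_Z (ra_lin h)) twist_ra.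
Qed.

(** The projection to the part supported on the coset [a.1] on which the
    central twists act by the character [b a.2]. *)
Definition grade_idem : bimod_hom M M := ghom phi_lin phi_gr phi_la phi_ra.

Lemma grade_idemE g m : m \in bgr M g -> grade_idem m =
  if coset H g == a.1 then #|Z|%:R^-1 *: \sum_(w in Z) (b a.2 w)^-1 *: tw g w m else 0.
Proof. exact: ghomE. Qed.

End Idempotent.

Local Notation e := grade_idem.

Lemma sdprod_fst a : a.1 \in ([set: G] / H)%g.
Proof. by case: a => -[x t] /= /setXP[]. Qed.
Lemma sdprod_snd a : a.2 \in Z.
Proof. by case: a => -[x t] /= /setXP[]. Qed.

Lemma twist_grade_idem a M g w (m : M) : m \in bgr M g -> w \in Z ->
  tw g w (e a M m) = b a.2 w *: e a M m.
Proof.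
move=> mg wZ; rewrite (grade_idemE _ mg); case: ifP => _; last first.
  by rewrite (linear_0 (twist_lin _ _)) scaler0.
rewrite (linear_Z (twist_lin _ _)) (linear_S _ _ _ (twist_lin _ _)).
rewrite scalerA mulrC -scalerA; congr (_ *: _).
rewrite [in RHS](reindex_inj (mulgI w)) /= scaler_sumr.
apply: eq_big => [v|v vZ]; first by rewrite groupMl.
rewrite (linear_Z (twist_lin _ _)) -twistM // scalerA.
rewrite (pairingMr bP) ?sdprod_snd // invfM mulrA divff ?mul1r //.
by rewrite (pairing_neq0 bP) ?sdprod_snd.
Qed.

Lemma grade_idem_id a M g (m : M) : m \in bgr M g -> coset H g = a.1 ->
  (forall w, w \in Z -> tw g w m = b a.2 w *: m) -> e a M m = m.
Proof.
move=> mg ga tm; rewrite (grade_idemE _ mg) ga eqxx.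
rewrite (eq_bigr (fun=> m)); last first.
  move=> w wZ; rewrite tm // scalerA mulVf ?scale1r //.
  by rewrite (pairing_neq0 bP) ?sdprod_snd.
by rewrite sumr_const -scaler_nat scalerA mulVf // scale1r.
Qed.

Lemma grade_idem_coset a M g (m : M) : m \in bgr M g -> e a M m = m -> m != 0 ->
  coset H g = a.1.
Proof. by move=> mg; rewrite (grade_idemE _ mg); case: eqP => // _ <-; rewrite eqxx. Qed.

Lemma grade_idem_nat a M N (f : bimod_hom M N) :
  bcomp (e a N) f = bcomp f (e a M).
Proof.
apply: bhom_ext_homogeneous => g m mg; rewrite !bcompE.
rewrite (grade_idemE _ (bhom_gr f mg)) (grade_idemE _ mg).
case: ifP => _; last by rewrite (linear_0 (bhom_linear f)).
rewrite (linear_Z (bhom_linear f)) (linear_S _ _ _ (bhom_linear f)).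
by congr (_ *: _); apply: eq_bigr => w _; rewrite (linear_Z (bhom_linear f)) twist_hom.
Qed.

Lemma grade_idem_orth a a' M : a != a' -> bcomp (e a' M) (e a M) = 0.
Proof.
move=> ne; apply: bhom_ext_homogeneous => g m mg; rewrite bcompE bhom0E.
rewrite (grade_idemE a' (bhom_gr (e a M) mg)).
case: eqP => // ga'; have [ga|/eqP nga] := coset H g =P a.1; last first.
  rewrite (grade_idemE _ mg) (negPf nga) big1 ?scaler0 // => w _.
  by rewrite (linear_0 (twist_lin _ _)) scaler0.
rewrite (eq_bigr (fun w => b (a'.2^-1 * a.2)%g w *: e a M m)); last first.
  move=> w wZ; rewrite (twist_grade_idem _ mg) // scalerA.
  by rewrite (pairingMl bP) ?groupV ?sdprod_snd // (pairingVl bP) ?sdprod_snd.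
have ad : (a'.2^-1 * a.2)%g \in Z by rewrite groupM ?groupV ?sdprod_snd.
rewrite -scaler_suml (eq_bigr (fun w => b w (a'.2^-1 * a.2)%g)); last first.
  by move=> w wZ; rewrite (pairing_sym bP).
rewrite (pairing_sum bP) // -eq_mulVg1; case: eqP => [E|_]; last by rewrite scale0r scaler0.
case/eqP: ne; apply: val_inj; rewrite /= [LHS]surjective_pairing [RHS]surjective_pairing.
by rewrite -ga -ga' E.
Qed.

Definition grade_index x t : U := insubd (1%g : U) (x, t).

Lemma grade_indexE x t : x \in ([set: G] / H)%g -> t \in Z ->
  grade_index x t = (x, t) :> _ * _.
Proof. by move=> xD tZ; rewrite /grade_index val_insubd inE /= xD tZ. Qed.

Lemma sum_grade_index (V : lmodType k) x (F : G -> V) : x \in ([set: G] / H)%g ->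
  \sum_(a : U | a.1 == x) F a.2 = \sum_(t in Z) F t.
Proof.
move=> xD; rewrite (reindex_onto (grade_index x) (fun a : U => a.2)) /=; last first.
  move=> a /eqP <-; apply: val_inj.
  exact: etrans (grade_indexE (sdprod_fst a) (sdprod_snd a)) (esym (surjective_pairing _)).
apply: eq_big => [t|t /andP[_ /eqP->]//].
have [tZ|ntZ] := boolP (t \in Z); first by rewrite grade_indexE // !eqxx.
by apply/negP => /andP[_ /eqP E]; case/negP: ntZ; rewrite -E sdprod_snd.
Qed.

Lemma grade_idem_sum M : \sum_(a : U) e a M = bid M.
Proof.
apply: bhom_ext_homogeneous => g m mg; rewrite bhom_sumE bidE.
transitivity (\sum_(a : U | a.1 == coset H g)
   #|Z|%:R^-1 *: \sum_(w in Z) (b a.2 w)^-1 *: tw g w m).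
  rewrite [RHS]big_mkcond /=; apply: eq_bigr => a _.
  by rewrite (grade_idemE _ mg) eq_sym.
rewrite (sum_grade_index (fun t => #|Z|%:R^-1 *: \sum_(w in Z) (b t w)^-1 *: tw g w m)).
  rewrite -scaler_sumr exchange_big /=.
  rewrite (bigD1 1%g) //= [X in _ + X]big1 => [|w /andP[wZ nw1]].
    rewrite addr0 (eq_bigr (fun=> m)) => [|t tZ].
      by rewrite sumr_const -scaler_nat scalerA mulVf // scale1r.
    by rewrite (pairing1r bP) // invr1 scale1r twist1.
  rewrite -scaler_suml (eq_bigr (fun t => b t w^-1%g)) => [|t tZ].
    by rewrite (pairing_sum bP) ?groupV // invg_eq1 (negPf nw1) scale0r.
  by rewrite (pairingVr bP).
by rewrite mem_quotient ?inE.
Qed.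

Lemma grade_idem_unit : e (1%g : U) (bunit A) = bid (bunit A).
Proof.
apply: bhom_ext_homogeneous => g m mg; rewrite bidE.
have [gH|ngH] := boolP (g \in H); last first.
  have -> : m = 0; last exact: (linear_0 (bhom_linear _)).
  apply/ffunP => x; rewrite (ga_grE mg) ?ffunE //.
  by apply: contra ngH => /eqP <-; apply: subgP.
apply: (grade_idem_id mg) => [|w wZ]; first by rewrite coset_id.
have g'H : (g^-1)%g \in H by rewrite groupV.
rewrite (pairing1l bP) // scale1r /tw (center_conj_id g'H wZ).
have ZH := subsetP (center_sub H).
have -> : ra m (subg H w^-1%g) = la (subg H w^-1%g) m.
  apply/ffunP => x.
  rewrite [LHS](@ga_basis_mulr k G H (subg H w^-1%g) x (m : grpalg k H)).
  rewrite [RHS](@ga_basis_mull k G H (subg H w^-1%g) x (m : grpalg k H)).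
  by rewrite -morphV ?ZH ?groupV // invgK subg_centerC.
by rewrite -laM -subgM ?ZH ?groupV // mulgV morph1 la1.
Qed.

(** Moving [w^((g g')^-1)] through [m (x) n] costs the character of [m] at
    [w^(g'^-1)] and then that of [n] at [w], which is the product rule of the
    semidirect product. *)
Lemma grade_idem_tens a a' M N : e a M = bid M -> e a' N = bid N ->
  e (a * a')%g (btens M N) = bid (btens M N).
Proof.
move=> eM eN; apply: bext => m n; rewrite bidE.
move: n; apply: homogeneous_ext => [||g' n ng'].
- exact: linear_comp (bhom_linear _) (pt_linr m).
- exact: pt_linr.
move: m; apply: homogeneous_ext => [||g m mg].
- exact: linear_comp (bhom_linear _) (pt_linl n).
- exact: pt_linl.
have [->|nzm] := eqVneq m 0.
  by rewrite (linear_0 (pt_linl n)) (linear_0 (bhom_linear _)).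
have [->|nzn] := eqVneq n 0.
  by rewrite (linear_0 (pt_linr m)) (linear_0 (bhom_linear _)).
have em : e a M m = m by rewrite eM bidE.
have en : e a' N n = n by rewrite eN bidE.
have ga := grade_idem_coset mg em nzm.
have ga' := grade_idem_coset ng' en nzn.
apply: (grade_idem_id (pt_gr mg ng')) => [|w wZ].
  by rewrite coset_morphM ?normal_norm_mem // ga ga'.
have w'Z := center_conj nHG g'^-1%g wZ.
have ZH := subsetP (center_sub H).
have tm : la (subg H (w ^ (g * g')^-1)%g) m =
    b a.2 (w ^ g'^-1)%g *: ra m (subg H (w ^ g'^-1)%g).
  have := twist_grade_idem a mg w'Z; rewrite em /tw => E.
  rewrite -(linear_Z (ra_lin _)) -E lara -raM -subgM ?ZH ?groupV // mulVg morph1 ra1.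
  by rewrite invMg conjgM.
have tn : la (subg H (w ^ g'^-1)%g) (ra n (subg H w^-1%g)) = b a'.2 w *: n.
  by have := twist_grade_idem a' ng' wZ; rewrite en.
rewrite /tw {1}/la {1}/ra pt_ract pt_lact -/(la _ m) -/(ra n _) tm.
rewrite (linear_Z (pt_linl _)) /ra pt_bal -/(ra n _) -/(la _ (ra n _)) tn.
rewrite (linear_Z (pt_linr _)) scalerA; congr (_ *: _).
rewrite (pairingMl bP) ?gact_stable ?sdprod_snd ?sdprod_fst //.
by rewrite -ga' toE ?sdprod_snd.
Qed.

End GradingIdempotents.

(** * Universality of the grading *)

Section UniversalGradingGroup.
Local Open Scope ring_scope.
Variables (k : closedFieldType) (char_k : [pchar k] =i pred0).
Variables (G : finGroupType) (H : {group G}).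
Hypothesis nHG : (H <| [set: G])%g.
Local Notation Z := ('Z(H))%g.
Local Notation A := (group_algebra k H).
Local Notation C := (group_theoretical k H).
Variable b : G -> G -> k.
Hypothesis bP : perfect_pairing Z b.
Variable to : groupAction ([set: G] / H)%g Z%G.
Hypothesis toE : forall t g w, t \in Z -> w \in Z ->
  b (to t (coset H g)) w = b t (w ^ g^-1)%g.
Local Notation U := (sdprod_by to).

Let cardH : #|H|%:R != 0 :> k.
Proof. exact: (natf_neq0_char0 char_k (cardG_gt0 _)). Qed.

Definition grading_idem (a : U) (X : C) : chom X X := grade_idem nHG b a X.
Local Notation e := grading_idem.

Lemma grading_idem_nat (a : U) (X Y : C) (f : chom X Y) : ccomp (e a Y) f = ccomp f (e a X).
Proof. exact: grade_idem_nat. Qed.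

Lemma grading_idem_orth (a a' : U) (X : C) : a != a' -> ccomp (e a' X) (e a X) = 0.
Proof. exact: grade_idem_orth. Qed.

Lemma grading_idem_sum (X : C) : \sum_(a : U) e a X = cid X.
Proof. exact: (grade_idem_sum char_k nHG bP to). Qed.

Lemma grading_idem_unit : e 1%g cunit = cid cunit.
Proof. exact: (grade_idem_unit char_k nHG bP to). Qed.

Lemma grading_idem_tens (a a' : U) (X Y : C) : e a X = cid X -> e a' Y = cid Y ->
  e (a * a')%g (tens X Y) = cid (tens X Y).
Proof. exact: (grade_idem_tens char_k bP toE). Qed.

Local Notation Cg := (idem_component e).
Let kerC : has_kernels C := @bimod_has_kernels k G A.

(** An element of the free bimodule with central support acts on the whole
    component through one scalar, given by its character. *)
Lemma grading_component_hom (a : U) g (M : C) :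
    Cg a M -> coset H g = a.1 -> forall (f : bimod_hom (free_bimod k H g) M) u,
    u \in bgr (free_bimod k H g) g ->
    (forall x, free_coef u x != 0 -> forall w, (x.1 * w = w * x.1)%g) ->
  f u = (\sum_x (free_coef u x : k) * b a.2 (sgval x.1 ^ g)%g) *: f (free_gen k H g).
Proof.
move=> aM ga f u ug central; rewrite free_bhomE scaler_suml; apply: eq_bigr => x _.
have [u0|nzu] := eqVneq (free_coef u x) 0; first by rewrite u0 mul0r !scale0r.
rewrite -scalerA; congr (_ *: _).
have mg := bhom_gr f (free_gen_gr k H g); set m := f _ in mg *.
have x1Z : sgval x.1 \in Z.
  apply/centerP; split=> [|h hH]; first exact: subgP.
  have := congr1 sgval (central x nzu (subg H h)).
  by rewrite /= subgK.
have degx : (sgval x.1 * g * sgval x.2 = g)%g.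
  apply/eqP/negPn/negP => ne; case/eqP: nzu.
  exact: free_coef_gr ug ne.
have wZ := center_conj nHG g x1Z.
have em : grade_idem nHG b a M m = m.
  by rewrite -[grade_idem _ _ _ _]/(e a M) (aM : e a M = cid M) bimod_cidE.
have := twist_grade_idem nHG bP a mg wZ; rewrite em => <-.
rewrite /central_twist conjgK sgvalK; congr (la _ (ra m _)).
apply: val_inj => /=; rewrite subgK; last first.
  by rewrite groupV (subsetP (center_sub H)).
by apply: (mulgI (sgval x.1 * g)%g); rewrite degx conjgE !invMg invgK !mulgA mulgK mulgV mul1g.
Qed.

(** The component of the free bimodule of degree [g] is nonzero: the projection
    of the generator still has coefficient [1/|Z|] at the generator. *)
Lemma grading_component_nonzero (a : U) : exists2 X, Cg a X & ~ is_zero X.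
Proof.
pose g := repr a.1; have ga : coset H g = a.1 by apply: coset_reprK.
pose P := free_bimod k H g.
have [Y CY [inj [prj [_ _ ip]]]] :=
  component_decomposition kerC grading_idem_nat grading_idem_orth grading_idem_sum (P : C).
exists (Y a) => // Y0; have : e a (P : C) = 0.
  by rewrite -ip (hom_from_zero (inj a) Y0) comp0m.
move=> /(congr1 (fun f : bimod_hom P P => f (free_gen k H g))).
rewrite bhom0E (grade_idemE _ _ _ (free_gen_gr k H g)) ga eqxx => /eqP.
rewrite scaler_eq0 invr_eq0 (negPf (natf_neq0_char0 char_k (cardG_gt0 _))) /=.
pose ev (u : P) : k^o := free_coef u (1%g, 1%g).
have flin : linear ev by exact: free_coef_linear.
have evE w : w \in Z -> ev ((b a.2 w)^-1 *: central_twist g w (free_gen k H g)) =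
    if w == 1%g then 1 else 0.
  move=> wZ; rewrite (linear_Z flin).
  have -> : ev (central_twist g w (free_gen k H g)) =
      ((1%g, 1%g) == (subg H (w ^ g^-1)%g, subg H w^-1%g))%:R.
    exact: (@free_gen_trans k G H g (subg H (w ^ g^-1)%g, subg H w^-1%g) (1%g, 1%g)).
  case: (w =P 1%g) => [->|/eqP nw1].
    rewrite conj1g invg1 morph1 eqxx (pairing1r bP) ?sdprod_snd // invr1.
    exact: scale1r.
  rewrite xpair_eqE; case: (_ =P subg H w^-1%g) => [E|_]; last by rewrite andbF scaler0.
  case/eqP: nw1; apply: invg_inj; rewrite invg1.
  by have := congr1 sgval E; rewrite /= subgK // groupV (subsetP (center_sub H)).
move=> /eqP/(congr1 ev); rewrite (linear_0 flin) (linear_S _ _ _ flin).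
rewrite (eq_bigr _ evE) -big_mkcondr (big_pred1 1%g) => [|w]; last first.
  by rewrite /=; case: eqP => [->|_]; rewrite ?group1 ?andbF.
by move/eqP; rewrite oner_eq0.
Qed.

(** If both summands of a decomposition of a component were nonzero, the
    idempotent of the decomposition on the free bimodule of that degree would
    act on the component both as the identity and as zero. But compatibility
    with the adjoint subcategory forces its coefficients to be supported on
    the center of [H], where it acts by one and the same scalar. *)
Lemma grading_component_indecomposable (a : U) :
  indecomposable_bimodule_cat (@adjoint_subcat k C) (Cg a).
Proof.
split=> [zC|N decN].
  by have [X aX nzX] := grading_component_nonzero a; apply/nzX/zC.
pose g := repr a.1; have ga : coset H g = a.1 by apply: coset_reprK.
pose P := free_bimod k H g.
have ad1 (V : C) : adjoint_subcat V -> Cg 1%g V.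
  exact: (adjoint_component kerC grading_idem_nat grading_idem_orth grading_idem_sum
    grading_idem_unit grading_idem_tens).
have [q [qT qF qV]] := decomposition_idempotent kerC grading_idem_nat grading_idem_orth
  grading_idem_sum grading_idem_tens (P : C) ad1 decN.
pose u : P := (q : bimod_hom P P) (free_gen k H g).
have central x : free_coef u x != 0 -> forall w, (x.1 * w = w * x.1)%g.
  by apply: (free_end_central cardH) => V F; apply: (qV V F).
have ug : u \in bgr P g by apply: bhom_gr; apply: free_gen_gr.
pose c : k := \sum_x (free_coef u x : k) * b a.2 (sgval x.1 ^ g)%g.
have actM (M : C) : Cg a M -> ~ is_zero M -> exists (f : bimod_hom P (M : bimod A)),
    f (free_gen k H g) != 0 /\ f u = c *: f (free_gen k H g).
  move=> aM nzM; have [m0 nzm0] : exists m : (M : bimod A), m != 0.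
    apply: contrapT => /forallNP M0; apply: nzM; apply/bimod_zeroP => m.
    by apply/eqP/negPn/negP; apply: M0.
  have [g' [m m_g' nzm]] := homogeneous_neq0 nzm0.
  have em : grade_idem nHG b a (M : bimod A) m = m.
    by rewrite -[grade_idem _ _ _ _]/(e a M) (aM : e a M = cid M) bimod_cidE.
  have ga' := grade_idem_coset m_g' em nzm.
  have gg'H : (g * g'^-1)%g \in H.
    apply: coset_idr; first exact: normal_norm_mem.
    have gV : coset H g'^-1%g = (a.1)^-1%g.
      by rewrite -ga'; apply: (morphV (coset_morphism H)); apply: normal_norm_mem.
    by rewrite coset_morphM ?normal_norm_mem // ga gV mulgV.
  have mg := la_gr (subg H (g * g'^-1)%g) m_g'.
  rewrite subgK // mulgKV in mg.
  have [f fg] := free_hom mg; exists f; split; last exact: (grading_component_hom aM).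
  rewrite fg; apply: contra nzm => /eqP E.
  by rewrite -[m](laK (subg H (g * g'^-1)%g)) E (linear_0 (la_lin _)).
have NC : forall s X, N s X -> Cg a X by case: decN.
apply: contrapT => /forallNP nzN.
have [/existsNP[M1 /not_implyP[NM1 nzM1]] /existsNP[M0 /not_implyP[NM0 nzM0]]] :=
  (nzN true, nzN false).
have [f1 [f1g f1u]] := actM M1 (NC _ _ NM1) nzM1.
have [f0 [f0g f0u]] := actM M0 (NC _ _ NM0) nzM0.
have c1 : c = 1.
  have E : f1 u = f1 (free_gen k H g).
    have /(congr1 (fun f : bimod_hom P _ => f (free_gen k H g))) := qT M1 f1 NM1.
    by rewrite bimod_compE.
  have /eqP : (c - 1) *: f1 (free_gen k H g) = 0 by rewrite scalerBl scale1r -f1u E subrr.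
  by rewrite scaler_eq0 (negPf f1g) orbF subr_eq0 => /eqP.
have := qF M0 f0 NM0; move=> /(congr1 (fun f : bimod_hom P _ => f (free_gen k H g))).
rewrite bimod_compE -/u f0u c1 scale1r bhom0E => /eqP.
by rewrite (negPf f0g).
Qed.

Lemma sdprod_universal_grading : universal_grading (Cg : U -> C -> Prop).
Proof.
split; [|exact: grading_component_indecomposable|].
  exact: (components_dsum_bimodule_cat kerC grading_idem_nat grading_idem_orth
    grading_idem_sum grading_idem_unit grading_idem_tens).
by move=> a a' X Y; apply: grading_idem_tens.
Qed.

End UniversalGradingGroup.

(** * The split extension *)

Section SplitExtension.
Local Open Scope group_scope.

Lemma sdprod_by_split_exact (aT rT uT : finGroupType) (D : {group aT})
    (R : {group rT}) (to : groupAction D R) (f : sdprod_by to -> uT) :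
    bijective f -> {morph f : x y / x * y} ->
  exists (i : {morphism R >-> uT}) (p : {morphism [set: uT] >-> aT})
      (s : {morphism D >-> uT}),
    [/\ split_exact i p s,
        forall z x, z \in R -> x \in D -> i (to z x) = i z ^ s x
      & [set: uT] \isog [set: sdprod_by to]].
Proof.
move=> [f' fK f'K] fM.
have f'M : {morph f' : x y / x * y} by move=> x y; rewrite -{1}[x]f'K -{1}[y]f'K -fM fK.
have iM : {in R &, {morph (fun z => f (sdpair1 to z)) : x y / x * y}}.
  by move=> x y xR yR; rewrite /= morphM // fM.
have sM : {in D &, {morph (fun x => f (sdpair2 to x)) : x y / x * y}}.
  by move=> x y xD yD; rewrite /= morphM // fM.
have pM : {in [set: uT] &, {morph (fun v => (f' v).1) : x y / x * y}}.
  by move=> x y _ _; rewrite f'M.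
exists (Morphism iM), (Morphism pM), (Morphism sM); split.
- split.
  + apply/injmP => x y xR yR /= /(can_inj fK).
    by move/injmP: (injm_sdpair1 to); apply.
  + apply/setP => v; apply/morphimP/idP => [[z _ zR ->]|].
      by apply/kerP; rewrite ?inE //= fK val_insubd inE group1 zR.
    move/kerP; rewrite inE /= => /(_ isT) v1; exists (f' v).2.
    * by case: (f' v) => -[a x] /= /setXP[].
    * by case: (f' v) => -[a x] /= /setXP[].
    by rewrite /= -[LHS]f'K {1}[f' v]sdpairE v1 morph1 mul1g.
  + apply/setP => x; apply/morphimP/idP => [[v _ _ ->]|xD] /=.
      by case: (f' v) => -[a z] /= /setXP[].
    by exists (f (sdpair2 to x)); rewrite ?inE //= fK val_insubd inE xD group1.
  by move=> x xD /=; rewrite fK val_insubd inE xD group1.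
- move=> z x zR xD /=; rewrite sdpair_act //.
  have fV y : f y^-1 = (f y)^-1.
    by apply: (mulgI (f y)); rewrite mulgV -fM mulgV; apply: (mulgI (f 1)); rewrite -fM !mulg1.
  by rewrite /conjg !fM fV.
have f'T : {in [set: uT] &, {morph f' : x y / x * y}} by move=> x y _ _.
apply/isogP; exists (Morphism f'T).
  by apply/injmP => x y _ _ /=; apply: (can_inj f'K).
apply/setP => x; rewrite inE; apply/morphimP; exists (f x); rewrite ?inE //=.
Qed.

End SplitExtension.

Import GroupScope.

Theorem proposition6p3 (k : closedFieldType) (char_k : [pchar k]%R =i pred0)
    (G : finGroupType) (H : {group G}) (nHG : H <| [set: G]) :
  let C := group_theoretical k H in
  (exists (U : finGroupType) (Cg : U -> C -> Prop), universal_grading Cg) /\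
  (forall (U : finGroupType) (Cg : U -> C -> Prop), universal_grading Cg ->
     exists (i : {morphism 'Z(H) >-> U}) (p : {morphism [set: U] >-> coset_of H})
       (s : {morphism [set: G] / H >-> U}) (to : groupAction ([set: G] / H) 'Z(H)),
       [/\ split_exact i p s,
           forall z x, z \in 'Z(H) -> x \in [set: G] / H ->
             i (to z x) = i z ^ s x
         & [set: U] \isog [set: sdprod_by to]]).
Proof.
move=> C; have [b bP] := abelian_perfect_pairing char_k (center_abelian H).
have [to toE] := dual_action char_k nHG bP.
have U0 := sdprod_universal_grading char_k nHG bP toE.
split; first by eexists; eexists; exact: U0.
move=> U Cg UCg.
have [f [f_bij fM]] := universal_grading_unique (@bimod_has_kernels k G _)
  (@bimod_tens_nonzero k G H) U0 UCg.
have [i [p [s H3]]] := sdprod_by_split_exact f_bij fM.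
by exists i, p, s, to.
Qed.
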